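(* Let $0<\gamma,\alpha\le1$, $f\in L^2(Q)$, $y^0\in L^2(a,b)$ and $v\in L^2(0,T)$, where $Q=(0,T)\times(a,b)$. Then there exists a unique very-weak solution $y\in L^2(Q)$ of $$\begin{cases}\mathcal D_t^\gamma y+\mathcal D_{b^-}^\alpha(\beta\,\mathbb D_{a^+}^\alpha y)+q\,y=f&\text{in }Q,\\ (I_{a^+}^{1-\alpha}y)(\cdot,a^+)=0&\text{in }(0,T),\\ (\beta\,\mathbb D_{a^+}^\alpha y)(\cdot,b^-)=v&\text{in }(0,T),\\ y(0,\cdot)=y^0&\text{in }(a,b).\end{cases}$$ Moreover, there is a constant $C>0$ such that $$\|y\|_{L^2(Q)}\le C\left(\|f\|_{L^2(Q)}+\|y^0\|_{L^2(a,b)}+\|v\|_{L^2(0,T)}\right).$$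
   Context: Let $0\le a<b$, $T>0$. For $0<s<1$: $I_{a^+}^{s}f(x)=\frac1{\Gamma(s)}\int_a^x(x-t)^{s-1}f(t)\,dt$, $I_{b^-}^{s}f(x)=\frac1{\Gamma(s)}\int_x^b(t-x)^{s-1}f(t)\,dt$, and $I^0$ is the identity. For $0<\alpha\le1$: $\mathbb D_{a^+}^\alpha f=\frac{d}{dx}I_{a^+}^{1-\alpha}f$ (left Riemann–Liouville derivative), $\mathcal D_{b^-}^\alpha f=-I_{b^-}^{1-\alpha}f'$ (right Caputo derivative). In time on $(0,T)$: $\mathcal D_t^\gamma y=I_{0^+}^{1-\gamma}\partial_ty$ (left Caputo), $I_T^{1-\gamma}=I_{T^-}^{1-\gamma}$, $\mathbb D_T^\gamma=-\frac{d}{dt}I_{T^-}^{1-\gamma}$ (right Riemann–Liouville). Standing assumptions: $\beta\in C[a,b]$, $q\in L^\infty(a,b)$, and there are constants $\beta_0,q_0>0$ with $\beta(x)\ge\beta_0$ for all $x\in[a,b]$ and $q(x)\ge q_0$ for a.e. $x$. $H^\alpha_{a^+}(a,b)=\{\rho\in L^2(a,b):\mathbb D_{a^+}^\alpha\rho\in L^2(a,b)\}$ with the graph norm, $D(\mathcal E)=\{u\in H^\alpha_{a^+}(a,b):(I_{a^+}^{1-\alpha}u)(a)=0\}$, $\mathcal E(y,z)=\int_a^b\beta\,\mathbb D_{a^+}^\alpha y\,\mathbb D_{a^+}^\alpha z\,dx+\int_a^bq\,y\,z\,dx$ on $D(\mathcal E)$. $A$ is the self-adjoint operator in $L^2(a,b)$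 associated with $\mathcal E$: $u\in D(A)$, $Au=f$ iff $u\in D(\mathcal E)$, $f\in L^2(a,b)$ and $\mathcal E(u,v)=(f,v)_{L^2(a,b)}$ for all $v\in D(\mathcal E)$. Explicitly, $D(A)=\{u\in D(\mathcal E):\mathcal D_{b^-}^\alpha(\beta\mathbb D_{a^+}^\alpha u)\in L^2(a,b),\ (\beta\mathbb D_{a^+}^\alpha u)(b)=0\}$ and $Au=\mathcal D_{b^-}^\alpha(\beta\mathbb D_{a^+}^\alpha u)+qu$. A function $y\in L^2(Q)$ is a very-weak solution of the system if $$\int_Qy\left(\mathbb D_T^\gamma\phi+\mathcal D_{b^-}^\alpha(\beta\mathbb D_{a^+}^\alpha\phi)+q\phi\right)dx\,dt=\int_Qf\phi\,dx\,dt+\int_a^by^0\,I_T^{1-\gamma}\phi(0,x)\,dx+\int_0^Tv(t)\,I_{a^+}^{1-\alpha}\phi(t,b^-)\,dt$$ for all $\phi\in\Psi=\{\phi\in L^2((0,T);D(A)):\ \mathbb D_T^\gamma\phi\in L^2(Q),\ I_T^{1-\gamma}\phi\in C([0,T];L^2(a,b)),\ I_T^{1-\gamma}\phi(T,\cdot)=0\}$. *)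

(* Defs.v *)
From HB Require Import structures.
From mathcomp Require Import all_boot all_order all_algebra.
From mathcomp Require Import all_classical all_reals all_analysis.

Set Implicit Arguments.
Unset Strict Implicit.
Unset Printing Implicit Defensive.

Import Order.TTheory GRing.Theory Num.Theory.
Import numFieldNormedType.Exports.

Local Open Scope classical_set_scope.
Local Open Scope ring_scope.

Notation leb := (@lebesgue_measure _).

Notation leb2 := (@lebesgue_measure _ \x @lebesgue_measure _)%E.

(* Elements of L^p(D) are represented by everywhere defined functions; only
   their values on D matter, and equality is equality a.e. on D. *)
Definition inLp d (X : measurableType d) (R : realType)
    (m : {measure set X -> \bar R}) (p : \bar R) (D : set X) (f : X -> R) :=
  f \_ D \in Lfun m p.

Definition normL2 d (X : measurableType d) (R : realType)
    (m : {measure set X -> \bar R}) (D : set X) (f : X -> R) : \bar R :=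
  Lnorm m 2%:E (EFin \o (f \_ D)).

Section FractionalCalculus.
Context {R : realType}.
Implicit Types (f g u F : R -> R) (a b c d s x alpha gamma T : R).

Definition Gamma s : R :=
  \int[leb]_(x in `]0, +oo[) (x `^ (s - 1) * expR (- x)).

(* I_{a+}^s f and I_{b-}^s f, for 0 <= s < 1 *)
Definition frac_int_left a s f x : R :=
  if s == 0 then f x
  else (Gamma s)^-1 * \int[leb]_(t in `]a, x[) ((x - t) `^ (s - 1) * f t).

Definition frac_int_right b s f x : R :=
  if s == 0 then f x
  else (Gamma s)^-1 * \int[leb]_(t in `]x, b[) ((t - x) `^ (s - 1) * f t).

(* C^1 functions with compact support in (a, b) *)
Definition test_function a b (chi : R -> R) :=
  [/\ forall x, derivable chi x 1,
      continuous (derive1 chi) &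
      exists c d, [/\ a < c, d < b & forall x, x \notin `[c, d] -> chi x = 0]].

(* g is the derivative dF/dx on (a, b), in the Sobolev space W^{1,1}(a, b).
   The fractional integral of an L^2 function is only defined a.e., so that
   d/dx in the Riemann-Liouville derivatives is the weak derivative. *)
Definition is_wderiv a b F g :=
  [/\ leb.-integrable `]a, b[ (EFin \o F),
      leb.-integrable `]a, b[ (EFin \o g) &
      forall chi, test_function a b chi ->
        \int[leb]_(x in `]a, b[) (F x * derive1 chi x) =
        - \int[leb]_(x in `]a, b[) (g x * chi x)].

(* The representative of F that is continuous on [a, b]; it exists as soon as
   F has a weak derivative in the sense above, and gives a meaning to the
   boundary values of F. *)
Definition cont_repr a b F : R -> R :=
  xget (cst 0) [set G | {within `[a, b], continuous G} /\
                        {ae leb, forall x, x \in `]a, b[ -> F x = G x}].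

(* g = D_{a+}^alpha f on (a, b) *)
Definition is_left_RL a b alpha f g :=
  is_wderiv a b (frac_int_left a (1 - alpha) f) g.

(* g = D_T^gamma f on (0, T) *)
Definition is_right_RL T gamma f g :=
  is_wderiv 0 T (frac_int_right T (1 - gamma) f) (fun t => - g t).

(* is_left_RL determines g up to equality a.e. on (a, b); left_RL picks one
   representative. *)
Definition left_RL a b alpha f : R -> R :=
  xget (cst 0) [set g | is_left_RL a b alpha f g].

(* the value (I_{a+}^{1-alpha} f)(x) for x in [a, b], endpoints included *)
Definition frac_trace a b alpha f x : R :=
  cont_repr a b (frac_int_left a (1 - alpha) f) x.

Definition H_left a b alpha u :=
  [/\ inLp leb 2%:E `]a, b[ u,
      exists g, is_left_RL a b alpha u g &
      inLp leb 2%:E `]a, b[ (left_RL a b alpha u)].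

Definition dom_form a b alpha u :=
  H_left a b alpha u /\ frac_trace a b alpha u a = 0.

Definition energy_form a b alpha (beta q : R -> R) (y z : R -> R) : R :=
  \int[leb]_(x in `]a, b[)
     (beta x * left_RL a b alpha y x * left_RL a b alpha z x) +
  \int[leb]_(x in `]a, b[) (q x * y x * z x).

(* The graph of the self-adjoint operator A associated with the form:
   u \in D(A) and A u = w.  This w is the meaning of
   D_{b-}^alpha (beta D_{a+}^alpha u) + q u for u in D(A). *)
Definition graphA a b alpha beta q u w :=
  [/\ dom_form a b alpha u,
      inLp leb 2%:E `]a, b[ w &
      forall z, dom_form a b alpha z ->
        energy_form a b alpha beta q u z = \int[leb]_(x in `]a, b[) (w x * z x)].

(* J \in C([0, T]; L^2(a, b)) *)
Definition continuous_L2 T a b (J : R -> R -> R) :=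
  (forall t, t \in `[0, T] -> inLp leb 2%:E `]a, b[ (J t)) /\
  (forall t0, t0 \in `[0, T] ->
     normL2 leb `]a, b[ (fun x => J t x - J t0 x)
       @[t --> within `[0, T] (nbhs t0)] --> 0%E).

Definition domQ T a b : set (R * R) := `]0, T[ `*` `]a, b[.

(* phi \in Psi together with w = A phi, psi = D_T^gamma phi and
   J = I_T^{1-gamma} phi, which are determined by phi a.e. on Q (J(t, .) for
   every t, a.e. on (a, b)).  L^2((0, T); L^2(a, b)) is identified with
   L^2(Q), and phi \in L^2((0, T); D(A)) means that phi and A phi are in it. *)
Definition in_Psi T a b gamma alpha (beta q : R -> R)
    (phi w psi : R * R -> R) (J : R -> R -> R) :=
  [/\ inLp leb2 2%:E (domQ T a b) phi,
      inLp leb2 2%:E (domQ T a b) w /\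
      {ae leb, forall t, t \in `]0, T[ ->
         graphA a b alpha beta q (fun x => phi (t, x)) (fun x => w (t, x))},
      inLp leb2 2%:E (domQ T a b) psi /\
      {ae leb, forall x, x \in `]a, b[ ->
         is_right_RL T gamma (fun t => phi (t, x)) (fun t => psi (t, x))},
      continuous_L2 T a b J /\
      {ae leb, forall t, t \in `]0, T[ -> {ae leb, forall x, x \in `]a, b[ ->
         J t x = frac_int_right T (1 - gamma) (fun r => phi (r, x)) t}} &
      {ae leb, forall x, x \in `]a, b[ -> J T x = 0}].

Definition very_weak_solution T a b gamma alpha (beta q : R -> R)
    (f : R * R -> R) (y0 v : R -> R) (y : R * R -> R) :=
  inLp leb2 2%:E (domQ T a b) y /\
  forall phi w psi J, in_Psi T a b gamma alpha beta q phi w psi J ->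
    \int[leb2]_(z in domQ T a b) (y z * (psi z + w z)) =
    \int[leb2]_(z in domQ T a b) (f z * phi z) +
    \int[leb]_(x in `]a, b[) (y0 x * J 0 x) +
    \int[leb]_(t in `]0, T[)
      (v t * frac_trace a b alpha (fun x => phi (t, x)) b).

End FractionalCalculus.

(* Main.v *)
(* Let J = I_{a+}^alpha in space and let W be the right fractional integral of
   order gamma in time. Since I^{1-alpha} I^alpha = I^1, du Bois-Reymond's lemma
   shows that phi is in Psi, with psi = D_T^gamma phi and w = A phi, if and only
   if phi = W psi = J g, where g = D_{a+}^alpha phi solves the elliptic problem
   form g z = (w, J z) for all z, with form g z = (beta g, z) + (q J g, J z); then
   I_T^{1-gamma} phi (0) is the integral of psi in time and
   I_{a+}^{1-alpha} phi (t, b) the integral of g(t, .) in space. A very-weak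
   solution is thus a y such that (y, psi + w) = (p, psi) + (V, g), where
   p = I_{0+}^gamma f + y0 and V = v.
   The kernel |t - s|^{gamma - 1} is a Gram kernel, so W is positive, and this
   gives (psi, w) >= 0: psi, w and g are bounded by psi + w in L^2(Q), and Riesz
   representation produces y together with its estimate. For uniqueness, take
   g with form g z = (y, J z) and test with psi = J g and w = W y: then
   0 = (y, J g + W y) = form g g + (y, W y) forces g = 0, hence y = 0 because the
   range of J is dense. *)
Require Import Defs.
From HB Require Import structures.
From mathcomp Require Import all_boot all_order all_algebra.
From mathcomp Require Import all_classical all_reals all_analysis.
From mathcomp Require Import measurable_realfun ess_sup_inf ring lra.

Set Implicit Arguments.
Unset Strict Implicit.
Unset Printing Implicit Defensive.

Import Order.TTheory GRing.Theory Num.Theory.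
Import numFieldNormedType.Exports.

Local Open Scope classical_set_scope.
Local Open Scope ring_scope.

(** * Square-integrable functions *)

(** The inequality [(psi, w) >= 0] is delicate because a general solution has no regularity. Since
    the coefficients do not depend on time, [W] commutes with them and with [J], so that
    [form (W g) g >= 0]; but this speaks of [(psi, w)] only for the explicit solutions [psi = J g],
    [w = W eta], where [g] is the elliptic solution for [eta]. The sums [J g + W eta] are dense: a
    vector [r] orthogonal to all of them gives, with [eta = r], two nonnegative terms of sum 0. The
    sign also applies to differences of explicit solutions, so when the sums converge the two
    summands converge separately; the limit is again a solution, and a second sign argument
    identifies it with the given one. The Gram factor of [|t - s|^(gamma - 1)] is a one-sided power
    of exponent [gamma / 2 - 1]; its Gram integral diverges at [gamma = 1], where the kernel is
    constant. Elements of L^2 stay functions, not classes: hence semi-inner products, operators that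
    are linear up to null vectors, and completeness for sequences of geometric rate, which converge
    almost everywhere. *)

Section SquareIntegrable.
Context d (T : measurableType d) (R : realType) (mu : {measure set T -> \bar R}).
Implicit Types (f g h : T -> R).

Definition sqint f :=
  measurable_fun setT f /\ (\int[mu]_x ((f x) ^+ 2)%:E < +oo)%E.

Definition ip f g : R := \int[mu]_x (f x * g x).

Lemma measurable_sqE f : measurable_fun setT f ->
  measurable_fun setT (fun x => ((f x) ^+ 2)%:E).
Proof. by move=> mf; apply/measurable_EFinP; exact: measurable_funX. Qed.

Lemma sqint_integrable_sq f : sqint f ->
  mu.-integrable setT (EFin \o (fun x => (f x) ^+ 2)).
Proof.
move=> [mf fi]; apply/integrableP; split; first exact: measurable_sqE.
rewrite (le_lt_trans _ fi)// le_eqVlt; apply/orP; left; apply/eqP.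
by apply: eq_integral => x _; rewrite gee0_abs// lee_fin sqr_ge0.
Qed.

Lemma sqint_integrable_mul f g : sqint f -> sqint g ->
  mu.-integrable setT (EFin \o (fun x => f x * g x)).
Proof.
move=> f2 g2; have [mf _] := f2; have [mg _] := g2.
apply: (@le_integrable _ _ _ mu _ measurableT _
  (EFin \o (fun x => f x ^+ 2 + g x ^+ 2))).
- by apply/measurable_EFinP; exact: measurable_funM.
- move=> x _ /=; rewrite lee_fin [leRHS]ger0_norm ?addr_ge0 ?sqr_ge0// normrM.
  rewrite -(real_normK (num_real (f x))) -(real_normK (num_real (g x))).
  have := sqr_ge0 (`|f x| - `|g x|); have := normr_ge0 (f x).
  have := normr_ge0 (g x); nra.
- have := integrableD measurableT (sqint_integrable_sq f2) (sqint_integrable_sq g2).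
  by apply: eq_integrable.
Qed.

Lemma sqint_le f g : measurable_fun setT g -> sqint f ->
  (forall x, `|g x| <= `|f x|) -> sqint g.
Proof.
move=> mg [mf fi] gf; split => //; apply: le_lt_trans fi.
apply: ge0_le_integral => //=.
- by move=> x _; rewrite lee_fin sqr_ge0.
- exact: measurable_sqE.
- exact: measurable_sqE.
- move=> x _; rewrite lee_fin -(real_normK (num_real (f x))).
  by rewrite -(real_normK (num_real (g x))) ler_pXn2r ?nnegrE.
Qed.

Lemma sqintZ a f : sqint f -> sqint (a \*o f).
Proof.
move=> f2; have [mf fi] := f2; split.
  by apply: measurable_funM => //; exact: measurable_cst.
under eq_integral do rewrite /= exprMn EFinM.
rewrite ge0_integralZl_EFin//; [|by move=> x _; rewrite lee_fin sqr_ge0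
  |exact: measurable_sqE|exact: sqr_ge0].
by rewrite lte_mul_pinfty// lee_fin sqr_ge0.
Qed.

Lemma sqintD f g : sqint f -> sqint g -> sqint (f \+ g).
Proof.
move=> f2 g2; have [mf fi] := f2; have [mg gi] := g2; split.
  exact: measurable_funD.
apply: (@le_lt_trans _ _
  (\int[mu]_x (2%:E * ((f x ^+ 2)%:E + (g x ^+ 2)%:E)))%E).
  apply: ge0_le_integral => //=.
  - by move=> x _; rewrite lee_fin sqr_ge0.
  - by apply/measurable_EFinP; apply: measurable_funX; exact: measurable_funD.
  - by apply: emeasurable_funM => //; apply: emeasurable_funD; exact: measurable_sqE.
  - move=> x _; rewrite -EFinD -EFinM lee_fin.
    by have := sqr_ge0 (f x - g x); nra.
rewrite ge0_integralZl_EFin//; last 2 first.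
  - by move=> x _; rewrite adde_ge0// lee_fin sqr_ge0.
  - by apply: emeasurable_funD; exact: measurable_sqE.
rewrite ge0_integralD//; try exact: measurable_sqE.
- by rewrite lte_mul_pinfty ?lee_fin// lte_add_pinfty.
- by move=> x _; rewrite lee_fin sqr_ge0.
- by move=> x _; rewrite lee_fin sqr_ge0.
Qed.

Lemma sqint0 : sqint (fun _ => 0).
Proof.
split; first exact: measurable_cst.
by rewrite (eq_integral (cst 0%E)) ?integral0// => x _; rewrite expr0n.
Qed.

Lemma sqintN f : sqint f -> sqint (\- f).
Proof.
move=> f2; have := sqintZ (-1) f2; congr sqint.
by apply/funext => x /=; rewrite mulN1r.
Qed.

Lemma sqintB f g : sqint f -> sqint g -> sqint (f \- g).
Proof. by move=> f2 g2; exact: (sqintD f2 (sqintN g2)). Qed.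

Lemma sqint_bounded_mul C f g : measurable_fun setT g -> (forall x, `|g x| <= C) ->
  sqint f -> sqint (fun x => g x * f x).
Proof.
move=> mg gC f2; have [mf _] := f2.
apply: (@sqint_le (C \*o f)).
- exact: measurable_funM.
- exact: sqintZ.
- move=> x /=; rewrite !normrM ler_wpM2r// (le_trans (gC x))//.
  exact: ler_norm.
Qed.

Lemma ipC f g : ip f g = ip g f.
Proof. by apply: eq_Rintegral => x _; rewrite mulrC. Qed.

Lemma ipDl f g h : sqint f -> sqint g -> sqint h ->
  ip (f \+ g) h = ip f h + ip g h.
Proof.
move=> f2 g2 h2; rewrite /ip -RintegralD//; try exact: sqint_integrable_mul.
by apply: eq_Rintegral => x _; rewrite mulrDl.
Qed.

Lemma ipZl a f h : sqint f -> sqint h -> ip (a \*o f) h = a * ip f h.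
Proof.
move=> f2 h2; rewrite /ip -RintegralZl//; try exact: sqint_integrable_mul.
by apply: eq_Rintegral => x _; rewrite mulrA.
Qed.

Lemma ip_ge0 f : 0 <= ip f f.
Proof. by apply: Rintegral_ge0 => x _; rewrite -expr2 sqr_ge0. Qed.

Lemma ip_sqE f : sqint f -> (ip f f)%:E = (\int[mu]_x ((f x) ^+ 2)%:E)%E.
Proof.
move=> f2; rewrite /ip /Rintegral fineK.
  by apply: eq_integral => x _; rewrite expr2.
by apply: integrable_fin_num => //; exact: sqint_integrable_mul.
Qed.

Lemma ip_eq0 f : sqint f -> ip f f = 0 -> {ae mu, forall x, f x = 0}.
Proof.
move=> f2 f0; have := ip_sqE f2; rewrite f0 => /esym fi; have [mf _] := f2.
have : (\int[mu]_x `|((f x) ^+ 2)%:E| = 0)%E.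
  by rewrite -[RHS]fi; apply: eq_integral => x _; rewrite gee0_abs// lee_fin sqr_ge0.
move/(ae_eq_integral_abs mu measurableT (measurable_sqE mf)).
apply: filterS => x /(_ I) /= /eqP; rewrite eqe sqrf_eq0 => /eqP.
by [].
Qed.

Lemma ip_ae f f' g g' : measurable_fun setT f -> measurable_fun setT f' ->
  measurable_fun setT g -> measurable_fun setT g' ->
  {ae mu, forall x, f x = f' x} -> {ae mu, forall x, g x = g' x} ->
  ip f g = ip f' g'.
Proof.
move=> mf mf' mg mg' ff' gg'; rewrite /ip /Rintegral; congr fine.
apply: ae_eq_integral => //.
- by apply/measurable_EFinP; exact: measurable_funM.
- by apply/measurable_EFinP; exact: measurable_funM.
- by apply: filterS2 ff' gg' => x -> -> _.
Qed.

Lemma sqint_ae f g : measurable_fun setT g -> {ae mu, forall x, f x = g x} ->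
  sqint f -> sqint g.
Proof.
move=> mg fg [mf fi]; split => //.
rewrite (ae_eq_integral (fun x => ((f x) ^+ 2)%:E))//; try exact: measurable_sqE.
by apply: filterS fg => x -> _.
Qed.

Lemma sqint_ae0 f : measurable_fun setT f -> {ae mu, forall x, f x = 0} -> ip f f = 0.
Proof.
move=> mf f0; rewrite (@ip_ae f (fun=> 0) f (fun=> 0))//; try exact: measurable_cst.
by rewrite /ip /Rintegral (eq_integral (cst 0%E)) ?integral0// => x _; rewrite mulr0.
Qed.

Lemma Lfun2P f : (f \in Lfun mu 2%:E) <-> sqint f.
Proof.
split.
- move=> f2; split.
    by move: f2; rewrite inE => /andP[]; rewrite inE.
  have /integrableP[_] := Lfun2_integrable_sqr f2; apply: le_lt_trans.
  by under eq_integral => x _ do rewrite -[X in X%:E]ger0_norm ?sqr_ge0//.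
- move=> [mf fi]; rewrite inE; apply/andP; split; rewrite inE//=.
  rewrite /finite_norm unlock poweR_lty//.
  rewrite (eq_integral (fun x => ((f x) ^+ 2)%:E))// => x _.
  by rewrite /= powR_mulrn// real_normK ?num_real.
Qed.

Lemma Lnorm2E f : sqint f -> Lnorm mu 2%:E (EFin \o f) = (Num.sqrt (ip f f))%:E.
Proof.
move=> f2; rewrite unlock (eq_integral (fun x => ((f x) ^+ 2)%:E)); last first.
  by move=> x _; rewrite /= powR_mulrn// real_normK ?num_real.
by rewrite -ip_sqE//= powR12_sqrt ?ip_ge0.
Qed.

End SquareIntegrable.

Lemma Rintegral_nonintegrable d (X : measurableType d) (R : realType)
    (m : {measure set X -> \bar R}) (g : X -> R) : measurable_fun setT g -> ~ m.-integrable setT (EFin \o g) ->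
  \int[m]_s g s = 0.
Proof.
move=> mg ng; rewrite /Rintegral integralE.
have mg' : measurable_fun setT (EFin \o g) by exact/measurable_EFinP.
have gp : (0 <= \int[m]_s (EFin \o g)^\+%E s)%E by exact: integral_ge0.
have gn : (0 <= \int[m]_s (EFin \o g)^\-%E s)%E by exact: integral_ge0.
have : ~ ((\int[m]_s (EFin \o g)^\+%E s < +oo)%E /\ (\int[m]_s (EFin \o g)^\-%E s < +oo)%E).
  move=> [hp hn]; apply: ng; apply/integrableP; split => //.
  rewrite -/(abse \o (EFin \o g)) fune_abse ge0_integralD//.
  - by rewrite lte_add_pinfty.
  - exact: measurable_funepos.
  - exact: measurable_funeneg.
move: gp gn; case: (integral _ _ _) => [p| |] //; case: (integral _ _ _) => [n| |] //.
by move=> _ _ []; split; exact: ltry.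
Qed.

(* If g is not integrable both sides are 0, the real part of an infinite
   integral. *)
Lemma Rintegral_scale d (X : measurableType d) (R : realType)
    (m : {measure set X -> \bar R}) (g : X -> R) (c : R) : measurable_fun setT g ->
  \int[m]_s (c * g s) = c * \int[m]_s g s.
Proof.
move=> mg; have [ig|ng] := pselect (m.-integrable setT (EFin \o g)).
  by rewrite RintegralZl.
have [->|c0] := eqVneq c 0.
  by rewrite mul0r; under eq_Rintegral do rewrite mul0r; rewrite Rintegral_cst ?mul0r.
rewrite !Rintegral_nonintegrable ?mulr0//; first exact: measurable_funM.
move=> icg; apply: ng; have := integrableZl measurableT c^-1 icg.
by apply: eq_integrable => // s _; rewrite /= -EFinM mulKf.
Qed.

Lemma limn_einf_le (R : realType) (u : (\bar R)^nat) (c : \bar R) :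
  (forall n, (u n <= c)%E) -> (limn_einf u <= c)%E.
Proof.
move=> uc; rewrite limn_einf_lim; apply: lime_le; first exact: is_cvg_einfs.
apply: nearW => n; apply: le_trans (uc n).
by apply: ereal_inf_lbound; exists n => /=.
Qed.

(** * Completeness of L^2 *)

Section Completeness.
Context d (T : measurableType d) (R : realType) (mu : {measure set T -> \bar R}).

Lemma fatou_bound (f : nat -> T -> \bar R) (g : T -> \bar R) (c : \bar R) :
  (forall n, measurable_fun setT (f n)) -> measurable_fun setT g ->
  (forall n x, (0 <= f n x)%E) ->
  {ae mu, forall x, f n x @[n --> \oo] --> g x} ->
  (forall n, (\int[mu]_x f n x <= c)%E) -> (\int[mu]_x g x <= c)%E.
Proof.
move=> mf mg f0 fg fc.
rewrite (ae_eq_integral (fun x => limn_einf (f ^~ x)))//.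
- apply: le_trans (fatou mu measurableT mf _) _ => //; exact: limn_einf_le.
- rewrite /limn_einf; apply: measurableT_comp => //.
  by apply: measurable_fun_limn_esup => n; exact: measurableT_comp.
- by apply: filterS fg => x fgx _; rewrite (cvg_limn_einf_sup fgx).1.
Qed.

(** The weight [2^k] turns square summability into absolute summability, by
    [2 |x| <= 2^k x^2 + 2^-k]. *)
Lemma cvg_series_sqr (x : nat -> R) (M : R) :
  (forall n, \sum_(0 <= k < n) 2 ^+ k * x k ^+ 2 <= M) -> cvgn (series x).
Proof.
move=> xM; apply: (@normed_cvg R R^o); apply: nondecreasing_is_cvgn.
  apply/nondecreasing_seqP => n; rewrite /normed_series_of /= /series /=.
  by rewrite [leRHS]big_nat_recr//= lerDl normr_ge0.
exists (M + 2) => _ [n _ <-]; rewrite /series/=.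
apply: (@le_trans _ _ (\sum_(0 <= k < n) (2 ^+ k * x k ^+ 2 + 2^-1 ^+ k))).
  apply: ler_sum => k _; set a : R := 2 ^+ k.
  have a0 : 0 < a by rewrite exprn_gt0.
  have -> : (2 : R)^-1 ^+ k = a^-1 by rewrite exprVn.
  rewrite -(real_normK (num_real (x k))); set y : R := `|x k|.
  have -> : a * y ^+ 2 + a^-1 = (a * y ^+ 2 + a^-1) by [].
  have : 0 <= a^-1 * (a * y - 1) ^+ 2 by rewrite mulr_ge0 ?sqr_ge0// invr_ge0 ltW.
  have -> : a^-1 * (a * y - 1) ^+ 2 = a * y ^+ 2 + a^-1 - 2 * y.
    by field; rewrite gt_eqF.
  by have : 0 <= y := normr_ge0 _; lra.
rewrite big_split/= lerD//.
have -> : \sum_(0 <= k < n) (2 : R)^-1 ^+ k = 2 - 2 * 2^-1 ^+ n.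
  elim: n => [|n IH]; first by rewrite big_geq// expr0; lra.
  by rewrite big_nat_recr//= IH exprS; lra.
by rewrite gerBl mulr_ge0// exprn_ge0// invr_ge0.
Qed.

(** Riesz-Fischer for a fast sequence. At the rate [8^-k], the squared increments weighted by [2^k]
    have integrals at most [C 4^-k]; their sum [G] is integrable, hence finite almost everywhere,
    and the sequence converges there. Fatou then gives back the rate with the same [C]. *)
Lemma sqint_complete (u : nat -> T -> R) (C : R) :
  (forall n, sqint mu (u n)) ->
  (forall n m, (n <= m)%N -> ip mu (u m \- u n) (u m \- u n) <= C * 8^-1 ^+ n) ->
  exists v, sqint mu v /\
    forall n, ip mu (v \- u n) (v \- u n) <= C * 8^-1 ^+ n.
Proof.
move=> u2 uC.
have mu_ n : measurable_fun setT (u n) by case: (u2 n).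
pose dd k x := u k.+1 x - u k x.
have mdd k : measurable_fun setT (dd k) by exact: measurable_funB.
pose G x := (\sum_(0 <= k <oo) (2 ^+ k * dd k x ^+ 2)%:E)%E.
have mterm k : measurable_fun setT (fun x => (2 ^+ k * dd k x ^+ 2)%:E).
  apply/measurable_EFinP; apply: measurable_funM; first exact: measurable_cst.
  exact: measurable_funX.
have term0 k x : (0 <= (2 ^+ k * dd k x ^+ 2)%:E)%E.
  by rewrite lee_fin mulr_ge0 ?sqr_ge0// exprn_ge0.
have C0 : 0 <= C.
  by have := uC 0 0 (leqnn _); rewrite expr0 mulr1; apply: le_trans; exact: ip_ge0.
have Glty : (\int[mu]_x G x < +oo)%E.
  rewrite integral_nneseries//.
  apply: (@le_lt_trans _ _ (C * 2)%:E); last exact: ltry.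
  apply: lime_le; first by apply: is_cvg_nneseries => k _ _; exact: integral_ge0.
  apply: nearW => n.
  apply: (@le_trans _ _ (\sum_(0 <= k < n) (C * 4^-1 ^+ k)%:E)%E).
    apply: lee_sum => k _; under eq_integral do rewrite EFinM.
    rewrite ge0_integralZl_EFin ?exprn_ge0//; last 2 first.
      by move=> x _; rewrite lee_fin sqr_ge0.
      exact: measurable_sqE.
    rewrite -(ip_sqE (sqintB (u2 k.+1) (u2 k))) -EFinM lee_fin.
    apply: (@le_trans _ _ (2 ^+ k * (C * 8^-1 ^+ k))).
      by rewrite ler_wpM2l ?exprn_ge0// uC.
    rewrite mulrCA -exprMn; have -> : (2 : R) * 8^-1 = 4^-1 by lra.
    by [].
  rewrite sumEFin lee_fin -mulr_sumr ler_wpM2l//.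
  have : \sum_(0 <= k < n) (4 : R)^-1 ^+ k = 4 / 3 - 4 / 3 * 4^-1 ^+ n.
    elim: n => [|n IH]; first by rewrite big_geq// expr0; lra.
    by rewrite big_nat_recr//= IH exprS; lra.
  move=> ->; have : 0 <= (4 : R)^-1 ^+ n by rewrite exprn_ge0// invr_ge0.
  by lra.
have mG : measurable_fun setT G by apply: ge0_emeasurable_sum.
have G0 x : (0 <= G x)%E by apply: nneseries_ge0.
have cvu : {ae mu, forall x, cvgn (fun n => u n x : R^o)}.
  have : mu.-integrable setT G.
    apply/integrableP; split => //; apply: le_lt_trans Glty.
    rewrite le_eqVlt; apply/orP; left; apply/eqP; apply: eq_integral => x _.
    by rewrite gee0_abs.
  move/(integrable_ae measurableT); apply: filterS => x /(_ I) Gx.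
  have : cvgn (series (fun k => dd k x)).
    apply: (@cvg_series_sqr _ (fine (G x))) => n.
    rewrite -lee_fin fineK// -sumEFin; exact: nneseries_lim_ge.
  have -> : (fun n => u n x) = (fun n => u 0 x + series (fun k => dd k x) n).
    apply/funext => n; by rewrite /series/= telescope_sumr// addrC subrK.
  by move=> cs; apply: is_cvgD => //; exact: is_cvg_cst.
(* An upper limit is measurable and defined at every point; it is the limit at almost every one. *)
pose v x := fine (limn_esup (fun n => (u n x)%:E)).
have mv : measurable_fun setT v.
  apply: (measurableT_comp (fine_measurable measurableT)).
  by apply: measurable_fun_limn_esup => n; apply/measurable_EFinP.
have vlim : {ae mu, forall x, u n x @[n --> \oo] --> v x}.
  apply: filterS cvu => x /cvg_ex[l ul]; rewrite /v.
  have ulE : (u n x)%:E @[n --> \oo] --> l%:E by apply: cvg_EFin => //; exact: nearW.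
  by rewrite (cvg_limn_einf_sup ulE).2.
have bnd n : (\int[mu]_x ((v x - u n x) ^+ 2)%:E <= (C * 8^-1 ^+ n)%:E)%E.
  apply: (@fatou_bound (fun m x => ((u (m + n)%N x - u n x) ^+ 2)%:E)).
  - by move=> m; apply: measurable_sqE; exact: measurable_funB.
  - by apply: measurable_sqE; exact: measurable_funB.
  - by move=> m x; rewrite lee_fin sqr_ge0.
  - apply: filterS vlim => x ux; apply: cvg_EFin; first exact: nearW.
    have h : u (m + n)%N x - u n x @[m --> \oo] --> v x - u n x.
      by apply: cvgB; [rewrite (cvg_shiftn n (u ^~ x))|exact: cvg_cst].
    exact: (cvgM h h).
  - by move=> m; rewrite -(ip_sqE (sqintB (u2 _) (u2 _))) lee_fin uC// leq_addl.
have v2 : sqint mu v.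
  have : sqint mu (v \- u 0).
    split; first exact: measurable_funB.
    by apply: (le_lt_trans (bnd 0)); exact: ltry.
  move=> h; have := sqintD h (u2 0); congr sqint.
  by apply/funext => x /=; rewrite subrK.
exists v; split => // n; rewrite -lee_fin (ip_sqE (sqintB v2 (u2 n))).
exact: bnd.
Qed.

End Completeness.

(** * Semi-Hilbert spaces and the abstract backward problem *)

(* A complete semi-inner product space carried by a subset of a module:
   completeness is only asked for sequences with geometric rate. *)
Record semihilbert (R : realType) (V : lmodType R) (E : set V)
    (B : V -> V -> R) : Prop := Semihilbert {
  sh_lin : forall a x y, E x -> E y -> E (a *: x + y);
  sh_linl : forall a x y z, E x -> E y -> E z ->
    B (a *: x + y) z = a * B x z + B y z;
  sh_sym : forall x y, E x -> E y -> B x y = B y x;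
  sh_ge0 : forall x, E x -> 0 <= B x x;
  sh_complete : forall (u : nat -> V) C, (forall n, E (u n)) ->
    (forall n m, (n <= m)%N -> B (u m - u n) (u m - u n) <= C * 8^-1 ^+ n) ->
    exists v C', E v /\ forall n, B (v - u n) (v - u n) <= C' * 8^-1 ^+ n }.

(** This is how limits are taken below: an identity is proved by bounding the square of a difference
    by [C 8^-n] for all [n]. *)
Lemma le0_of_geometric (R : realType) (a C : R) :
  (forall n, a <= C * 8^-1 ^+ n) -> a <= 0.
Proof.
move=> aC; have [//|a0] := leP a 0.
have h : (fun n : nat => C * 8^-1 ^+ n) @ \oo --> C * 0.
  apply: cvgM; first exact: cvg_cst.
  by apply: cvg_expr; rewrite ger0_norm ?invr_ge0// invf_lt1// ltr1n.
rewrite mulr0 in h.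
have : limn (fun n : nat => C * 8^-1 ^+ n) = 0 by apply/cvg_lim.
have : a <= limn (fun n : nat => C * 8^-1 ^+ n).
  apply: limr_ge; first by apply/cvg_ex; exists 0.
  by apply: nearW => n.
by move=> + E; rewrite E => /(lt_le_trans a0); rewrite ltxx.
Qed.

(** * Calculus and Riesz representation in a semi-Hilbert space *)

Section SemiHilbert.
Context (R : realType) (V : lmodType R) (E : set V) (B : V -> V -> R).
Hypothesis sh : semihilbert E B.
Implicit Types (x y z : V) (a : R).

Lemma shZ a x : E x -> E (a *: x).
Proof.
move=> Ex; have E0 : E 0 by have := sh_lin sh (-1) Ex Ex; rewrite scaleN1r addNr.
by have := sh_lin sh a Ex E0; rewrite addr0.
Qed.

Lemma shD x y : E x -> E y -> E (x + y).
Proof. by move=> Ex Ey; have := sh_lin sh 1 Ex Ey; rewrite scale1r. Qed.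

Lemma shB x y : E x -> E y -> E (x - y).
Proof.
by move=> Ex Ey; apply: shD => //; rewrite -scaleN1r; exact: shZ.
Qed.

Lemma sh0l x y : E x -> E y -> B 0 y = 0.
Proof.
move=> Ex Ey; have := sh_linl sh (-1) Ex Ex Ey.
by rewrite scaleN1r addNr => ->; rewrite mulN1r addNr.
Qed.

Lemma shDl x y z : E x -> E y -> E z -> B (x + y) z = B x z + B y z.
Proof.
by move=> Ex Ey Ez; have := sh_linl sh 1 Ex Ey Ez; rewrite scale1r mul1r.
Qed.

Lemma shZl a x z : E x -> E z -> B (a *: x) z = a * B x z.
Proof.
move=> Ex Ez; have E0 : E 0 by have := shB Ex Ex; rewrite subrr.
by have := sh_linl sh a Ex E0 Ez; rewrite addr0 (sh0l Ex Ez) addr0.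
Qed.

Lemma shBl x y z : E x -> E y -> E z -> B (x - y) z = B x z - B y z.
Proof.
move=> Ex Ey Ez; rewrite -scaleN1r shDl//; last exact: shZ.
by rewrite shZl// mulN1r.
Qed.

Lemma shDr x y z : E x -> E y -> E z -> B z (x + y) = B z x + B z y.
Proof.
move=> Ex Ey Ez; rewrite (sh_sym sh)//; last exact: shD.
by rewrite shDl// ![B _ z](sh_sym sh).
Qed.

Lemma shZr a x z : E x -> E z -> B z (a *: x) = a * B z x.
Proof.
move=> Ex Ez; rewrite (sh_sym sh)//; last exact: shZ.
by rewrite shZl// [B _ z](sh_sym sh).
Qed.

Lemma shBr x y z : E x -> E y -> E z -> B z (x - y) = B z x - B z y.
Proof.
move=> Ex Ey Ez; rewrite (sh_sym sh)//; last exact: shB.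
by rewrite shBl// ![B _ z](sh_sym sh).
Qed.

Lemma sh_sqD x y : E x -> E y -> B (x + y) (x + y) = B x x + 2 * B x y + B y y.
Proof.
move=> Ex Ey; have Exy := shD Ex Ey.
rewrite shDl// !shDr// [B y x](sh_sym sh)//; ring.
Qed.

Lemma sh_sqB x y : E x -> E y -> B (x - y) (x - y) = B x x - 2 * B x y + B y y.
Proof.
move=> Ex Ey; have Exy := shB Ex Ey.
rewrite shBl// !shBr// [B y x](sh_sym sh)//; ring.
Qed.

Lemma sh_CS x y : E x -> E y -> B x y ^+ 2 <= B x x * B y y.
Proof.
move=> Ex Ey.
have key a b : 0 <= a ^+ 2 * B x x + 2 * (a * b) * B x y + b ^+ 2 * B y y.
  have := sh_ge0 sh (shD (shZ a Ex) (shZ b Ey)).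
  rewrite sh_sqD ?shZl ?shZr//; try exact: shZ.
  congr (_ <= _); ring.
have [xx0|xx0] := eqVneq (B x x) 0.
  have [->|p0] := eqVneq (B x y) 0; first by rewrite xx0 mul0r expr0n.
  (* When [B x x = 0] the quadratic form of [key] is affine in [a]; this [a] gives it the negative
     value [- B y y - 2]. *)
  have := key (- (B y y + 1) / B x y) 1; rewrite xx0 mulr0 mulr1 add0r.
  rewrite -mulrA mulfVK// expr1n mul1r; have := sh_ge0 sh Ey; lra.
have xx : 0 < B x x by rewrite lt_def xx0 (sh_ge0 sh).
have := key (- B x y) (B x x).
have -> : (- B x y) ^+ 2 * B x x + 2 * (- B x y * B x x) * B x y
  + B x x ^+ 2 * B y y = B x x * (B x x * B y y - B x y ^+ 2) by ring.
by rewrite pmulr_rge0// subr_ge0.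
Qed.

Lemma sh_null x y : E x -> E y -> B x x = 0 -> B x y = 0.
Proof.
move=> Ex Ey x0; have := sh_CS Ex Ey; rewrite x0 mul0r => h.
by apply/eqP; rewrite -sqrf_eq0 eq_le h sqr_ge0.
Qed.

(** Convergence at the rate that [sh_complete] handles. It replaces a topology on [V], and is
    preserved by sums and bounded operators at the price of a larger constant. *)
Definition geo_cv (u : nat -> V) x := [/\ E x, forall n, E (u n) &
  exists2 C, 0 <= C & forall n, B (x - u n) (x - u n) <= C * 8^-1 ^+ n].

Lemma geo_cvI u x C : E x -> (forall n, E (u n)) ->
  (forall n, B (x - u n) (x - u n) <= C * 8^-1 ^+ n) -> geo_cv u x.
Proof.
move=> Ex Eu h; split => //; exists `|C| => // n; apply: (le_trans (h n)).
by rewrite ler_wpM2r ?ler_norm// exprn_ge0// invr_ge0.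
Qed.

Lemma geo_cv_cst x : E x -> geo_cv (fun=> x) x.
Proof.
move=> Ex; apply: (@geo_cvI _ _ 0) => // n; rewrite subrr mul0r.
by rewrite (sh0l Ex)//; have := shB Ex Ex; rewrite subrr.
Qed.

Lemma geo_cvD u v x y : geo_cv u x -> geo_cv v y ->
  geo_cv (fun n => u n + v n) (x + y).
Proof.
move=> [Ex Eu [C C0 xu]] [Ey Ev [D D0 yv]].
apply: (@geo_cvI _ _ (2 * (C + D))) => [|n|n]; [exact: shD|exact: shD|].
rewrite opprD addrACA; have Exu := shB Ex (Eu n); have Eyv := shB Ey (Ev n).
have := sh_ge0 sh (shB Exu Eyv); rewrite (sh_sqB Exu Eyv) (sh_sqD Exu Eyv).
by have := xu n; have := yv n; rewrite -mulrA mulrDl; lra.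
Qed.

(** Cauchy-Schwarz on [B (x - u n) y + B (u n) (y - v n)]; the constant [K] dominates both [B y y]
    and all the [B (u n) (u n)]. *)
Lemma geo_cv_ip u v x y : geo_cv u x -> geo_cv v y ->
  exists C, forall n, (B x y - B (u n) (v n)) ^+ 2 <= C * 8^-1 ^+ n.
Proof.
move=> [Ex Eu [C C0 xu]] [Ey Ev [D D0 yv]].
pose K := 2 * B x x + B y y + 2 * C.
exists (2 * K * (C + D)) => n.
have d0 : 0 <= B (x - u n) (x - u n) by rewrite (sh_ge0 sh)//; exact: shB.
have e0 : 0 <= B (y - v n) (y - v n) by rewrite (sh_ge0 sh)//; exact: shB.
have := xu n; have := yv n; set e := 8^-1 ^+ n => yD xC.
have e1 : e <= 1 by rewrite exprn_ile1// ?invr_ge0// invf_le1// ler1n.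
have e0' : 0 <= e by rewrite exprn_ge0// invr_ge0.
have h1 := sh_CS (shB Ex (Eu n)) Ey.
have h2 := sh_CS (Eu n) (shB Ey (Ev n)).
have un : B (u n) (u n) <= 2 * B x x + 2 * C * e.
  have := sh_ge0 sh (shB (shZ 2 Ex) (Eu n)).
  rewrite sh_sqB ?shZl ?shZr//; try exact: shZ.
  have := sh_sqB Ex (Eu n); lra.
have yy0 := sh_ge0 sh Ey; have xx0 := sh_ge0 sh Ex.
have b1 : B (x - u n) y ^+ 2 <= K * (C * e).
  by apply: (le_trans h1); rewrite mulrC ler_pM// /K; lra.
have b2 : B (u n) (y - v n) ^+ 2 <= K * (D * e).
  apply: (le_trans h2); apply: ler_pM => //; first exact: (sh_ge0 sh).
  by apply: (le_trans un); rewrite /K; nra.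
have -> : B x y - B (u n) (v n) = B (x - u n) y + B (u n) (y - v n).
  by rewrite shBl// shBr//; ring.
set p := B (x - u n) y in b1 *; set r := B (u n) (y - v n) in b2 *.
have := sqr_ge0 (p - r); rewrite -!mulrA [(C + D) * e]mulrDl mulrDr; nra.
Qed.

Lemma geo_cv_ge u v x y c : geo_cv u x -> geo_cv v y ->
  (forall n, c <= B (u n) (v n)) -> c <= B x y.
Proof.
move=> ux vy uv; have [C h] := geo_cv_ip ux vy.
rewrite leNgt; apply/negP => lt.
have : (c - B x y) ^+ 2 <= 0.
  apply: (@le0_of_geometric _ _ C) => n; apply: le_trans (h n).
  have := uv n; nra.
by rewrite leNgt exprn_even_gt0//= subr_eq0 gt_eqF.
Qed.

Lemma geo_cv_eq u v x y u' v' x' y' : geo_cv u x -> geo_cv v y ->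
  geo_cv u' x' -> geo_cv v' y' ->
  (forall n, B (u n) (v n) = B (u' n) (v' n)) -> B x y = B x' y'.
Proof.
move=> ux vy ux' vy' uv; have [C h] := geo_cv_ip ux vy.
have [D h'] := geo_cv_ip ux' vy'.
apply/eqP; rewrite -subr_eq0 -sqrf_eq0 eq_le sqr_ge0 andbT.
apply: (@le0_of_geometric _ _ (2 * (C + D))) => n.
have := h n; have := h' n; rewrite -uv -mulrA mulrDl.
have := sqr_ge0 (B x y + B x' y' - 2 * B (u n) (v n)); nra.
Qed.

(* Riesz representation of a bounded functional known on a subspace only; the
   subspace and the functional are given together as the linear graph [G]. *)
Lemma sh_riesz (G : V -> R -> Prop) (C : R) : 0 <= C ->
  (exists x m, G x m) ->
  (forall a x m y n, G x m -> G y n -> G (a *: x + y) (a * m + n)) ->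
  (forall x m, G x m -> E x) ->
  (forall x m, G x m -> m ^+ 2 <= C * B x x) ->
  exists y, [/\ E y, forall x m, G x m -> B y x = m, B y y <= C &
    exists u m, geo_cv u y /\ forall n, G (u n) (m n)].
Proof.
move=> C0 [x0 [m0 G0]] Glin GE GC.
have GZ a x m : G x m -> G (a *: x) (a * m).
  move=> Gx; have G00 : G 0 0.
    by have := Glin (-1) _ _ _ _ Gx Gx; rewrite scaleN1r mulN1r !addNr.
  by have := Glin a _ _ _ _ Gx G00; rewrite !addr0.
have GD x m y n : G x m -> G y n -> G (x + y) (m + n).
  by move=> Gx Gy; have := Glin 1 _ _ _ _ Gx Gy; rewrite scale1r mul1r.
(* The functional [B x x - 2 m], bounded below by [- C] because [2 |m| <= C + B x x], is minimised
   over the graph; a minimising sequence converges to the representative. *)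
pose J := [set r | exists x m, G x m /\ r = B x x - 2 * m].
have Jlb : lbound J (- C).
  move=> _ [x [m [Gx ->]]]; have h := GC _ _ Gx.
  have xx := sh_ge0 sh (GE _ _ Gx).
  have : (2 * m) ^+ 2 <= (C + B x x) ^+ 2.
    rewrite exprMn; have := sqr_ge0 (C - B x x); nra.
  have := sqr_ge0 (2 * m + C + B x x); nra.
have J0 : J !=set0 by exists (B x0 x0 - 2 * m0), x0, m0.
have hJ : has_inf J by split => //; exists (- C).
pose i0 := inf J.
have i0le x m : G x m -> i0 <= B x x - 2 * m.
  by move=> Gx; apply: ge_inf; [exists (- C)|exists x, m].
have e0 n : 0 < (8 : R)^-1 ^+ n / 4 by rewrite divr_gt0// exprn_gt0// invr_gt0.
(* With a defect of [8^-n / 4], comparing the midpoint of [u k] and [u n] with the infimum bounds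
   their squared distance by [8^-n]. *)
have pick n : exists xm : V * R, G xm.1 xm.2 /\
    B xm.1 xm.1 - 2 * xm.2 <= i0 + 8^-1 ^+ n / 4.
  have [_ [x [m [Gx ->]]] lt] := inf_adherent (e0 n) hJ.
  by exists (x, m); split => //=; exact: ltW.
have [um umP] := choice pick.
pose u n := (um n).1; pose m n := (um n).2.
have Gu n : G (u n) (m n) by case: (umP n).
have Eu n : E (u n) by exact: GE (Gu n).
have uJ n : B (u n) (u n) - 2 * m n <= i0 + 8^-1 ^+ n / 4 by case: (umP n).
have cauchy n k : (n <= k)%N -> B (u k - u n) (u k - u n) <= 1 * 8^-1 ^+ n.
  move=> nk; have h := i0le _ _ (GZ 2^-1 _ _ (GD _ _ _ _ (Gu k) (Gu n))).
  rewrite shZl ?shZr ?sh_sqD// in h; try by [exact: shD|apply: shZ; exact: shD].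
  rewrite sh_sqB//; have := uJ n; have := uJ k.
  have : (8 : R)^-1 ^+ k <= 8^-1 ^+ n.
    by rewrite ler_wiXn2l// ?invr_ge0// invf_le1// ler1n.
  lra.
have [y [K [Ey yK]]] := sh_complete sh Eu cauchy.
have yu x n : E x -> B (y - u n) x ^+ 2 <= K * 8^-1 ^+ n * B x x.
  move=> Ex; apply: (le_trans (sh_CS (shB Ey (Eu n)) Ex)).
  by rewrite ler_wpM2r// (sh_ge0 sh).
have rep x k : G x k -> B y x = k.
  move=> Gx; have Ex := GE _ _ Gx.
  (* Near-minimality of [u n] in the direction [x]. The [t] used in [k1] would be optimal with
     [B x x] in place of [c]; the added 1 keeps [c] positive on null vectors. *)
  have key n t : - 8^-1 ^+ n / 4 <= 2 * t * (B (u n) x - k) + t ^+ 2 * B x x.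
    have h := i0le _ _ (GD _ _ _ _ (Gu n) (GZ t _ _ Gx)).
    rewrite sh_sqD ?shZl ?shZr// in h; try exact: shZ.
    have := uJ n; nra.
  have xx := sh_ge0 sh Ex.
  pose c := 1 + B x x; have c0 : 0 < c by rewrite /c; lra.
  have k1 n : (B (u n) x - k) ^+ 2 <= c * 8^-1 ^+ n.
    have := key n (- (B (u n) x - k) / c).
    set p := B (u n) x - k; set e := 8^-1 ^+ n.
    have -> : 2 * (- p / c) * p + (- p / c) ^+ 2 * B x x =
        - (p ^+ 2 / c) * (2 - B x x / c) by field; rewrite gt_eqF.
    have : B x x / c <= 1 by rewrite ler_pdivrMr// /c; lra.
    have -> : p ^+ 2 = p ^+ 2 / c * c by rewrite divfK// gt_eqF.
    have : 0 <= p ^+ 2 / c by rewrite divr_ge0 ?sqr_ge0// ltW.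
    have : 0 < e by rewrite exprn_gt0// invr_gt0.
    rewrite mulrK ?unitfE ?gt_eqF//.
    set q := p ^+ 2 / c; set s := B x x / c => ee q0 s1 h.
    have : q <= e by nra.
    by rewrite mulrC; move=> ?; rewrite ler_wpM2l// ltW.
  have : (B y x - k) ^+ 2 <= 0.
    apply: (@le0_of_geometric _ _ (2 * (K * B x x + c))) => n.
    have := k1 n; have := yu x n Ex; rewrite shBl//.
    set e := 8^-1 ^+ n.
    have := sqr_ge0 (B y x - 2 * B (u n) x + k).
    set a1 := B y x; set b1 := B (u n) x => h1 h2 h3.
    have -> : 2 * (K * B x x + c) * e = 2 * (K * e * B x x) + 2 * (c * e) by ring.
    nra.
  move=> h; apply/eqP; rewrite -subr_eq0 -sqrf_eq0 eq_le h.
  exact: sqr_ge0.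
exists y; split => //; last first.
  by exists u, m; split => //; exact: (geo_cvI _ _ yK).
have yy := sh_ge0 sh Ey.
(* The bound on [y], which may lie outside the graph: [B (u n) (u n)] is expressed through
   [B y (u n) = m n], and [(m n - C)^2 >= 0] then eliminates [m n]. *)
have key n : m n ^+ 2 <= C * (K * 8^-1 ^+ n - B y y + 2 * m n).
  apply: (le_trans (GC _ _ (Gu n))); rewrite ler_wpM2l//.
  by have := yK n; rewrite sh_sqB// (rep _ _ (Gu n)); lra.
have [C1|C1] := eqVneq C 0.
  rewrite C1; apply: (@le0_of_geometric _ _ K) => n; have := yK n.
  have := key n; rewrite C1 mul0r => m2.
  have m0' : m n = 0 by apply/eqP; rewrite -sqrf_eq0 eq_le m2 sqr_ge0.
  by rewrite sh_sqB// (rep _ _ (Gu n)) m0'; have := sh_ge0 sh (Eu n); lra.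
have Cp : 0 < C by rewrite lt_def C1.
have : C * (B y y - C) <= 0.
  apply: (@le0_of_geometric _ _ (C * K)) => n; have := key n.
  have := sqr_ge0 (m n - C); rewrite -mulrA; set e := K * _; nra.
by rewrite pmulr_rle0// subr_le0.
Qed.

(** Coercivity makes a fast sequence for [B'] fast for [B], and the upper bound carries the rate of
    convergence back to [B']. *)
Lemma sh_equiv (B' : V -> V -> R) (c C : R) : 0 < c ->
  (forall a x y z, E x -> E y -> E z ->
    B' (a *: x + y) z = a * B' x z + B' y z) ->
  (forall x y, E x -> E y -> B' x y = B' y x) ->
  (forall x, E x -> c * B x x <= B' x x) ->
  (forall x, E x -> B' x x <= C * B x x) ->
  semihilbert E B'.
Proof.
move=> c0 lin sym coer bnd; split => //.
- exact: (sh_lin sh).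
- move=> x Ex; apply: le_trans (coer _ Ex); rewrite mulr_ge0 ?(sh_ge0 sh)//.
  exact: ltW.
- move=> u K Eu uK.
  have [n m nm|v [C' [Ev vC]]] := sh_complete sh (C := K / c) Eu.
    have Eb := shB (Eu m) (Eu n).
    rewrite mulrAC ler_pdivlMr// mulrC; apply: le_trans (coer _ Eb) _.
    exact: uK.
  exists v, (`|C| * C'); split => // n; have Eb := shB Ev (Eu n).
  apply: (le_trans (bnd _ Eb)); rewrite -mulrA.
  apply: (@le_trans _ _ (`|C| * B (v - u n) (v - u n))).
    by rewrite ler_wpM2r ?ler_norm// (sh_ge0 sh).
  by rewrite ler_wpM2l.
Qed.

End SemiHilbert.

(* Bounded operators are linear only up to null vectors, so linearity is
   tested against the inner product. *)
Record bounded_op (R : realType) (V : lmodType R) (E : set V)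
    (B : V -> V -> R) (S : V -> V) : Prop := BoundedOp {
  op_stable : forall x, E x -> E (S x);
  op_lin : forall a x y z, E x -> E y -> E z ->
    B (S (a *: x + y)) z = a * B (S x) z + B (S y) z;
  op_bounded : exists C, 0 <= C /\ forall x, E x -> B (S x) (S x) <= C * B x x }.

(** * The abstract backward problem and its dual *)

Section Parabolic.
Context (R : realType) (V : lmodType R) (E : set V) (ip form : V -> V -> R).
Context (J W Ws : V -> V) (c : R).
Hypotheses (sh : semihilbert E ip) (sf : semihilbert E form).
Hypotheses (c0 : 0 < c) (coer : forall x, E x -> c * ip x x <= form x x).
Hypotheses (bJ : bounded_op E ip J) (bW : bounded_op E ip W)
  (bWs : bounded_op E ip Ws).
Hypothesis E_nonempty : exists x, E x.
Hypothesis W_adj : forall x y, E x -> E y -> ip (W x) y = ip x (Ws y).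
Hypothesis JW : forall x y, E x -> E y -> ip (J (W x)) y = ip (W (J x)) y.
Hypothesis JWs : forall x y, E x -> E y -> ip y (J (Ws x)) = ip y (Ws (J x)).
Hypothesis formW : forall x y, E x -> E y -> form (W x) y = form x (Ws y).
Hypothesis W_ge0 : forall x, E x -> 0 <= ip (W x) x.
Hypothesis formW_ge0 : forall x, E x -> 0 <= form (W x) x.
Hypothesis J_dense : forall x, E x -> (forall z, E z -> ip x (J z) = 0) -> ip x x = 0.

(* [J g] is the solution of the elliptic problem with right-hand side [w]. *)
Definition elliptic (w g : V) := forall z, E z -> form g z = ip w (J z).

(** The test function itself is not carried: it is the common value of [W psi] and [J g], which are
    equal up to a null vector. *)
Definition backward (psi w g : V) :=
  [/\ E psi, E w, E g, elliptic w g &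
    forall z, E z -> ip (W psi) z = ip (J g) z].

Let EJ x : E x -> E (J x). Proof. exact: (op_stable bJ). Qed.
Let EW x : E x -> E (W x). Proof. exact: (op_stable bW). Qed.
Let EWs x : E x -> E (Ws x). Proof. exact: (op_stable bWs). Qed.

Let opC S : bounded_op E ip S -> {C | 0 <= C & forall x, E x -> ip (S x) (S x) <= C * ip x x}.
Proof. by move=> bS; have /cid[C [C0 h]] := op_bounded bS; exists C. Qed.

(** Riesz in the inner product [form]: coercivity bounds [z |-> ip w (J z)] there, with squared norm
    at most [ip w w * CJ / c]. *)
Lemma elliptic_exists w : E w -> exists2 g, E g & elliptic w g.
Proof.
move=> Ew; have [CJ CJ0 hCJ] := opC bJ.
pose G z m := E z /\ m = ip w (J z).
have [|||||g [Eg h _ _]] := @sh_riesz _ _ _ _ sf G (ip w w * CJ / c).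
- by rewrite divr_ge0 ?mulr_ge0 ?(sh_ge0 sh)// ltW.
- by have [x Ex] := E_nonempty; exists x, (ip w (J x)).
- move=> a x m y n [Ex ->] [Ey ->]; split; first exact: (sh_lin sh).
  have Exy := EJ (sh_lin sh a Ex Ey).
  rewrite [RHS](sh_sym sh)// (op_lin bJ)//.
  by rewrite ![ip w _](sh_sym sh)//; exact: EJ.
- by move=> x m [].
- move=> x m [Ex ->]; apply: (le_trans (sh_CS sh Ew (EJ Ex))).
  rewrite -!mulrA ler_wpM2l ?(sh_ge0 sh)//.
  apply: (le_trans (hCJ _ Ex)); rewrite ler_wpM2l//.
  by rewrite ler_pdivlMl//; exact: coer.
by exists g => // z Ez; rewrite (h z (ip w (J z))).
Qed.

Lemma elliptic_lin a w g w' g' : E w -> E w' -> E g -> E g' ->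
  elliptic w g -> elliptic w' g' -> elliptic (a *: w + w') (a *: g + g').
Proof.
move=> Ew Ew' Eg Eg' h h' z Ez.
by rewrite (sh_linl sf)// h// h'// (sh_linl sh)//; exact: EJ.
Qed.

(** [form (W g) z = form g (Ws z) = ip w (J (Ws z)) = ip w (Ws (J z)) = ip (W w) (J z)]: the
    elliptic solver commutes with integration in time. *)
Lemma elliptic_W w g : E w -> E g -> elliptic w g -> elliptic (W w) (W g).
Proof.
move=> Ew Eg h z Ez; have Ews := EWs Ez.
rewrite formW// h// JWs// W_adj//; exact: EJ.
Qed.

(** [c ip g g <= form g g = ip w (J g)], then Cauchy-Schwarz and the bound of [J]; squaring gives
    [CJ / c^2]. *)
Lemma elliptic_bound : exists C, 0 <= C /\ forall w g, E w -> E g -> elliptic w g ->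
  ip g g <= C * ip w w.
Proof.
have [CJ CJ0 hCJ] := opC bJ; exists (CJ / c ^+ 2).
split; first by rewrite divr_ge0// sqr_ge0.
move=> w g Ew Eg h; have := h g Eg; have := coer Eg.
have := sh_CS sh Ew (EJ Eg); have := hCJ _ Eg.
have := sh_ge0 sh Eg; have := sh_ge0 sh Ew; have := sh_ge0 sh (EJ Eg).
set gg := ip g g; set ww := ip w w; set wJ := ip w _; set JJ := ip (J g) _.
move=> JJ0 ww0 gg0 h1 h2 h3 h4; rewrite h4 in h3.
have [->|g0] := eqVneq gg 0; first by rewrite mulr_ge0// divr_ge0// sqr_ge0.
have gp : 0 < gg by rewrite lt_def g0.
rewrite mulrAC ler_pdivlMr ?exprn_gt0//.
have : (c * gg) ^+ 2 <= ww * (CJ * gg).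
  apply: (@le_trans _ _ (wJ ^+ 2)).
    have cg0 : 0 <= c * gg by rewrite mulr_ge0// ltW.
    by rewrite lerXn2r ?nnegrE// (le_trans cg0).
  by apply: (le_trans h2); rewrite ler_wpM2l.
rewrite exprMn [gg ^+ 2]expr2 mulrA [ww * _]mulrA ler_pM2r//.
by rewrite [gg * _]mulrC [CJ * _]mulrC.
Qed.

(** [S x - S (u n)] and [S (x - u n)] may differ as vectors; they have the same products with [E],
    hence the same square. *)
Lemma op_lim S u x : bounded_op E ip S -> geo_cv E ip u x ->
  geo_cv E ip (fun n => S (u n)) (S x).
Proof.
move=> bS [Ex Eu [C C0 h]]; have [CS CS0 hCS] := opC bS.
have ES z : E z -> E (S z) by exact: (op_stable bS).
apply: (geo_cvI (C := CS * C)) => [|n|n]; [exact: ES|exact: ES|].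
have Ed := shB sh Ex (Eu n).
have EE := shB sh (ES _ Ex) (ES _ (Eu n)).
suff -> : ip (S x - S (u n)) (S x - S (u n)) = ip (S (x - u n)) (S (x - u n)).
  by apply: (le_trans (hCS _ Ed)); rewrite -mulrA ler_wpM2l.
have lin z : E z -> ip (S (x - u n)) z = ip (S x - S (u n)) z.
  move=> Ez; rewrite addrC -scaleN1r (op_lin bS)// mulN1r addrC (shBl sh)//.
  - exact: ES.
  - exact: ES.
by rewrite -(lin _ EE) (sh_sym sh) ?lin//; exact: ES.
Qed.

Lemma op_linB S x y z : bounded_op E ip S -> E x -> E y -> E z ->
  ip (S (x - y)) z = ip (S x) z - ip (S y) z.
Proof.
by move=> bS Ex Ey Ez; rewrite addrC -scaleN1r (op_lin bS)// mulN1r addrC.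
Qed.

(** [form g g = ip r (J g) <= 0] makes [g] null for [form]; then [ip r (J z) = form g z = 0] for
    every [z], and the range of [J] is dense. The sign arguments below all end here. *)
Lemma elliptic_null r g : E r -> E g -> elliptic r g -> ip r (J g) <= 0 ->
  ip r r = 0.
Proof.
move=> Er Eg rg; rewrite -rg// => h.
have fg : form g g = 0 by apply/eqP; rewrite eq_le h (sh_ge0 sf).
by apply: J_dense => // z Ez; rewrite -rg// (sh_null sf).
Qed.

Lemma backward_lin a psi w g psi' w' g' : backward psi w g ->
  backward psi' w' g' ->
  backward (a *: psi + psi') (a *: w + w') (a *: g + g').
Proof.
move=> [E1 E2 E3 h1 h2] [E1' E2' E3' h1' h2'].
split; try exact: (sh_lin sh); first exact: elliptic_lin.
by move=> z Ez; rewrite (op_lin bW)// (op_lin bJ)// h2// h2'.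
Qed.

(** The explicit solutions, with test function [W (J g)], for which the sign of [ip psi w] can be
    read off. *)
Lemma backward_approx eta g : E eta -> E g -> elliptic eta g ->
  backward (J g) (W eta) (W g).
Proof.
move=> Ee Eg h; split; [exact: EJ|exact: EW|exact: EW|exact: elliptic_W|].
by move=> z Ez; rewrite JW.
Qed.

(** [ip (J g) (W eta) = form (W g) g], because [W g] is the elliptic solution for [W eta]. *)
Lemma approx_ge0 eta g : E eta -> E g -> elliptic eta g ->
  0 <= ip (J g) (W eta).
Proof.
move=> Ee Eg h; rewrite (sh_sym sh); [|exact: EJ|exact: EW].
by rewrite -(elliptic_W Ee Eg h)// formW_ge0.
Qed.

(* Maximal regularity: the elliptic part and the time derivative of a solution
   have nonnegative inner product, so each is controlled by their sum. *)
Lemma backward_ge0 psi w g : backward psi w g -> 0 <= ip psi w.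
Proof.
move=> bk; have [Epsi Ew Eg _ _] := bk.
pose h := psi + w; have Eh : E h by exact: (shD sh).
(* The sums of the two parts of explicit solutions, taken up to null vectors since the operators are
   linear only in that sense, with the functional [ip h] on them. *)
pose G x m := [/\ E x, m = ip h x & exists eta ge, [/\ E eta, E ge,
  elliptic eta ge & forall z, E z -> ip x z = ip (J ge) z + ip (W eta) z]].
have Gap eta ge : E eta -> E ge -> elliptic eta ge ->
    G (J ge + W eta) (ip h (J ge + W eta)).
  move=> Ee Ege eg; split => //; first by apply: (shD sh); [exact: EJ|exact: EW].
  exists eta, ge; split => // z Ez; rewrite (shDl sh)//; [exact: EJ|exact: EW].
have [|||||y [Ey rep _ [u [m [uy Gu]]]]] := @sh_riesz _ _ _ _ sh G (ip h h).
- exact: (sh_ge0 sh).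
- have [ge Ege eg] := elliptic_exists Ew.
  by exists (J ge + W w), (ip h (J ge + W w)); exact: Gap.
- move=> a x mx x' mx' [Ex -> [e [ge [Ee Ege eg xE]]]].
  move=> [Ex' -> [e' [ge' [Ee' Ege' eg' xE']]]].
  split; [exact: (sh_lin sh)|by rewrite (shDr sh) ?(shZr sh)//; exact: (shZ sh)|].
  exists (a *: e + e'), (a *: ge + ge'); split; try exact: (sh_lin sh).
    exact: elliptic_lin.
  move=> z Ez; rewrite (sh_linl sh)// xE// xE'// (op_lin bJ)// (op_lin bW)//; ring.
- by move=> x mx [].
- by move=> x mx [Ex -> _]; exact: (sh_CS sh).
(* Density of the sums: [r = h - y] is orthogonal to [J ge + W r], while [ip r (J ge) = form ge ge]
   and [ip r (W r)] are both nonnegative. *)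
have yh z : E z -> ip y z = ip h z.
  move=> Ez; pose r := h - y; have Er : E r by exact: (shB sh).
  have [ge Ege eg] := elliptic_exists Er.
  have EJg := EJ Ege; have EWr := EW Er.
  have : ip r (J ge + W r) = 0.
    by rewrite (shBl sh)//; [rewrite (rep _ _ (Gap _ _ Er Ege eg)) subrr|exact: (shD sh)].
  rewrite (shDr sh)// [ip r (W r)](sh_sym sh)// => r0.
  have : ip r r = 0.
    by apply: (elliptic_null Er Ege eg); have := W_ge0 Er; lra.
  by move/(sh_null sh Er Ez); rewrite (shBl sh)// => /eqP; rewrite subr_eq0 => /eqP.
have pick n : exists eg : V * V, [/\ E eg.1, E eg.2, elliptic eg.1 eg.2 &
    forall z, E z -> ip (u n) z = ip (J eg.2) z + ip (W eg.1) z].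
  by have [_ _ [e [ge H]]] := Gu n; exists (e, ge).
have [eg egP] := choice pick.
pose a n := J (eg n).2; pose b n := W (eg n).1.
have Ea n : E (a n) by apply: EJ; case: (egP n).
have Eb n : E (b n) by apply: EW; case: (egP n).
have Eu n : E (u n) by case: (Gu n).
have uab n z : E z -> ip (u n) z = ip (a n) z + ip (b n) z.
  by case: (egP n) => _ _ _; exact.
have [_ _ [K K0 yK]] := uy.
(* The cross term of the two differences is nonnegative by [approx_ge0], so the convergence of [u]
   forces those of [a] and [b] separately. *)
have cauchy n k : (n <= k)%N -> ip (a k - a n) (a k - a n) <= 4 * K * 8^-1 ^+ n
    /\ ip (b k - b n) (b k - b n) <= 4 * K * 8^-1 ^+ n.
  move=> nk; have Eda := shB sh (Ea k) (Ea n); have Edb := shB sh (Eb k) (Eb n).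
  have Edu := shB sh (Eu k) (Eu n).
  have duz z : E z -> ip (u k - u n) z = ip (a k - a n) z + ip (b k - b n) z.
    by move=> Ez; rewrite !(shBl sh)// !uab//; ring.
  have du : ip (u k - u n) (u k - u n) = ip (a k - a n) (a k - a n)
      + 2 * ip (a k - a n) (b k - b n) + ip (b k - b n) (b k - b n).
    rewrite duz// ![ip _ (u k - u n)](sh_sym sh)// !duz//.
    rewrite [ip (b k - b n) (a k - a n)](sh_sym sh)//; ring.
  have ab0 : 0 <= ip (a k - a n) (b k - b n).
    have [E1 E2 H1 _] := egP k; have [E3 E4 H2 _] := egP n.
    have := elliptic_lin (-1) E3 E1 E4 E2 H2 H1; rewrite !scaleN1r.
    rewrite ![- _ + _]addrC => H; have := approx_ge0 (shB sh E1 E3) (shB sh E2 E4) H.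
    have EWd := EW (shB sh E1 E3).
    rewrite (op_linB bJ E2 E4 EWd) -(shBl sh (Ea k) (Ea n) EWd).
    rewrite (sh_sym sh Eda EWd) (op_linB bW E1 E3 Eda).
    by rewrite -(shBl sh (Eb k) (Eb n) Eda) (sh_sym sh Edb Eda).
  have uK : ip (u k - u n) (u k - u n) <= 4 * K * 8^-1 ^+ n.
    have EA := shB sh Ey (Eu n); have EB := shB sh Ey (Eu k).
    have -> : u k - u n = (y - u n) - (y - u k) by rewrite opprB [RHS]addrC addrA subrK.
    have := sh_ge0 sh (shD sh EA EB); rewrite (sh_sqD sh EA EB) (sh_sqB sh EA EB).
    have : K * 8^-1 ^+ k <= K * 8^-1 ^+ n.
      by rewrite ler_wpM2l// ler_wiXn2l// ?invr_ge0// invf_le1// ler1n.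
    by have := yK n; have := yK k; rewrite -mulrA; lra.
  have := sh_ge0 sh Eda; have := sh_ge0 sh Edb; rewrite du in uK.
  by split; lra.
have [A [CA [EA hA]]] := sh_complete sh Ea (fun n k nk => (cauchy n k nk).1).
have [D [CD [ED hD]]] := sh_complete sh Eb (fun n k nk => (cauchy n k nk).2).
have cA : geo_cv E ip a A by exact: (geo_cvI _ _ hA).
have cD : geo_cv E ip b D by exact: (geo_cvI _ _ hD).
have AD0 : 0 <= ip A D.
  apply: (geo_cv_ge sh cA cD) => n; have [E1 E2 H1 _] := egP n.
  exact: approx_ge0.
have ADh z : E z -> ip A z + ip D z = ip h z.
  move=> Ez; rewrite -(shDl sh)// -yh//.
  apply: (geo_cv_eq sh (geo_cvD sh cA cD) (geo_cv_cst sh Ez) uy (geo_cv_cst sh Ez)).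
  by move=> n; rewrite uab// (shDl sh).
have [gD EgD HgD] := elliptic_exists ED.
(* The limit is a solution: [W (eg n).2] converges to [gD] by [elliptic_bound], and [W (a n)] agrees
   with [J (W (eg n).2)] for each [n] by commutation. *)
have bkA : backward A D gD.
  split => // z Ez.
  have [CE [CE0 hCE]] := elliptic_bound.
  have cg : geo_cv E ip (fun n => W (eg n).2) gD.
    have Eg2 n : E (W (eg n).2) by apply: EW; case: (egP n).
    apply: (geo_cvI (C := CE * CD)) => // n.
    rewrite -mulrA; apply: le_trans (ler_wpM2l CE0 (hD n)); apply: hCE.
    - exact: (shB sh).
    - exact: (shB sh).
    - have [E1 E2 H1 _] := egP n.
      have := elliptic_lin (-1) (Eb n) ED (Eg2 n) EgD (elliptic_W E1 E2 H1) HgD.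
      by rewrite !scaleN1r ![- _ + _]addrC.
  apply: (geo_cv_eq sh (op_lim bW cA) (geo_cv_cst sh Ez) (op_lim bJ cg) (geo_cv_cst sh Ez)).
  by move=> n; have [E1 E2 H1 _] := egP n; rewrite /a JW.
(* The difference [(p, e, f)] with the given solution has [p + e] null and [W p = J f] up to null
   vectors, so [ip e (J f) = - ip (W p) p <= 0] and [e] is null. *)
have := backward_lin (-1) bkA bk; rewrite !scaleN1r ![- _ + _]addrC.
set p := psi - A; set e := w - D; set f := g - gD => -[Ep Ee Ef Hef HWp].
have pe z : E z -> ip p z + ip e z = 0.
  move=> Ez; rewrite !(shBl sh)//; have := ADh z Ez; rewrite (shDl sh)//; lra.
have EJf := EJ Ef; have EWp := EW Ep.
have e0 : ip e e = 0.
  apply: (elliptic_null Ee Ef Hef).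
  have := W_ge0 Ep; rewrite HWp// (sh_sym sh)//.
  by have := pe _ EJf; lra.
have ez z : E z -> ip e z = 0 by move=> Ez; apply: (sh_null sh).
have pz z : E z -> ip p z = 0 by move=> Ez; have := pe z Ez; rewrite ez//; lra.
have -> : ip psi w = ip A D.
  have h1 := pz _ Ew; have h2 := ez _ EA.
  rewrite (shBl sh)// in h1; rewrite (sh_sym sh)// (shBr sh)// in h2; lra.
exact: AD0.
Qed.

Lemma elliptic_dense y : E y ->
  (forall g, E g -> elliptic y g -> ip y (J g + W y) = 0) -> ip y y = 0.
Proof.
move=> Ey h; have [g Eg yg] := elliptic_exists Ey.
have := h g Eg yg; have EJg := EJ Eg; have EWy := EW Ey.
rewrite (shDr sh)// [ip y (W y)](sh_sym sh)// => h0.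
by apply: (elliptic_null Ey Eg yg); have := W_ge0 Ey; lra.
Qed.

Lemma backward_dual : exists C, 0 <= C /\ forall p v, E p -> E v ->
  exists y, [/\ E y, ip y y <= C * (ip p p + ip v v) &
    forall psi w g, backward psi w g -> ip y (psi + w) = ip p psi + ip v g].
Proof.
have [CE [CE0 hCE]] := elliptic_bound.
exists (2 * (1 + CE)); split; first by rewrite mulr_ge0// addr_ge0.
move=> p v Ep Ev.
(* Given as a relation: the bound [m^2 <= C B x x] proved below also shows that the value depends on
   [psi + w] only. *)
pose G x m := exists psi w g, [/\ backward psi w g, x = psi + w &
  m = ip p psi + ip v g].
have p0 := sh_ge0 sh Ep; have v0 := sh_ge0 sh Ev.
have [|||||y [Ey rep yC _]] :=
    @sh_riesz _ _ _ _ sh G (2 * (1 + CE) * (ip p p + ip v v)).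
- by rewrite !mulr_ge0// addr_ge0.
- have [g Eg pg] := elliptic_exists Ep; do 2 eexists; do 3 eexists; split => //.
  exact: backward_approx Ep Eg pg.
- move=> a x m x' m' [psi [w [g [bk -> ->]]]] [psi' [w' [g' [bk' -> ->]]]].
  exists (a *: psi + psi'), (a *: w + w'), (a *: g + g').
  have [E1 E2 E3 _ _] := bk; have [E1' E2' E3' _ _] := bk'.
  split; [exact: backward_lin|by rewrite scalerDr addrACA|].
  rewrite !(shDr sh)//; try exact: (shZ sh).
  by rewrite !(shZr sh)//; ring.
- by move=> x m [psi [w [g [[E1 E2 _ _ _] -> _]]]]; exact: (shD sh).
(* The sign of [ip psi w] gives [|psi|^2 + |w|^2 <= |psi + w|^2], and [|g|^2 <= CE |w|^2]; the
   factor 2 comes from [(a + b)^2 <= 2 (a^2 + b^2)]. *)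
- move=> x m [psi [w [g [bk -> ->]]]]; have [E1 E2 E3 h3 _] := bk.
  have := backward_ge0 bk; rewrite (sh_sqD sh)//.
  have := hCE _ _ E2 E3 h3; have := sh_CS sh Ep E1; have := sh_CS sh Ev E3.
  have := sh_ge0 sh E1; have := sh_ge0 sh E2; have := sh_ge0 sh E3.
  set a := ip p psi; set b := ip v g; set PP := ip p p; set VV := ip v v.
  set ww := ip w w; set ss := ip psi psi; set gg := ip g g => g0 w0 s0 h1 h2 h4 h5.
  apply: (@le_trans _ _ (2 * (a ^+ 2 + b ^+ 2))).
    by have := sqr_ge0 (a - b); nra.
  rewrite -!mulrA ler_wpM2l//.
  have h6 : VV * gg <= VV * (CE * ww) by rewrite ler_wpM2l.
  apply: (@le_trans _ _ (PP * ss + VV * (CE * ww))); first by lra.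
  apply: (@le_trans _ _ ((1 + CE) * ((PP + VV) * (ss + ww)))); last first.
    by rewrite ler_wpM2l ?addr_ge0// ler_wpM2l ?addr_ge0//; lra.
  have t1 : 0 <= PP * ww by rewrite mulr_ge0. 
  have t2 : 0 <= VV * ss by rewrite mulr_ge0. 
  have t3 : 0 <= VV * ww by rewrite mulr_ge0. 
  have t4 : 0 <= PP * ss by rewrite mulr_ge0. 
  have := mulr_ge0 CE0 t1; have := mulr_ge0 CE0 t2.
  have := mulr_ge0 CE0 t3; have := mulr_ge0 CE0 t4; lra.
exists y; split => // psi w g bk; apply: rep; by exists psi, w, g.
Qed.

End Parabolic.

(** * Integral operators with Schur kernels *)

Section ProductMeasure.
Context d1 d2 (T1 : measurableType d1) (T2 : measurableType d2) (R : realType).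
Context (m1 : {sigma_finite_measure set T1 -> \bar R})
        (m2 : {sigma_finite_measure set T2 -> \bar R}).

(** Tonelli applies to the positive and negative parts, and [fine] sends an infinite difference to 0
    in a measurable way. *)
Lemma measurable_param_Rintegral (h : T1 * T2 -> R) : measurable_fun setT h ->
  measurable_fun setT (fun x => \int[m2]_y h (x, y)).
Proof.
move=> mh; apply: (measurableT_comp (fine_measurable measurableT)).
have mE : measurable_fun setT (EFin \o h) by apply/measurable_EFinP.
rewrite [X in measurable_fun _ X](_ : _ = fun x =>
  ((\int[m2]_y (EFin \o h)^\+ (x, y)) - (\int[m2]_y (EFin \o h)^\- (x, y)))%E).
  apply: emeasurable_funB.
  - apply: (measurable_fun_fubini_tonelli_F (EFin \o h)^\+%E) => //.
    exact: measurable_funepos.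
  - apply: (measurable_fun_fubini_tonelli_F (EFin \o h)^\-%E) => //.
    exact: measurable_funeneg.
apply/funext => x; rewrite [LHS]integralE.
by congr (_ - _)%E; apply: eq_integral => y _; rewrite ?funeposE ?funenegE.
Qed.

Lemma ae_prod (P : T1 * T2 -> Prop) : {ae (m1 \x m2)%E, forall z, P z} ->
  {ae m1, forall x, {ae m2, forall y, P (x, y)}}.
Proof.
move=> [A [mA A0 PA]].
have : (\int[m1]_x `|m2 (xsection A x)| = 0)%E.
  rewrite -[RHS]A0 /product_measure1 /=.
  by apply: eq_integral => x _; rewrite gee0_abs.
move/(ae_eq_integral_abs m1 measurableT (measurable_fun_xsection _ mA)).
apply: filterS => x /(_ I) /= x0.
exists (xsection A x); split => //; first exact: measurable_xsection.
by move=> y nP; rewrite /xsection /= inE; exact: PA.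
Qed.

Lemma prod_ae (P : T1 * T2 -> Prop) : measurable [set z | P z] ->
  {ae m1, forall x, {ae m2, forall y, P (x, y)}} ->
  {ae (m1 \x m2)%E, forall z, P z}.
Proof.
move=> mP aeP; exists (~` [set z | P z]); split; [exact: measurableC| |by []].
rewrite /product_measure1 /=.
rewrite (ae_eq_integral (cst 0%E))//; first exact: integral0.
  by apply: measurable_fun_xsection; exact: measurableC.
apply: filterS aeP => x [A [mA A0 PA]] _ /=.
apply/eqP; rewrite eq_le measure_ge0 andbT -A0.
apply: le_measure; rewrite ?inE//.
  by apply: measurable_xsection; exact: measurableC.
by move=> y; rewrite /xsection /= inE => nP; exact: PA.
Qed.

Lemma measurable_pair1 d (X : measurableType d) (f : T1 * T2 -> X) x :
  measurable_fun setT f -> measurable_fun setT (fun y => f (x, y)).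
Proof. by move=> mf; exact: measurableT_comp. Qed.

Lemma measurable_pair2 d (X : measurableType d) (f : T1 * T2 -> X) y :
  measurable_fun setT f -> measurable_fun setT (fun x => f (x, y)).
Proof. by move=> mf; exact: measurableT_comp. Qed.

(** The inner integrals are finite for almost every [x]; elsewhere the real inner integral takes a
    default value, on a null set. *)
Lemma Rintegral_prod1 (h : T1 * T2 -> R) :
  (m1 \x m2)%E.-integrable setT (EFin \o h) ->
  \int[(m1 \x m2)%E]_z h z = \int[m1]_x \int[m2]_y h (x, y).
Proof.
move=> ih; have mh : measurable_fun setT h.
  by apply/measurable_EFinP; exact: (measurable_int _ ih).
rewrite /Rintegral -(integral12_prod_meas1 ih); congr fine.
apply: ae_eq_integral => //.
- exact: (measurable_int _ (integrable_fubini_F ih)).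
- by apply/measurable_EFinP; exact: measurable_param_Rintegral.
apply: filterS (ae_integrable1 ih) => x hx _ /=.
by rewrite fineK//; exact: integrable_fin_num.
Qed.

Lemma integrable_Rintegral1 (h : T1 * T2 -> R) :
  (m1 \x m2)%E.-integrable setT (EFin \o h) ->
  m1.-integrable setT (fun x => (\int[m2]_y h (x, y))%:E).
Proof.
move=> ih; have mh : measurable_fun setT h.
  by apply/measurable_EFinP; exact: (measurable_int _ ih).
have iF := integrable_fubini_F ih.
apply: (le_integrable measurableT _ _ iF).
  by apply/measurable_EFinP; exact: measurable_param_Rintegral.
move=> x _; rewrite /fubini_F /Rintegral /=.
by case: (integral _ _ _) => [r| |] //=; rewrite normr0 leey.
Qed.

Lemma sqint_sections (f : T1 * T2 -> R) : sqint (m1 \x m2)%E f ->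
  {ae m1, forall x, sqint m2 (fun y => f (x, y))}.
Proof.
move=> f2; have [mf _] := f2.
apply: filterS (ae_integrable1 (sqint_integrable_sq f2)) => x ix.
by split; [exact: measurable_pair1|exact: (integrable_lty measurableT ix)].
Qed.

Lemma ip_sections (f g : T1 * T2 -> R) : sqint (m1 \x m2)%E f ->
  sqint (m1 \x m2)%E g ->
  ip (m1 \x m2)%E f g = \int[m1]_x ip m2 (fun y => f (x, y)) (fun y => g (x, y)).
Proof. by move=> f2 g2; rewrite /ip Rintegral_prod1//; exact: sqint_integrable_mul. Qed.

End ProductMeasure.

Section Swap.
Context d1 d2 (T1 : measurableType d1) (T2 : measurableType d2) (R : realType).
Context (m1 : {sigma_finite_measure set T1 -> \bar R})
        (m2 : {sigma_finite_measure set T2 -> \bar R}).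

Lemma measurable_fun_swap d (X : measurableType d) (f : T1 * T2 -> X) :
  measurable_fun setT f -> measurable_fun setT (fun z : T2 * T1 => f (z.2, z.1)).
Proof.
move=> mf; apply: (measurableT_comp mf).
by apply/measurable_fun_pairP; split; [exact: measurable_snd|exact: measurable_fst].
Qed.

Lemma ge0_integral_swap (f : T1 * T2 -> \bar R) : measurable_fun setT f ->
  (forall z, (0 <= f z)%E) ->
  (\int[(m1 \x m2)%E]_z f z = \int[(m2 \x m1)%E]_z f (z.2, z.1))%E.
Proof.
move=> mf f0; rewrite fubini_tonelli2// fubini_tonelli1//.
exact: measurable_fun_swap.
Qed.

Lemma sqint_swap (f : T1 * T2 -> R) : sqint (m1 \x m2)%E f ->
  sqint (m2 \x m1)%E (fun z => f (z.2, z.1)).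
Proof.
move=> [mf fi]; split; first exact: measurable_fun_swap.
rewrite -(ge0_integral_swap (f := fun z => (f z ^+ 2)%:E))//.
- exact: measurable_sqE.
- by move=> z; rewrite lee_fin sqr_ge0.
Qed.

Lemma Rintegral_swap (f : T1 * T2 -> R) : measurable_fun setT f ->
  \int[(m1 \x m2)%E]_z f z = \int[(m2 \x m1)%E]_z f (z.2, z.1).
Proof.
move=> mf; rewrite /Rintegral; congr fine; rewrite integralE [in RHS]integralE.
have mE : measurable_fun setT (EFin \o f) by apply/measurable_EFinP.
rewrite (ge0_integral_swap (f := (EFin \o f)^\+%E))//; last exact: measurable_funepos.
rewrite (ge0_integral_swap (f := (EFin \o f)^\-%E))//; last exact: measurable_funeneg.
by congr (_ - _)%E; apply: eq_integral => y _; rewrite ?funeposE ?funenegE.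
Qed.

Lemma ip_swap (f g : T1 * T2 -> R) : measurable_fun setT f ->
  measurable_fun setT g ->
  ip (m1 \x m2)%E f g = ip (m2 \x m1)%E (fun z => f (z.2, z.1)) (fun z => g (z.2, z.1)).
Proof. by move=> mf mg; rewrite /ip Rintegral_swap//; exact: measurable_funM. Qed.

Lemma ae_swap (P : T1 * T2 -> Prop) : {ae (m1 \x m2)%E, forall z, P z} ->
  {ae (m2 \x m1)%E, forall z, P (z.2, z.1)}.
Proof.
move=> [A [mA A0 PA]].
have msw : measurable_fun setT (fun z : T2 * T1 => (z.2, z.1)).
  by apply/measurable_fun_pairP; split; [exact: measurable_snd|exact: measurable_fst].
have mB : measurable [set z : T2 * T1 | A (z.2, z.1)].
  by rewrite -[X in measurable X]setTI; exact: msw.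
exists [set z | A (z.2, z.1)]; split => //; last by move=> z nP; apply: PA.
rewrite -[LHS]/((m2 \x m1)%E _) -[X in (m2 \x m1)%E X]setIT -integral_indic//.
transitivity (\int[(m1 \x m2)%E]_z (\1_A z)%:E)%E; last by rewrite integral_indic// setIT.
apply/esym; rewrite ge0_integral_swap//.
by apply/measurable_EFinP; exact: measurable_indic.
Qed.

End Swap.

(** * The Schur test *)

Section KernelOperator.
Context d (T : measurableType d) (R : realType).
Context (m : {sigma_finite_measure set T -> \bar R}).
Implicit Types (k l : T -> T -> R) (f g h : T -> R).

Definition kop k f x : R := \int[m]_s (k x s * f s).

(** One constant for rows and columns makes the class stable under transposition, and bounds at
    every point leave no exceptional set to track. The operator norm on L^2 is then at most [C]. *)
Record schur k (C : R) : Prop := Schur {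
  schur_measurable : measurable_fun setT (fun z : T * T => k z.1 z.2);
  schur_ge0 : forall x s, 0 <= k x s;
  schur_gt0 : 0 < C;
  schur_row : forall x, (\int[m]_s (k x s)%:E <= C%:E)%E;
  schur_col : forall s, (\int[m]_x (k x s)%:E <= C%:E)%E }.

Lemma schur_transpose k C : schur k C -> schur (fun x s => k s x) C.
Proof.
by move=> [mk k0 C0 kr kc]; split => //; exact: (measurable_fun_swap mk).
Qed.

Lemma measurable_kop k f : measurable_fun setT (fun z : T * T => k z.1 z.2) ->
  measurable_fun setT f -> measurable_fun setT (kop k f).
Proof.
move=> mk mf; apply: (@measurable_param_Rintegral _ _ _ _ _ m (fun z => k z.1 z.2 * f z.2)).
by apply: measurable_funM => //; exact: measurableT_comp.
Qed.

Lemma measurable_schur_row k C x : schur k C -> measurable_fun setT (k x).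
Proof. by move=> sk; exact: (measurable_pair1 x (schur_measurable sk)). Qed.

(** Cauchy-Schwarz for the weight [k x]: the square of [int k f] is at most [(int k) (int k f^2)],
    and the first factor is at most [C]. It is proved by the discriminant of
    [t |-> int k (f - t)^2]. *)
Lemma sqr_kernel_integrable k C f x : schur k C -> measurable_fun setT f ->
  (\int[m]_s (k x s * f s ^+ 2)%:E < +oo)%E ->
  m.-integrable setT (EFin \o (fun s => k x s * f s)) /\
  ((kop k f x ^+ 2)%:E <= C%:E * \int[m]_s (k x s * f s ^+ 2)%:E)%E.
Proof.
move=> sk mf fin; have mk := measurable_schur_row x sk.
have k0 := schur_ge0 sk x.
have ik : m.-integrable setT (EFin \o k x).
  apply/integrableP; split; first exact/measurable_EFinP.
  under eq_integral do rewrite /= ger0_norm//.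
  exact: le_lt_trans (schur_row sk x) (ltry _).
have ikf2 : m.-integrable setT (EFin \o (fun s => k x s * f s ^+ 2)).
  apply/integrableP; split.
    by apply/measurable_EFinP; apply: measurable_funM => //; exact: measurable_funX.
  rewrite (eq_integral (fun s => (k x s * f s ^+ 2)%:E))// => s _.
  by rewrite gee0_abs// lee_fin mulr_ge0// sqr_ge0.
have ikf : m.-integrable setT (EFin \o (fun s => k x s * f s)).
  apply: (le_integrable measurableT _ _ (integrableD measurableT ik ikf2)).
    by apply/measurable_EFinP; exact: measurable_funM.
  move=> s _; rewrite /= lee_fin normrM ger0_norm//.
  rewrite [leRHS]ger0_norm; last first.
    by apply: addr_ge0 => //; apply: mulr_ge0 => //; exact: sqr_ge0.
  rewrite -[X in X + _]mulr1 -mulrDr ler_wpM2l//.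
  rewrite -(real_normK (num_real (f s))).
  by have := sqr_ge0 (`|f s| - 1); have := normr_ge0 (f s); nra.
split=> //; pose c := kop k f x; pose S := \int[m]_s k x s.
pose F := \int[m]_s (k x s * f s ^+ 2).
have FE : (F%:E = \int[m]_s (k x s * f s ^+ 2)%:E)%E.
  by rewrite /F /Rintegral fineK//; exact: integrable_fin_num.
have SC : S <= C.
  rewrite -lee_fin; apply: le_trans (schur_row sk x).
  by rewrite /S /Rintegral fineK//; exact: integrable_fin_num.
have S0 : 0 <= S by exact: Rintegral_ge0.
have F0 : 0 <= F by apply: Rintegral_ge0 => s _; rewrite mulr_ge0// sqr_ge0.
have key t : 0 <= F - 2 * t * c + t ^+ 2 * S.
  have -> : F - 2 * t * c + t ^+ 2 * S = \int[m]_s (k x s * (f s - t) ^+ 2).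
    rewrite /F /c /S /kop -!RintegralZl//.
    rewrite -RintegralB//; last by apply: eq_integrable (integrableZl measurableT (2 * t) ikf).
    rewrite -RintegralD//; last 2 first.
    - by apply: eq_integrable (integrableB measurableT ikf2 (integrableZl measurableT (2 * t) ikf)).
    - by apply: eq_integrable (integrableZl measurableT (t ^+ 2) ik).
    by apply: eq_Rintegral => s _; ring.
  by apply: Rintegral_ge0 => s _; rewrite mulr_ge0// sqr_ge0.
rewrite -FE -EFinM lee_fin -/c.
apply: (@le_trans _ _ (S * F)); last by rewrite ler_wpM2r.
have [S0'|S0'] := eqVneq S 0.
  have [->|c0] := eqVneq c 0; first by rewrite expr0n mulr_ge0.
  (* With [S = 0] the polynomial is affine in [t]; this [t] gives it the value [-1]. *)
  have := key ((F + 1) / (2 * c)); rewrite S0'.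
  have -> : 2 * ((F + 1) / (2 * c)) * c = F + 1 by field.
  lra.
have Sp : 0 < S by rewrite lt_def S0'.
have := key (c / S).
have -> : F - 2 * (c / S) * c + (c / S) ^+ 2 * S = (S * F - c ^+ 2) / S by field.
by rewrite pmulr_lge0 ?invr_gt0// subr_ge0.
Qed.

Lemma schur_sq_fubini k C f : schur k C -> measurable_fun setT f ->
  (\int[m]_x \int[m]_s (k x s * f s ^+ 2)%:E <= C%:E * \int[m]_s (f s ^+ 2)%:E)%E.
Proof.
move=> sk mf; have [mk k0 C0 kr kc] := sk.
rewrite (fubini_tonelli (fun z => (k z.1 z.2 * f z.2 ^+ 2)%:E)); last 2 first.
  apply/measurable_EFinP; apply: measurable_funM => //.
  by apply: measurable_funX; exact: measurableT_comp.
  by move=> z; rewrite lee_fin mulr_ge0// sqr_ge0.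
rewrite -ge0_integralZl_EFin//; last 3 first.
- by move=> x _; rewrite lee_fin sqr_ge0.
- exact: measurable_sqE.
- exact: ltW.
apply: ge0_le_integral => //=.
- by move=> s _; apply: integral_ge0 => x _; rewrite lee_fin mulr_ge0// sqr_ge0.
- apply: (@measurable_fun_fubini_tonelli_G _ _ _ _ _ m (fun z => (k z.1 z.2 * f z.2 ^+ 2)%:E)).
    apply/measurable_EFinP; apply: measurable_funM => //.
    by apply: measurable_funX; exact: measurableT_comp.
  by move=> z; rewrite lee_fin mulr_ge0// sqr_ge0.
- by apply: emeasurable_funM => //; exact: measurable_sqE.
move=> s _; under eq_integral do rewrite mulrC EFinM.
rewrite ge0_integralZl_EFin ?sqr_ge0//; last 2 first.
- by move=> x _; rewrite lee_fin.
- by apply/measurable_EFinP; exact: (measurable_pair2 s mk).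
by rewrite muleC lee_wpmul2r ?lee_fin ?sqr_ge0.
Qed.

(** The row bound gives one factor [C] at each point, Tonelli with the column bound the other. *)
Lemma kop_sq_le k C f : schur k C -> measurable_fun setT f ->
  (\int[m]_x (kop k f x ^+ 2)%:E <= (C ^+ 2)%:E * \int[m]_s (f s ^+ 2)%:E)%E.
Proof.
move=> sk mf; have [mk k0 C0 kr kc] := sk.
pose F x := (\int[m]_s (k x s * f s ^+ 2)%:E)%E.
have F0 x : (0 <= F x)%E.
  by apply: integral_ge0 => s _; rewrite lee_fin mulr_ge0// sqr_ge0.
have mF : measurable_fun setT F.
  apply: (@measurable_fun_fubini_tonelli_F _ _ _ _ _ m (fun z => (k z.1 z.2 * f z.2 ^+ 2)%:E)).
    apply/measurable_EFinP; apply: measurable_funM => //.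
    by apply: measurable_funX; exact: measurableT_comp.
  by move=> z; rewrite lee_fin mulr_ge0// sqr_ge0.
apply: (@le_trans _ _ (\int[m]_x (C%:E * F x))%E).
  apply: ge0_le_integral => //=.
  - by move=> x _; rewrite lee_fin sqr_ge0.
  - by apply: measurable_sqE; exact: measurable_kop.
  - exact: emeasurable_funM.
  move=> x _; case: (ltP (F x) +oo%E) => Fx; last first.
    by move: Fx; rewrite leye_eq => /eqP ->; rewrite gt0_muley ?leey// lte_fin.
  by have [] := sqr_kernel_integrable sk mf Fx.
rewrite ge0_integralZl_EFin//; last exact: ltW.
rewrite expr2 EFinM -muleA; apply: lee_wpmul2l; first by rewrite lee_fin ltW.
exact: schur_sq_fubini.
Qed.

Lemma kop_integrable_ae k C f : schur k C -> sqint m f ->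
  {ae m, forall x, m.-integrable setT (EFin \o (fun s => k x s * f s))}.
Proof.
move=> sk [mf fi]; have [mk k0 C0 kr kc] := sk.
pose F x := (\int[m]_s (k x s * f s ^+ 2)%:E)%E.
have F0 x : (0 <= F x)%E.
  by apply: integral_ge0 => s _; rewrite lee_fin mulr_ge0// sqr_ge0.
have mF : measurable_fun setT F.
  apply: (@measurable_fun_fubini_tonelli_F _ _ _ _ _ m (fun z => (k z.1 z.2 * f z.2 ^+ 2)%:E)).
    apply/measurable_EFinP; apply: measurable_funM => //.
    by apply: measurable_funX; exact: measurableT_comp.
  by move=> z; rewrite lee_fin mulr_ge0// sqr_ge0.
have iF : m.-integrable setT F.
  apply/integrableP; split => //; under eq_integral do rewrite gee0_abs//.
  apply: le_lt_trans (schur_sq_fubini sk mf) _.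
  by rewrite lte_mul_pinfty// lee_fin ltW.
apply: filterS (integrable_ae measurableT iF) => x /(_ I) Fx.
have [] // := @sqr_kernel_integrable k C f x sk mf.
by rewrite -ge0_fin_numE//; exact: F0.
Qed.

Lemma kop_sqint k C f : schur k C -> sqint m f -> sqint m (kop k f).
Proof.
move=> sk [mf fi]; split; first exact: measurable_kop (schur_measurable sk) mf.
apply: le_lt_trans (kop_sq_le sk mf) _.
by rewrite lte_mul_pinfty// lee_fin sqr_ge0.
Qed.

(** [|k f h| <= k f^2 + k h^2], where columns control the first term and rows the second. This
    licenses Fubini in the adjoint formula. *)
Lemma schur_integrable_mul k C f h : schur k C -> sqint m f -> sqint m h ->
  (m \x m)%E.-integrable setT (EFin \o (fun z => k z.1 z.2 * f z.2 * h z.1)).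
Proof.
move=> sk f2 h2; have [mk k0 C0 kr kc] := sk.
have [mf fi] := f2; have [mh hi] := h2.
have mk2 g : measurable_fun setT g ->
    measurable_fun setT (fun z : T * T => (k z.1 z.2 * g z.2 ^+ 2)).
  by move=> mg; apply: measurable_funM => //; apply: measurable_funX; exact: measurableT_comp.
have mk1 g : measurable_fun setT g ->
    measurable_fun setT (fun z : T * T => (k z.1 z.2 * g z.1 ^+ 2)).
  by move=> mg; apply: measurable_funM => //; apply: measurable_funX; exact: measurableT_comp.
have i1 : (m \x m)%E.-integrable setT (EFin \o (fun z => k z.1 z.2 * f z.2 ^+ 2)).
  apply/integrable12ltyP; first by apply/measurable_EFinP; exact: mk2.
  apply: le_lt_trans (_ : (C%:E * \int[m]_s (f s ^+ 2)%:E < +oo)%E); last first.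
    by rewrite lte_mul_pinfty// lee_fin ltW.
  apply: le_trans (schur_sq_fubini sk mf); rewrite le_eqVlt; apply/orP; left; apply/eqP.
  apply: eq_integral => x _; apply: eq_integral => s _.
  by rewrite gee0_abs// lee_fin mulr_ge0// sqr_ge0.
have i2 : (m \x m)%E.-integrable setT (EFin \o (fun z => k z.1 z.2 * h z.1 ^+ 2)).
  apply/integrable21ltyP; first by apply/measurable_EFinP; exact: mk1.
  apply: le_lt_trans (_ : (C%:E * \int[m]_s (h s ^+ 2)%:E < +oo)%E); last first.
    by rewrite lte_mul_pinfty// lee_fin ltW.
  apply: le_trans (schur_sq_fubini (schur_transpose sk) mh).
  rewrite le_eqVlt; apply/orP; left; apply/eqP.
  apply: eq_integral => x _; apply: eq_integral => s _.
  by rewrite gee0_abs// lee_fin mulr_ge0// sqr_ge0.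
apply: (le_integrable measurableT _ _ (integrableD measurableT i1 i2)).
  apply/measurable_EFinP; apply: measurable_funM; last exact: measurableT_comp.
  by apply: measurable_funM => //; exact: measurableT_comp.
move=> z _; rewrite /= lee_fin !normrM ger0_norm//.
rewrite [leRHS]ger0_norm; last first.
  by apply: addr_ge0; apply: mulr_ge0 => //; exact: sqr_ge0.
rewrite -mulrDr -mulrA ler_wpM2l// -(real_normK (num_real (f z.2))) -(real_normK (num_real (h z.1))).
have := sqr_ge0 (`|f z.2| - `|h z.1|); have := normr_ge0 (f z.2).
by have := normr_ge0 (h z.1); nra.
Qed.

Lemma ip_kop k C f h : schur k C -> sqint m f -> sqint m h ->
  ip m (kop k f) h = \int[(m \x m)%E]_z (k z.1 z.2 * f z.2 * h z.1).
Proof.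
move=> sk f2 h2; have i := schur_integrable_mul sk f2 h2.
rewrite Rintegral_prod1// /ip /Rintegral; congr fine.
have [mf _] := f2; have [mh _] := h2; have mk := schur_measurable sk.
apply: ae_eq_integral => //.
- by apply/measurable_EFinP; apply: measurable_funM => //; exact: measurable_kop.
- exact: (measurable_int _ (integrable_Rintegral1 i)).
apply: filterS (kop_integrable_ae sk f2) => x ix _ /=; congr EFin.
by rewrite -[LHS]RintegralZr.
Qed.

Lemma kop_adjoint k C f h : schur k C -> sqint m f -> sqint m h ->
  ip m (kop k f) h = ip m f (kop (fun x s => k s x) h).
Proof.
move=> sk f2 h2; have skT := schur_transpose sk.
have [mf _] := f2; have [mh _] := h2; have mk := schur_measurable sk.
rewrite (ip_kop sk f2 h2) ipC (ip_kop skT h2 f2) Rintegral_swap.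
  by apply: eq_Rintegral => z _ /=; rewrite mulrAC.
apply: measurable_funM; last exact: measurableT_comp.
by apply: measurable_funM => //; exact: measurableT_comp.
Qed.

End KernelOperator.

(** * Kernel operators in the second (space) and in the first (time) variable *)

Section ProductOperators.
Context d1 d2 (T1 : measurableType d1) (T2 : measurableType d2) (R : realType).
Context (m1 : {sigma_finite_measure set T1 -> \bar R})
        (m2 : {sigma_finite_measure set T2 -> \bar R}).

Lemma integrable_swap (f : T1 * T2 -> R) :
  (m1 \x m2)%E.-integrable setT (EFin \o f) ->
  (m2 \x m1)%E.-integrable setT (EFin \o (fun z => f (z.2, z.1))).
Proof.
move=> /integrableP[mf fi]; apply/integrableP; split.
  by apply/measurable_EFinP; apply: measurable_fun_swap; apply/measurable_EFinP.
rewrite -(@ge0_integral_swap _ _ _ _ _ m1 m2 (fun z => `|(f z)%:E|%E))//.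
by apply: measurableT_comp.
Qed.

Lemma Rintegral_prod2 (h : T1 * T2 -> R) :
  (m1 \x m2)%E.-integrable setT (EFin \o h) ->
  \int[(m1 \x m2)%E]_z h z = \int[m2]_y \int[m1]_x h (x, y).
Proof.
move=> ih; have mh : measurable_fun setT h.
  by apply/measurable_EFinP; exact: (measurable_int _ ih).
by rewrite Rintegral_swap// Rintegral_prod1//; exact: integrable_swap.
Qed.

Lemma measurable_fun_uncurry d3 d4 d5 d6 (A : measurableType d3)
    (B : measurableType d4) (C : measurableType d5) (X : measurableType d6)
    (k : A -> B -> C) (f : X -> A) (g : X -> B) :
  measurable_fun setT (fun z : A * B => k z.1 z.2) ->
  measurable_fun setT f -> measurable_fun setT g ->
  measurable_fun setT (fun x => k (f x) (g x)).
Proof.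
move=> mk mf mg; have mfg : measurable_fun setT (fun x => (f x, g x)).
  by apply/measurable_fun_pairP; split.
exact: (measurableT_comp mk mfg).
Qed.

Definition op2 (k : T2 -> T2 -> R) (f : T1 * T2 -> R) (z : T1 * T2) : R :=
  kop m2 k (fun s => f (z.1, s)) z.2.

Lemma measurable_op2 k f : measurable_fun setT (fun z : T2 * T2 => k z.1 z.2) ->
  measurable_fun setT f -> measurable_fun setT (op2 k f).
Proof.
move=> mk mf.
apply: (@measurable_param_Rintegral _ _ (T1 * T2)%type _ _ m2
  (fun z => k z.1.2 z.2 * f (z.1.1, z.2))).
apply: measurable_funM.
- apply: (measurable_fun_uncurry mk); last exact: measurable_snd.
  exact: (measurableT_comp measurable_snd measurable_fst).
- apply: (measurable_fun_uncurry (k := fun x y => f (x, y))).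
  + by apply: eq_measurable_fun mf => -[].
  + exact: (measurableT_comp measurable_fst measurable_fst).
  + exact: measurable_snd.
Qed.

Lemma op2_sq_le k C f : schur m2 k C -> measurable_fun setT f ->
  (\int[(m1 \x m2)%E]_z (op2 k f z ^+ 2)%:E <=
   (C ^+ 2)%:E * \int[(m1 \x m2)%E]_z (f z ^+ 2)%:E)%E.
Proof.
move=> sk mf; have mk := schur_measurable sk.
have mo := measurable_op2 mk mf.
have fub (g : T1 * T2 -> R) : measurable_fun setT g ->
    (\int[(m1 \x m2)%E]_z (g z ^+ 2)%:E = \int[m1]_x \int[m2]_y (g (x, y) ^+ 2)%:E)%E.
  move=> mg; rewrite (fubini_tonelli1 (fun z => (g z ^+ 2)%:E))//.
    exact: measurable_sqE.
  by move=> z; rewrite lee_fin sqr_ge0.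
have mfub (g : T1 * T2 -> R) : measurable_fun setT g ->
    measurable_fun setT (fun x => \int[m2]_y (g (x, y) ^+ 2)%:E)%E.
  move=> mg; apply: (measurable_fun_fubini_tonelli_F (fun z => (g z ^+ 2)%:E)).
    exact: measurable_sqE.
  by move=> z; rewrite lee_fin sqr_ge0.
have sq0 (g : T1 * T2 -> R) x : (0 <= \int[m2]_y (g (x, y) ^+ 2)%:E)%E.
  by apply: integral_ge0 => y _; rewrite lee_fin sqr_ge0.
rewrite (fub _ mo) (fub _ mf) -ge0_integralZl_EFin ?sqr_ge0//; last exact: mfub.
apply: ge0_le_integral => //=.
- exact: mfub.
- by apply: emeasurable_funM => //; exact: mfub.
- by move=> x _; exact: (@kop_sq_le _ _ _ m2 k C (fun y => f (x, y)) sk (measurable_pair1 x mf)).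
Qed.

Lemma op2_sqint k C f : schur m2 k C -> sqint (m1 \x m2)%E f ->
  sqint (m1 \x m2)%E (op2 k f).
Proof.
move=> sk [mf fi]; split; first exact: measurable_op2 (schur_measurable sk) mf.
apply: le_lt_trans (op2_sq_le sk mf) _.
by rewrite lte_mul_pinfty// lee_fin sqr_ge0.
Qed.

Lemma op2_bounded k C f : schur m2 k C -> sqint (m1 \x m2)%E f ->
  ip (m1 \x m2)%E (op2 k f) (op2 k f) <= C ^+ 2 * ip (m1 \x m2)%E f f.
Proof.
move=> sk f2; rewrite -lee_fin EFinM !ip_sqE//; last exact: op2_sqint sk f2.
by have [mf _] := f2; exact: op2_sq_le.
Qed.

Lemma op2_adjoint k C f h : schur m2 k C -> sqint (m1 \x m2)%E f ->
  sqint (m1 \x m2)%E h ->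
  ip (m1 \x m2)%E (op2 k f) h = ip (m1 \x m2)%E f (op2 (fun x s => k s x) h).
Proof.
move=> sk f2 h2; have skT := schur_transpose sk.
have o2 := op2_sqint sk f2; have oT2 := op2_sqint skT h2.
rewrite (ip_sections o2 h2) (ip_sections f2 oT2).
have i1 := integrable_Rintegral1 (sqint_integrable_mul o2 h2).
have i2 := integrable_Rintegral1 (sqint_integrable_mul f2 oT2).
rewrite /Rintegral; congr fine; apply: ae_eq_integral => //.
- exact: (measurable_int _ i1).
- exact: (measurable_int _ i2).
apply: filterS2 (sqint_sections f2) (sqint_sections h2) => x fx hx _.
by congr EFin; exact: (kop_adjoint sk fx hx).
Qed.

End ProductOperators.

Section ProductOperators1.
Context d1 d2 (T1 : measurableType d1) (T2 : measurableType d2) (R : realType).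
Context (m1 : {sigma_finite_measure set T1 -> \bar R})
        (m2 : {sigma_finite_measure set T2 -> \bar R}).

Definition op1 (k : T1 -> T1 -> R) (f : T1 * T2 -> R) (z : T1 * T2) : R :=
  kop m1 k (fun s => f (s, z.2)) z.1.

Let op1E k f : op1 k f = fun z => op2 m1 k (fun w => f (w.2, w.1)) (z.2, z.1).
Proof. by []. Qed.

Lemma measurable_op1 k f : measurable_fun setT (fun z : T1 * T1 => k z.1 z.2) ->
  measurable_fun setT f -> measurable_fun setT (op1 k f).
Proof.
move=> mk mf; rewrite op1E; apply: measurable_fun_swap.
by apply: measurable_op2 => //; exact: measurable_fun_swap.
Qed.

Lemma op1_sqint k C f : schur m1 k C -> sqint (m1 \x m2)%E f ->
  sqint (m1 \x m2)%E (op1 k f).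
Proof.
move=> sk f2; rewrite op1E; apply: sqint_swap; apply: (op2_sqint sk).
exact: sqint_swap.
Qed.

Lemma op1_bounded k C f : schur m1 k C -> sqint (m1 \x m2)%E f ->
  ip (m1 \x m2)%E (op1 k f) (op1 k f) <= C ^+ 2 * ip (m1 \x m2)%E f f.
Proof.
move=> sk f2; have [mf _] := f2; have [mo _] := op1_sqint sk f2.
by rewrite (ip_swap m1 m2 mo mo) (ip_swap m1 m2 mf mf); exact: op2_bounded sk (sqint_swap f2).
Qed.

Lemma op1_adjoint k C f h : schur m1 k C -> sqint (m1 \x m2)%E f ->
  sqint (m1 \x m2)%E h ->
  ip (m1 \x m2)%E (op1 k f) h = ip (m1 \x m2)%E f (op1 (fun x s => k s x) h).
Proof.
move=> sk f2 h2; have skT := schur_transpose sk.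
have [mf _] := f2; have [mh _] := h2.
have [mo _] := op1_sqint sk f2; have [mo' _] := op1_sqint skT h2.
rewrite (ip_swap m1 m2 mo mh) (ip_swap m1 m2 mf mo'); exact: op2_adjoint sk (sqint_swap f2) (sqint_swap h2).
Qed.

Lemma prod_sigma_finite : sigma_finite [set: T1 * T2] (m1 \x m2)%E.
Proof.
have /sigma_finiteP[F [TF ndF Foo]] := sigma_finiteT m1.
have /sigma_finiteP[G [TG ndG Goo]] := sigma_finiteT m2.
exists (fun n => F n `*` G n).
  apply/esym; rewrite -subTset => -[x y] _.
  have [i _ Fx] : (\bigcup_i F i) x by rewrite -TF.
  have [j _ Gy] : (\bigcup_i G i) y by rewrite -TG.
  exists (maxn i j) => //; split => /=.
  - by move: x Fx; exact/subsetPset/ndF/leq_maxl.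
  - by move: y Gy; exact/subsetPset/ndG/leq_maxr.
move=> k; have [? ?] := Foo k; have [? ?] := Goo k.
split; first exact: measurableX.
by rewrite product_measure1E// lte_mul_pinfty// ge0_fin_numE.
Qed.

(** Packaged as a sigma-finite measure, so that Schur kernels on pairs and products of three factors
    fall under the results for a single measure. *)
Definition prod_measure : {sigma_finite_measure set (T1 * T2)%type -> \bar R} :=
  HB.pack (m1 \x m2)%E (Measure_isSigmaFinite.Build _ _ _ (m1 \x m2)%E prod_sigma_finite).

Lemma schur_prod (l : T1 -> T1 -> R) (k : T2 -> T2 -> R) C D :
  schur m1 l C -> schur m2 k D ->
  schur prod_measure (fun z w => l z.1 w.1 * k z.2 w.2) (C * D).
Proof.
have row (l' : T1 -> R) (k' : T2 -> R) : 0 < C -> 0 < D ->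
    measurable_fun setT l' -> measurable_fun setT k' ->
    (forall t, 0 <= l' t) -> (forall x, 0 <= k' x) ->
    (\int[m1]_t (l' t)%:E <= C%:E)%E -> (\int[m2]_x (k' x)%:E <= D%:E)%E ->
    (\int[(m1 \x m2)%E]_w (l' w.1 * k' w.2)%:E <= (C * D)%:E)%E.
  move=> C0 D0 ml mk l0 k0 lC kD.
  rewrite fubini_tonelli1//; last 2 first.
  - apply/measurable_EFinP; apply: measurable_funM; exact: measurableT_comp.
  - by move=> w; rewrite lee_fin mulr_ge0.
  rewrite /fubini_F /=.
  rewrite (eq_integral (fun x => (l' x)%:E * \int[m2]_y (k' y)%:E)%E); last first.
    move=> x _; under eq_integral do rewrite EFinM.
    rewrite ge0_integralZl_EFin//; last exact/measurable_EFinP.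
    by move=> y _; rewrite lee_fin.
  apply: (@le_trans _ _ (\int[m1]_x ((l' x)%:E * D%:E))%E).
    apply: ge0_le_integral => //=.
    - by move=> x _; rewrite mule_ge0 ?lee_fin// integral_ge0// => y _; rewrite lee_fin.
    - by apply: emeasurable_funM => //; exact/measurable_EFinP.
    - by apply: emeasurable_funM => //; exact/measurable_EFinP.
    - by move=> x _; rewrite lee_wpmul2l ?lee_fin.
  rewrite ge0_integralZr//; last 3 first.
  - exact/measurable_EFinP.
  - by move=> x _; rewrite lee_fin.
  - by rewrite lee_fin ltW.
  by rewrite EFinM lee_wpmul2r// lee_fin ltW.
move=> [ml l0 C0 lr lc] [mk k0 D0 kr kc]; split.
- apply: measurable_funM.
  + apply: (measurable_fun_uncurry ml).
      exact: (measurableT_comp measurable_fst measurable_fst).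
    exact: (measurableT_comp measurable_fst measurable_snd).
  + apply: (measurable_fun_uncurry mk).
      exact: (measurableT_comp measurable_snd measurable_fst).
    exact: (measurableT_comp measurable_snd measurable_snd).
- by move=> z w; rewrite mulr_ge0.
- by rewrite mulr_gt0.
- move=> z; apply: row => //.
  + exact: (measurable_pair1 z.1 ml).
  + exact: (measurable_pair1 z.2 mk).
- move=> w; apply: (row (l ^~ w.1) (k ^~ w.2)) => //.
  + exact: (measurable_pair2 w.1 ml).
  + exact: (measurable_pair2 w.2 mk).
Qed.

(** Both orders are the iterated integrals of [f] against the tensor kernel, which is a Schur kernel
    by [schur_prod]; they agree wherever the double integral converges absolutely, that is almost
    everywhere. *)
Lemma op_comm (l : T1 -> T1 -> R) (k : T2 -> T2 -> R) C D f :
  schur m1 l C -> schur m2 k D -> sqint (m1 \x m2)%E f ->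
  {ae (m1 \x m2)%E, forall z, op1 l (op2 m2 k f) z = op2 m2 k (op1 l f) z}.
Proof.
move=> sl sk f2; have [mf _] := f2.
have ml := schur_measurable sl; have mk := schur_measurable sk.
apply: filterS (kop_integrable_ae (schur_prod sl sk) f2) => -[t x] i /=.
transitivity (\int[(m1 \x m2)%E]_w (l t w.1 * k x w.2 * f w)).
  rewrite Rintegral_prod1// /op1 /op2 /kop /= /Rintegral; congr fine.
  apply: ae_eq_integral => //.
  - apply/measurable_EFinP; apply: measurable_funM; first exact: (measurable_pair1 t ml).
    exact: (measurable_pair2 x (measurable_op2 m2 mk mf)).
  - exact: (measurable_int _ (integrable_Rintegral1 i)).
  apply: filterS (ae_integrable1 i) => s is_ _ /=; congr EFin.
  rewrite -/(Rintegral _ _ _) -[RHS]/(\int[m2]_y (l t s * k x y * f (s, y))).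
  under [RHS]eq_Rintegral do rewrite -mulrA.
  rewrite Rintegral_scale//; apply: measurable_funM; first exact: (measurable_pair1 x mk).
  exact: (measurable_pair1 s mf).
rewrite Rintegral_prod2// /op1 /op2 /kop /= /Rintegral; congr fine.
apply: ae_eq_integral => //.
- exact: (measurable_int _ (integrable_Rintegral1 (integrable_swap i))).
- apply/measurable_EFinP; apply: measurable_funM; first exact: (measurable_pair1 x mk).
  exact: (measurable_pair1 t (measurable_op1 ml mf)).
apply: filterS (ae_integrable2 i) => r ir _ /=; congr EFin.
rewrite -[LHS]/(\int[m1]_s (l t s * k x r * f (s, r))).
under eq_Rintegral do rewrite mulrAC mulrC.
rewrite Rintegral_scale//; apply: measurable_funM; first exact: (measurable_pair1 t ml).
exact: (measurable_pair2 r mf).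
Qed.

End ProductOperators1.

(** * Fractional kernels *)

Section AffineChange.
Context {R : realType}.

Let affine (c e : R) (x : measurableTypeR R) : measurableTypeR R := c * x + e.

Let measurable_affine c e : measurable_fun setT (affine c e).
Proof.
apply: measurable_funD; last exact: measurable_cst.
by apply: measurable_funM; [exact: measurable_cst|exact: measurable_id].
Qed.

Let push c e : {measure set (measurableTypeR R) -> \bar R} :=
  measure_function_pushforward__canonical__measure_function_Measure leb
    (measurable_affine c e).

(** Both sides are measures in [A] that agree on half-open intervals. *)
Lemma lebesgue_measure_affine (c e : R) (A : set R) : 0 < c -> measurable A ->
  leb A = (c%:E * leb [set x | A (c * x + e)%R])%E.
Proof.
move=> c0 mA; have c0' := ltW c0.
change (leb A = mscale (NngNum c0') (push c e) A).
apply: (lebesgue_measure_unique _ mA) => _ [[a b] _ <-]; rewrite /mscale /= /pushforward /=.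
rewrite -[RHS]/((c%:E * leb (affine c e @^-1` `]a, b]))%E).
have -> : affine c e @^-1` `]a, b] = `](a - e) / c, (b - e) / c]%classic.
  apply/seteqP; split => x /=; rewrite /affine !in_itv/= => /andP[h1 h2]; apply/andP; split.
  - by rewrite ltr_pdivrMr// ltrBlDr mulrC.
  - by rewrite ler_pdivlMr// lerBrDr mulrC.
  - by move: h1; rewrite ltr_pdivrMr// ltrBlDr mulrC.
  - by move: h2; rewrite ler_pdivlMr// lerBrDr mulrC.
rewrite !lebesgue_measure_itv/= !lte_fin ltr_pM2r ?invr_gt0// ltrD2r.
case: ifP => ab; last by rewrite mule0.
by rewrite -!EFinB -EFinM; congr EFin; field; rewrite gt_eqF.
Qed.

Lemma ge0_integral_affine (c e : R) (f : R -> \bar R) : 0 < c ->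
  measurable_fun setT f -> (forall x, (0 <= f x)%E) ->
  (\int[leb]_x f x = c%:E * \int[leb]_x f (c * x + e)%R)%E.
Proof.
move=> c0 mf f0; have c0' := ltW c0.
transitivity (\int[mscale (NngNum c0') (push c e)]_x f x)%E.
  apply: eq_measure_integral => A mA _.
  exact: (lebesgue_measure_affine e c0 mA).
rewrite ge0_integral_mscale//; congr (_ * _)%E.
by rewrite ge0_integral_pushforward//= preimage_setT.
Qed.

Lemma ge0_integral_reflect (f : R -> \bar R) :
  measurable_fun setT f -> (forall x, (0 <= f x)%E) ->
  (\int[leb]_x f x = \int[leb]_x f (- x)%R)%E.
Proof.
move=> mf f0.
pose P : {measure set (measurableTypeR R) -> \bar R} :=
  @measure_function_pushforward__canonical__measure_function_Measure _ _
    (measurableTypeR R) (measurableTypeR R) R leb -%R (oppr_measurable (R := R) (D := setT)).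
transitivity (\int[P]_x f x)%E.
  by apply: eq_measure_integral => A mA _; exact/esym/lebesgue_measureN.
by rewrite ge0_integral_pushforward//= preimage_setT.
Qed.

End AffineChange.

(** * Power integrals near 0 and at infinity *)

Section PowerIntegrals.
Context {R : realType}.
Implicit Types (p s x y e M : R).

Lemma integral_powR_itv p e M : p != 0 -> 0 < e -> e < M ->
  (\int[leb]_(t in `[e, M]) (t `^ (p - 1))%:E = ((M `^ p - e `^ p) / p)%:E)%E.
Proof.
move=> p0 e0 eM.
have der x : 0 < x -> is_derive x 1 (fun y => y `^ p / p) (x `^ (p - 1)).
  move=> x0; have h := is_derive1_powR p x0.
  have -> : x `^ (p - 1) = p^-1 *: (p * x `^ (p - 1)) by rewrite /GRing.scale /= mulKf.
  have -> : (fun y => y `^ p / p) = p^-1 \*: (fun y => y `^ p).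
    by apply/funext => y; rewrite /= /GRing.scale /= mulrC.
  exact: is_deriveZ.
have cF x : 0 < x -> {for x, continuous (fun y => y `^ p / p)}.
  move=> x0; apply: differentiable_continuous; apply/derivable1_diffP.
  by have [] := der x x0.
have cf x : 0 < x -> {for x, continuous (fun y => y `^ (p - 1))}.
  move=> x0; apply: differentiable_continuous; apply/derivable1_diffP.
  by have [] := is_derive1_powR (p - 1) x0.
rewrite (@continuous_FTC2 _ _ (fun y => y `^ p / p))//.
- by rewrite -EFinB mulrBl.
- apply: continuous_in_subspaceT => x /[!inE] /= /[!in_itv] /= /andP[ex _].
  exact/cf/(lt_le_trans e0).
- split.
  + move=> x /[!in_itv] /= /andP[ex _].
    by have [] := der x (lt_trans e0 ex).
  + by apply: cvg_at_right_filter; exact: cF.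
  + by apply: cvg_at_left_filter; apply: cF; exact: lt_trans eM.
- move=> x /[!in_itv] /= /andP[ex _].
  by rewrite derive1E; apply: derive_val; exact/der/(lt_trans e0).
Qed.

Lemma measurable_itv_powR (i : interval R) (r : R) :
  measurable_fun setT (fun t : R => if t \in i then t `^ r else 0).
Proof.
apply: measurable_fun_if => //=.
- apply: (measurable_fun_bool true); rewrite setTI.
  rewrite (_ : _ @^-1` _ = [set` i])//.
- apply: measurable_funTS; exact: measurable_powR.
Qed.

Lemma integral_if_itv (i : interval R) (f : R -> R) :
  (\int[leb]_t (if t \in i then f t else 0)%:E = \int[leb]_(t in [set` i]) (f t)%:E)%E.
Proof.
rewrite [RHS]integral_mkcond; apply: eq_integral => t _.
by rewrite patchE mem_setE; case: ifP.
Qed.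

(** The primitive is used away from the singularity: the truncations to [[1 / (n + 2), 1]] have
    integrals at most [1 / s], and Fatou passes to the limit. *)
Lemma integral_powR_head s : 0 < s ->
  (\int[leb]_t (if t \in `]0%R, 1%R[ then t `^ (s - 1) else 0)%:E <= (s^-1)%:E)%E.
Proof.
move=> s0.
apply: (@fatou_bound _ _ _ leb (fun n t => (if t \in `[n.+2%:R^-1, 1] then t `^ (s - 1) else 0)%:E)).
- by move=> n; apply/measurable_EFinP; exact: measurable_itv_powR.
- by apply/measurable_EFinP; exact: measurable_itv_powR.
- by move=> n x; rewrite lee_fin; case: ifP => // _; exact: powR_ge0.
(* The truncated intervals contain 1 and the limit interval does not. *)
- exists [set 1]; split; [exact: measurable_set1|exact: lebesgue_measure_set1|].
  move=> t /= nt; apply: contrapT => t1; apply: nt; apply: cvg_near_cst.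
  have t1' : t != 1 by apply/eqP.
  have [t0|t0] := leP t 0.
    apply: nearW => n; rewrite !in_itv /= (le_gtF t0) /=.
    case: ifP => // /andP[h _]; exfalso; move: h.
    by rewrite leNgt (le_lt_trans t0)// invr_gt0.
  near=> n; rewrite !in_itv /= t0 /= [t < 1]lt_neqAle t1' /=.
  suff -> : n.+2%:R^-1 <= t by [].
  apply: (@le_trans _ _ n.+1%:R^-1); first by rewrite lef_pV2 ?posrE// ler_nat.
  apply/ltW; near: n; exact: (near_infty_natSinv_lt (PosNum t0)).
- move=> n; rewrite integral_if_itv integral_powR_itv ?gt_eqF//; last first.
    by rewrite invf_lt1 ?ltr1n.
  rewrite lee_fin powR1 ler_pdivrMr// mulVf ?gt_eqF// gerBl ?powR_ge0//.
Unshelve. all: by end_near. Qed.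

Lemma integral_powR_tail s : 1 < s ->
  (\int[leb]_t (if (1%R <= t)%R then t `^ (- s) else 0)%:E <= ((s - 1)^-1)%:E)%E.
Proof.
move=> s1.
apply: (@fatou_bound _ _ _ leb (fun n t => (if t \in `[1, n.+2%:R] then t `^ (- s) else 0)%:E)).
- by move=> n; apply/measurable_EFinP; exact: measurable_itv_powR.
- have := measurable_itv_powR `[1, +oo[ (- s) => h; apply/measurable_EFinP.
  by apply: eq_measurable_fun h => t _; rewrite in_itv /= andbT.
- by move=> n x; rewrite lee_fin; case: ifP => // _; exact: powR_ge0.
- apply: aeW => t; apply: cvg_near_cst.
  near=> n; rewrite in_itv /=.
  suff -> : t <= n.+2%:R by rewrite andbT.
  apply: (@le_trans _ _ n%:R); last by rewrite ler_nat leqW.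
  near: n; exact: nbhs_infty_ger.
- move=> n; rewrite integral_if_itv.
  have s1' : s - 1 != 0 by rewrite subr_eq0 gt_eqF.
  have := @integral_powR_itv (1 - s) 1 n.+2%:R.
  rewrite addrAC subrr add0r => ->//; last 2 first.
  + by rewrite subr_eq0 lt_eqF.
  + by rewrite ltr1n.
  rewrite lee_fin powR1 -[X in _ / X]opprB invrN mulrN -mulNr opprB.
  rewrite ler_pdivrMr ?subr_gt0// mulVf// gerBl ?powR_ge0//.
Unshelve. all: by end_near. Qed.

End PowerIntegrals.

(** * The fractional kernel and the beta integral *)

Section FractionalKernel.
Context {R : realType}.
Implicit Types (a b s x t r : R).

(** The kernel of [Gamma s] times the left integral of order [s], cut to the triangle
    [a < t < x < b]. Its transpose is the kernel of the right integral. *)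
Definition fker a b s x t : R :=
  if (a < t) && (t < x) && (x < b) then (x - t) `^ (s - 1) else 0.

Lemma fker_ge0 a b s x t : 0 <= fker a b s x t.
Proof. by rewrite /fker; case: ifP => // _; exact: powR_ge0. Qed.

Lemma measurable_fker a b s :
  measurable_fun setT (fun z : R * R => fker a b s z.1 z.2).
Proof.
apply: measurable_fun_ifT => //.
- apply: measurable_and; first apply: measurable_and.
  + by apply: measurable_fun_ltr; [exact: measurable_cst|exact: measurable_snd].
  + by apply: measurable_fun_ltr; [exact: measurable_snd|exact: measurable_fst].
  + by apply: measurable_fun_ltr; [exact: measurable_fst|exact: measurable_cst].
- apply: (measurableT_comp (measurable_powR _)).
  by apply: measurable_funB; [exact: measurable_fst|exact: measurable_snd].
Qed.

Lemma powRM_lt0 (x y p : R) : 0 < x -> 0 < y -> (x * y) `^ p = x `^ p * y `^ p.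
Proof. by move=> x0 y0; rewrite powRM// ltW. Qed.

(** Substituting [u = (x - t) / (b - a)], in [t] for rows and in [x] for columns, reduces both to
    [integral_powR_head]. Rows are reflected first because [ge0_integral_affine] preserves
    orientation. *)
Lemma schur_fker a b s : a < b -> 0 < s -> schur leb (fker a b s) ((b - a) `^ s / s).
Proof.
move=> ab s0; have L0 : 0 < b - a by rewrite subr_gt0.
pose hd t : R := if t \in `]0%R, 1%R[ then t `^ (s - 1) else 0.
have mhd : measurable_fun setT (fun t => (hd t)%:E).
  by apply/measurable_EFinP; exact: measurable_itv_powR.
have hd0 t : 0 <= hd t by rewrite /hd; case: ifP => // _; exact: powR_ge0.
have mk := measurable_fker a b s.
have E : (b - a) `^ s / s = (b - a) * ((b - a) `^ (s - 1) * s^-1).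
  rewrite mulrA -{2}[b - a]powRr1 ?ltW// -powRD; last by rewrite (gt_eqF L0) implybT.
  by rewrite [1 + _]addrC subrK.
have bound (f : R -> R) : measurable_fun setT f -> (forall u, 0 <= f u) ->
    (forall u, f u <= (b - a) `^ (s - 1) * hd u) ->
    ((b - a)%:E * \int[leb]_u (f u)%:E <= ((b - a) `^ s / s)%:E)%E.
  move=> mf f0 fh; rewrite E EFinM lee_wpmul2l//; first by rewrite lee_fin ltW.
  apply: (@le_trans _ _ (\int[leb]_u ((b - a) `^ (s - 1) * hd u)%:E)%E).
    apply: ge0_le_integral => //=.
    - by move=> u _; rewrite lee_fin.
    - exact/measurable_EFinP.
    - by apply/measurable_EFinP; apply: measurable_funM; [exact: measurable_cst|apply/measurable_EFinP].
    - by move=> u _; rewrite lee_fin.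
  under eq_integral do rewrite EFinM.
  rewrite ge0_integralZl_EFin//; last 2 first.
    by move=> u _; rewrite lee_fin.
    exact: powR_ge0.
  rewrite EFinM lee_wpmul2l ?lee_fin ?powR_ge0//.
  exact: integral_powR_head.
split => //.
- by move=> x t; exact: fker_ge0.
- by rewrite divr_gt0// powR_gt0.
- move=> x.
  rewrite ge0_integral_reflect; last 2 first.
    by apply/measurable_EFinP; exact: (measurable_pair1 x mk).
    by move=> t; rewrite lee_fin fker_ge0.
  have mkx : measurable_fun setT (fun t => fker a b s x (- t)).
    by apply: (measurableT_comp (measurable_pair1 x mk)); exact: oppr_measurable.
  rewrite (@ge0_integral_affine _ (b - a) (- x)) ?subr_gt0//; last 2 first.
    exact/measurable_EFinP.
    by move=> t; rewrite lee_fin fker_ge0.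
  apply: bound.
  + apply: (measurableT_comp mkx); apply: measurable_funD; last exact: measurable_cst.
    by apply: measurable_funM; [exact: measurable_cst|exact: measurable_id].
  + by move=> u; exact: fker_ge0.
  + move=> u; rewrite /fker; case: ifPn => [/andP[/andP[h1 h2] h3]|_]; last first.
      by rewrite mulr_ge0 ?powR_ge0.
    have u0 : 0 < u by rewrite -(pmulr_rgt0 _ L0); lra.
    have u1 : u < 1 by rewrite -(ltr_pM2l L0); lra.
    rewrite /hd in_itv /= u0 u1 -powRM_lt0//.
    by rewrite opprK addrCA addrC subrr add0r.
- move=> t; have mkt : measurable_fun setT (fun x => fker a b s x t).
    exact: (measurable_pair2 t mk).
  rewrite (@ge0_integral_affine _ (b - a) t) ?subr_gt0//; last 2 first.
    exact/measurable_EFinP.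
    by move=> x; rewrite lee_fin fker_ge0.
  apply: bound.
  + apply: (measurableT_comp mkt); apply: measurable_funD; last exact: measurable_cst.
    by apply: measurable_funM; [exact: measurable_cst|exact: measurable_id].
  + by move=> u; exact: fker_ge0.
  + move=> u; rewrite /fker; case: ifPn => [/andP[/andP[h1 h2] h3]|_]; last first.
      by rewrite mulr_ge0 ?powR_ge0.
    have u0 : 0 < u by rewrite -(pmulr_rgt0 _ L0); lra.
    have u1 : u < 1 by rewrite -(ltr_pM2l L0); lra.
    by rewrite /hd in_itv /= u0 u1 -powRM_lt0// addrK.
Qed.

(** The integrand of Euler's beta function at [(s, 1 - s)]. *)
Definition beta_integrand s (u : R) : R :=
  if (0 < u) && (u < 1) then (1 - u) `^ (- s) * u `^ (s - 1) else 0.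

Lemma beta_integrand_ge0 s u : 0 <= beta_integrand s u.
Proof. by rewrite /beta_integrand; case: ifP => // _; rewrite mulr_ge0 ?powR_ge0. Qed.

Lemma measurable_beta_integrand s : measurable_fun setT (beta_integrand s).
Proof.
apply: measurable_fun_ifT => //.
- by apply: measurable_and; apply: measurable_fun_ltr.
- apply: measurable_funM; apply: (measurableT_comp (measurable_powR _)) => //.
  by apply: measurable_funB.
Qed.

Lemma powR_le1 (x p : R) : 0 < x -> x <= 1 -> 0 <= p -> x `^ p <= 1.
Proof.
move=> x0 x1 p0; have := @ge0_ler_powR _ _ p0 x 1.
by rewrite powR1 !nnegrE (ltW x0) ler01; exact.
Qed.

Lemma powRN_ge1 (x p : R) : 0 < x -> x <= 1 -> 0 <= p -> 1 <= x `^ (- p).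
Proof.
by move=> x0 x1 p0; rewrite powRN invf_ge1 ?powR_gt0// powR_le1.
Qed.

Lemma powRN_le2 (x p : R) : 2^-1 <= x -> x <= 1 -> 0 <= p -> p <= 1 -> x `^ (- p) <= 2.
Proof.
move=> x2 x1 p0 p1; have x0 : 0 < x by apply: lt_le_trans x2; rewrite invr_gt0.
rewrite powRN -[leRHS]invrK lef_pV2 ?posrE ?powR_gt0 ?invr_gt0//.
apply: (le_trans x2); rewrite -[leLHS]powRr1; last exact: ltW.
have -> : x `^ 1 = x `^ p * x `^ (1 - p).
  by rewrite -powRD ?(gt_eqF x0) ?implybT// addrC subrK.
by rewrite ler_piMr ?powR_ge0// powR_le1// subr_ge0.
Qed.

Definition beta_const s : R := fine (\int[leb]_u (beta_integrand s u)%:E)%E.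

(** Each half of []0, 1[] has one singular factor, and the other factor is at most 2 there: two
    power integrals, one of them reflected, dominate. *)
Lemma beta_integral s : 0 < s < 1 ->
  (\int[leb]_u (beta_integrand s u)%:E = (beta_const s)%:E)%E.
Proof.
move=> /andP[s0 s1]; rewrite /beta_const fineK//.
pose hd p t : R := if t \in `]0%R, 1%R[ then t `^ (p - 1) else 0.
have mhd p : measurable_fun setT (hd p) by exact: measurable_itv_powR.
have hd0 p t : 0 <= hd p t by rewrite /hd; case: ifP => // _; exact: powR_ge0.
have s1' : 0 < 1 - s by rewrite subr_gt0.
rewrite ge0_fin_numE; last by apply: integral_ge0 => u _; rewrite lee_fin beta_integrand_ge0.
apply: (@le_lt_trans _ _ (2 * (s^-1 + (1 - s)^-1))%:E); last exact: ltry.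
have pt (u : R) : beta_integrand s u <= 2 * (hd s u + hd (1 - s) (1 - u)).
  rewrite /beta_integrand.
  case: ifPn => [/andP[u0 u1]|_]; last by rewrite mulr_ge0// addr_ge0.
  rewrite /hd !in_itv /= u0 u1 /= subr_gt0 u1 gtrBl u0 /=.
  have -> : 1 - s - 1 = - s by ring.
  have p1 := powR_ge0 u (s - 1); have p2 := powR_ge0 (1 - u) (- s).
  have [u2|u2] := leP u 2^-1.
    have : (1 - u) `^ (- s) <= 2 by apply: powRN_le2; lra.
    nra.
  have : u `^ (s - 1) <= 2 by rewrite -[s - 1]opprB; apply: powRN_le2; lra.
  nra.
have mr : measurable_fun setT (fun u : R => hd (1 - s) (1 - u)).
  by apply: (measurableT_comp (mhd (1 - s))); exact: measurable_funB.
have mrE : measurable_fun setT (fun u : R => (hd (1 - s) (1 - u))%:E).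
  exact/measurable_EFinP.
have mhdE p : measurable_fun setT (fun u : R => (hd p u)%:E).
  exact/measurable_EFinP.
apply: (@le_trans _ _ (\int[leb]_u (2%:E * ((hd s u)%:E + (hd (1 - s) (1 - u))%:E)))%E).
  apply: ge0_le_integral => //=.
  - by move=> u _; rewrite lee_fin beta_integrand_ge0.
  - by apply/measurable_EFinP; exact: measurable_beta_integrand.
  - apply: emeasurable_funM => //; apply: emeasurable_funD.
      exact: mhdE.
    exact: mrE.
  - by move=> u _; rewrite -EFinD -EFinM lee_fin.
rewrite ge0_integralZl_EFin//; last 2 first.
  by move=> u _; rewrite adde_ge0 ?lee_fin.
  apply: emeasurable_funD; first exact: mhdE.
  exact: mrE.
rewrite EFinM lee_wpmul2l//.
have -> : (\int[leb]_u ((hd s u)%:E + (hd (1 - s) (1 - u))%:E) =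
    \int[leb]_u (hd s u)%:E + \int[leb]_u (hd (1 - s) (1 - u))%:E)%E.
  apply: ge0_integralD => //.
  - by move=> u _; rewrite lee_fin.
  - exact: mhdE.
  - by move=> u _; rewrite lee_fin.
rewrite EFinD leeD ?integral_powR_head//.
have -> : (\int[leb]_u (hd (1 - s) (1 - u))%:E = \int[leb]_u (hd (1 - s) u)%:E)%E.
  have nn u : (0 <= (hd (1 - s) u)%:E)%E by rewrite lee_fin.
  have r1 := @ge0_integral_reflect R (fun u => (hd (1 - s) u)%:E) (mhdE (1 - s)) nn.
  have mN : measurable_fun setT (fun u : R => (hd (1 - s) (- u))%:E).
    exact: (measurableT_comp (mhdE _) (oppr_measurable (R := R) (D := setT))).
  have r2 := @ge0_integral_affine R 1 (- 1) (fun u => (hd (1 - s) (- u))%:E) ltr01 mN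
    (fun u => nn (- u)).
  apply/esym; apply: (etrans r1); apply: (etrans r2).
  by rewrite mul1e; apply: eq_integral => u _; rewrite mul1r opprB.
exact: integral_powR_head.
Qed.

Lemma beta_const_gt0 s : 0 < s < 1 -> 0 < beta_const s.
Proof.
move=> s01; rewrite -lte_fin -beta_integral//; have /andP[s0 s1] := s01.
apply: (@lt_le_trans _ _ (\int[leb]_u (\1_(`]0%R, 1%R[ : set R) u)%:E)%E).
  by rewrite integral_indic//= setIT lebesgue_measure_itv/= lte_fin ltr01 oppr0 adde0 lte_fin.
apply: ge0_le_integral => //=.
- by apply/measurable_EFinP; exact: measurable_indic.
- by apply/measurable_EFinP; exact: measurable_beta_integrand.
- move=> u _; rewrite lee_fin indicE mem_setE in_itv /= /beta_integrand.
  case: ifP => [/andP[u0 u1]|//] /=.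
  rewrite -[leLHS]mulr1; apply: ler_pM => //.
  + by apply: powRN_ge1; lra.
  + by rewrite -opprB; apply: powRN_ge1; lra.
Qed.

(** After [t = r + (x - r) u] the powers of [x - r] cancel, Jacobian included, and the beta integral
    remains. This is [I^(1 - s) I^s = I^1] on kernels, up to the Gamma factors. *)
Lemma fker_comp a b s x r : 0 < s < 1 ->
  (\int[leb]_t (fker a b (1 - s) x t * fker a b s t r)%:E =
   (if (a < r) && (r < x) && (x < b) then beta_const s else 0)%:E)%E.
Proof.
move=> s01; have /andP[s0 s1] := s01.
have mk1 : measurable_fun setT (fker a b (1 - s) x).
  exact: (measurable_pair1 x (measurable_fker a b (1 - s))).
have mk2 : measurable_fun setT (fker a b s ^~ r).
  exact: (measurable_pair2 r (measurable_fker a b s)).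
case: ifPn => [/andP[/andP[ar rx] xb]|h]; last first.
  rewrite (eq_integral (cst 0%E)) ?integral0// => t _; rewrite /fker.
  case: ifPn => [/andP[/andP[at_ tx] xb]|_]; last by rewrite mul0r.
  case: ifPn => [/andP[/andP[ar rt] tb]|_]; last by rewrite mulr0.
  by move: h; rewrite ar xb (lt_trans rt tx).
have L0 : 0 < x - r by rewrite subr_gt0.
have maff : measurable_fun setT (fun u : R => (x - r) * u + r).
  apply: measurable_funD; last exact: measurable_cst.
  by apply: measurable_funM; [exact: measurable_cst|exact: measurable_id].
have pt (u : R) : (x - r) * (fker a b (1 - s) x ((x - r) * u + r) *
    fker a b s ((x - r) * u + r) r) = beta_integrand s u.
  rewrite /fker /beta_integrand.
  have -> : ((x - r) * u + r < x) = (u < 1).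
    by rewrite -ltrBrDr -[X in _ < X]mulr1 ltr_pM2l.
  have -> : (r < (x - r) * u + r) = (0 < u).
    by rewrite ltrDr pmulr_rgt0.
  case: (ltP 0 u) => u0; last by rewrite !andbF /= !mulr0.
  case: (ltP u 1) => u1; last by rewrite !andbF /= !mul0r mulr0.
  have h1 : a < (x - r) * u + r.
    by apply: (lt_trans ar); rewrite ltrDr mulr_gt0.
  have h2 : (x - r) * u + r < b.
    by apply: lt_trans xb; rewrite -ltrBrDr -[X in _ < X]mulr1 ltr_pM2l.
  rewrite h1 h2 ar xb /= addrK.
  have -> : x - ((x - r) * u + r) = (x - r) * (1 - u) by ring.
  rewrite !powRM_lt0 ?subr_gt0//.
  have -> : 1 - s - 1 = - s by ring.
  have E : (x - r) * ((x - r) `^ (- s) * (x - r) `^ (s - 1)) = 1.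
    rewrite -{1}[x - r]powRr1 ?ltW// -!powRD ?(gt_eqF L0) ?implybT//.
    have -> : 1 + (- s + (s - 1)) = 0 by ring.
    by rewrite powRr0.
  transitivity ((x - r) * ((x - r) `^ (- s) * (x - r) `^ (s - 1)) *
    ((1 - u) `^ (- s) * u `^ (s - 1))); first by ring.
  by rewrite E mul1r.
rewrite (@ge0_integral_affine _ (x - r) r)//; last 2 first.
- by apply/measurable_EFinP; exact: measurable_funM.
- by move=> t; rewrite lee_fin mulr_ge0 ?fker_ge0.
rewrite -beta_integral// -ge0_integralZl_EFin ?ltW//; last 2 first.
- by move=> u _; rewrite lee_fin mulr_ge0 ?fker_ge0.
- apply/measurable_EFinP; apply: measurable_funM.
  + exact: (measurableT_comp mk1 maff).
  + exact: (measurableT_comp mk2 maff).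
by apply: eq_integral => u _; rewrite -EFinM pt.
Qed.

End FractionalKernel.

(** * Positivity of fractional integrals *)

Section GramPositivity.
Context d d' (T : measurableType d) (U : measurableType d') (R : realType).
Context (m : {sigma_finite_measure set T -> \bar R})
        (n : {sigma_finite_measure set U -> \bar R}).

(* A kernel that is almost everywhere the Gram kernel
   [k x s = \int G x r * G s r dr] is positive semidefinite. *)
Lemma gram_ge0 (k : T -> T -> R) (G : T -> U -> R) (f : T -> R) :
  measurable_fun setT (fun z : T * U => G z.1 z.2) ->
  measurable_fun setT f -> (forall x r, 0 <= G x r) ->
  {ae (m \x m)%E, forall z,
    (\int[n]_r (G z.1 r * G z.2 r)%:E = (k z.1 z.2)%:E)%E} ->
  (m \x m)%E.-integrable setT (EFin \o (fun z => k z.1 z.2 * f z.2 * f z.1)) ->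
  0 <= \int[(m \x m)%E]_z (k z.1 z.2 * f z.2 * f z.1).
Proof.
move=> mG mf G0 GG ik.
pose M := prod_measure m m.
(* With the Gram formula inserted, the double integral is the integral over [r] of the square of
   [int G x r f x]. Absolute convergence comes from [ik], as [k] and [G] are nonnegative. *)
pose Phi (w : (T * T) * U) := G w.1.1 w.2 * f w.1.1 * (G w.1.2 w.2 * f w.1.2).
have m1 : measurable_fun setT (fun w : (T * T) * U => G w.1.1 w.2 * f w.1.1).
  apply: measurable_funM.
    apply: (measurable_fun_uncurry mG); last exact: measurable_snd.
    exact: (measurableT_comp measurable_fst measurable_fst).
  by apply: (measurableT_comp mf); exact: (measurableT_comp measurable_fst measurable_fst).
have m2 : measurable_fun setT (fun w : (T * T) * U => G w.1.2 w.2 * f w.1.2).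
  apply: measurable_funM.
    apply: (measurable_fun_uncurry mG); last exact: measurable_snd.
    exact: (measurableT_comp measurable_snd measurable_fst).
  by apply: (measurableT_comp mf); exact: (measurableT_comp measurable_snd measurable_fst).
have mPhi : measurable_fun setT Phi by exact: measurable_funM.
have mGz (z : T * T) : measurable_fun setT (fun r => (G z.1 r * G z.2 r)%:E).
  apply/measurable_EFinP; apply: measurable_funM; exact: (measurable_pair1 _ mG).
have iPhi : (M \x n)%E.-integrable setT (EFin \o Phi).
  apply/integrable12ltyP; first exact/measurable_EFinP.
  have /integrableP[mk ki] := ik; apply: le_lt_trans ki.
  rewrite le_eqVlt; apply/orP; left; apply/eqP.
  apply: ae_eq_integral => //.
  - apply: (measurable_fun_fubini_tonelli_F (fun w => `|(Phi w)%:E|%E)) => //.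
    by apply: measurableT_comp => //; exact/measurable_EFinP.
  - by apply: measurableT_comp.
  apply: filterS GG => -[x s] /= kE _.
  have k0 : 0 <= k x s.
    by rewrite -lee_fin -kE; apply: integral_ge0 => r _; rewrite lee_fin mulr_ge0.
  rewrite -mulrA normrM (ger0_norm k0) EFinM -kE.
  rewrite muleC -ge0_integralZl_EFin//; last 2 first.
    by move=> r _; rewrite lee_fin mulr_ge0.
    exact: (mGz (x, s)).
  apply: eq_integral => r _; rewrite -EFinM /Phi /= mulrACA normrM mulrC.
  by rewrite [`|G x r * _|]ger0_norm ?mulr_ge0// [f s * _]mulrC.
have kE : \int[(m \x m)%E]_z (k z.1 z.2 * f z.2 * f z.1) = \int[M]_z \int[n]_r Phi (z, r).
  rewrite /Rintegral; congr fine; apply: ae_eq_integral => //.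
  - exact: (measurable_int _ ik).
  - exact: (measurable_int _ (integrable_Rintegral1 iPhi)).
  apply: filterS2 GG (ae_integrable1 iPhi) => -[x s] /= kE ir _; congr EFin.
  rewrite -/(Rintegral _ _ _).
  have -> : k x s = \int[n]_r (G x r * G s r) by rewrite /Rintegral kE.
  rewrite -mulrA mulrC -Rintegral_scale.
  - by apply: eq_Rintegral => r _; rewrite /Phi /=; ring.
  - apply/measurable_EFinP; exact: (mGz (x, s)).
rewrite kE -Rintegral_prod1// Rintegral_prod2//.
have sec : {ae n, forall r, 0 <= \int[M]_z Phi (z, r)}.
  apply: filterS (ae_integrable2 iPhi) => r ir.
  pose a x := G x r * f x.
  have ma : measurable_fun setT a.
    by apply: measurable_funM => //; exact: (measurable_pair2 r mG).
  have ia : (m \x m)%E.-integrable setT (EFin \o (fun z : T * T => a z.1 * a z.2)).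
    exact: ir.
  rewrite -[X in _ <= X]/(\int[(m \x m)%E]_z (a z.1 * a z.2)) Rintegral_prod1//=.
  (* The tensor square of [a] is integrable. Either some nonzero [a x] has an integrable section, so
     that [a] is integrable, or [a x = 0] for almost every [x]. *)
  have [[x [a0 ix]]|na] := pselect (exists x, a x != 0 /\
      m.-integrable setT (EFin \o (fun s => a x * a s))).
    have ima : m.-integrable setT (EFin \o a).
      have := integrableZl measurableT (a x)^-1 ix; apply: eq_integrable => // s _.
      by rewrite /= -EFinM mulKf.
    under eq_Rintegral do rewrite RintegralZl//.
    by rewrite RintegralZr// -expr2 sqr_ge0.
  rewrite /Rintegral (ae_eq_integral (cst 0%E)) ?integral0//.
    exact: (measurable_int _ (integrable_Rintegral1 ia)).
  apply: filterS (ae_integrable1 ia) => x ix _ /=; congr EFin.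
  have ax : a x = 0 by apply/eqP/negPn/negP => a0; apply: na; exists x.
  by under eq_integral do rewrite ax mul0r; rewrite integral0.
(* The inner integral is nonnegative for almost every [r]; with the absolute value it is so for
   every [r]. *)
rewrite /Rintegral (ae_eq_integral (fun r => (`|fine (\int[M]_z (Phi (z, r))%:E)|)%:E)%E)//.
- by apply: fine_ge0; apply: integral_ge0 => r _; rewrite lee_fin.
- exact: (measurable_int _ (integrable_Rintegral1 (integrable_swap iPhi))).
- apply/measurable_EFinP; apply: measurableT_comp => //; apply/measurable_EFinP.
  exact: (measurable_int _ (integrable_Rintegral1 (integrable_swap iPhi))).
- by apply: filterS sec => r h _; rewrite ger0_norm.
Qed.

End GramPositivity.

Section GammaPositive.
Context {R : realType}.

(** Finiteness is part of the claim: [Gamma] is the real part of an integral, and an infinite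
    integral would count as 0. *)
Lemma Gamma_gt0 (s : R) : 0 < s < 1 -> 0 < Gamma s.
Proof.
move=> /andP[s0 s1].
pose g (x : R) := if 0 < x then x `^ (s - 1) * expR (- x) else 0.
have mg : measurable_fun setT g.
  apply: measurable_fun_ifT => //; first exact: measurable_fun_ltr.
  apply: measurable_funM; first exact: measurable_powR.
  by apply: measurableT_comp; [exact: measurable_expR|exact: oppr_measurable].
have g0 x : 0 <= g x by rewrite /g; case: ifP => // _; rewrite mulr_ge0 ?powR_ge0 ?expR_ge0.
have GE : Gamma s = fine (\int[leb]_x (g x)%:E)%E.
  rewrite /Gamma Rintegral_mkcond /Rintegral; congr fine; apply: eq_integral => x _.
  by rewrite patchE mem_setE in_itv /= andbT /g; case: ifP.
pose hd (t : R) : R := if t \in `]0%R, 1%R[ then t `^ (s - 1) else 0.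
pose tl (t : R) : R := if 1 <= t then t `^ (- 2) else 0.
have mhd : measurable_fun setT (fun t => (hd t)%:E).
  by apply/measurable_EFinP; exact: measurable_itv_powR.
have mtl : measurable_fun setT (fun t => (tl t)%:E).
  apply/measurable_EFinP; apply: measurable_fun_ifT => //; exact: measurable_fun_ler.
have hd0 t : 0 <= hd t by rewrite /hd; case: ifP => // _; exact: powR_ge0.
have tl0 t : 0 <= tl t by rewrite /tl; case: ifP => // _; exact: powR_ge0.
(* The 4 comes from squaring [1 + x / 2 <= expR (x / 2)], which gives [expR (- x) <= 4 / x^2]. *)
have gle x : g x <= hd x + 4 * tl x.
  rewrite /g; case: ifPn => x0; last by rewrite addr_ge0// mulr_ge0.
  rewrite /hd /tl in_itv /= x0 /=; case: (ltP x 1) => x1.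
    rewrite mulr0 addr0 ler_piMr ?powR_ge0//.
    by rewrite -expR0 ler_expR oppr_le0 ltW.
  rewrite add0r -[leRHS]mulr1 mulrC; apply: ler_pM; rewrite ?expR_ge0 ?powR_ge0//.
    have h : 1 + x / 2 <= expR (x / 2) by exact: expR_ge1Dx.
    have -> : expR (- x) = (expR (x / 2) ^+ 2)^-1.
      by rewrite -expRM_natl expRN mulr_natl -[x / 2 *+ 2]mulr_natr divfK.
    rewrite powRN powR_mulrn; last exact: ltW.
    rewrite -[4]invrK -invfM lef_pV2 ?posrE; last 2 first.
    - by rewrite exprn_gt0 ?expR_gt0.
    - by rewrite mulr_gt0 ?invr_gt0// exprn_gt0.
    apply: (@le_trans _ _ ((x / 2) ^+ 2)); first by rewrite exprMn; lra.
    by rewrite lerXn2r ?nnegrE ?expR_ge0 ?divr_ge0 ?ltW//; lra.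
  rewrite -opprB powRN invf_le1 ?powR_gt0//.
  have := @ge0_ler_powR _ (1 - s) _ 1 x; rewrite powR1; apply; rewrite ?nnegrE//; lra.
have fin : (\int[leb]_x (g x)%:E < +oo)%E.
  apply: (@le_lt_trans _ _ (\int[leb]_x ((hd x)%:E + 4%:E * (tl x)%:E))%E).
    apply: ge0_le_integral => //=.
    - by move=> x _; rewrite lee_fin.
    - exact/measurable_EFinP.
    - by apply: emeasurable_funD => //; exact: emeasurable_funM.
    - by move=> x _; rewrite -EFinM -EFinD lee_fin.
  rewrite ge0_integralD//; last 3 first.
  - by move=> x _; rewrite lee_fin.
  - by move=> x _; rewrite -EFinM lee_fin mulr_ge0.
  - exact: emeasurable_funM.
  rewrite ge0_integralZl_EFin//; last by move=> x _; rewrite lee_fin.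
  apply: (@le_lt_trans _ _ ((s^-1)%:E + 4%:E * ((2 - 1)^-1)%:E)%E); last exact: ltry.
  by rewrite leeD ?integral_powR_head// lee_wpmul2l// integral_powR_tail// ltr1n.
have lb : ((expR (- 1))%:E <= \int[leb]_x (g x)%:E)%E.
  apply: (@le_trans _ _ (\int[leb]_x ((expR (- 1))%:E * (\1_(`]0%R, 1%R[ : set R) x)%:E))%E).
    rewrite ge0_integralZl_EFin ?expR_ge0//; last first.
      by apply/measurable_EFinP; exact: measurable_indic.
    rewrite integral_indic//= setIT lebesgue_measure_itv/= lte_fin ltr01 oppr0 adde0.
    by rewrite mule1.
  apply: ge0_le_integral => //=.
  - by apply: emeasurable_funM => //; apply/measurable_EFinP; exact: measurable_indic.
  - exact/measurable_EFinP.
  - move=> u _; rewrite -EFinM lee_fin indicE mem_setE in_itv /= /g.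
    case: (boolP (0 < u < 1)) => [/andP[u0 u1]|_] /=; last first.
      by rewrite mulr0; case: ifP => // _; rewrite mulr_ge0 ?powR_ge0 ?expR_ge0.
    rewrite u0 mulr1 -[leLHS]mul1r; apply: ler_pM; rewrite ?expR_ge0//.
      by rewrite -opprB; apply: powRN_ge1; lra.
    by rewrite ler_expR lerN2 ltW.
rewrite GE -lte_fin fineK ?ge0_fin_numE//; last by apply: integral_ge0 => x _; rewrite lee_fin.
by apply: lt_le_trans lb; rewrite lte_fin expR_gt0.
Qed.

End GammaPositive.

(** * The Gram factorisation of the fractional kernel *)

Section FractionalPositivity.
Context {R : realType}.
Implicit Types (a b s x t r p u : R).

(** [t] is confined to the interval, as in [fker], but [r] runs over the whole half-line below [t],
    so that the Gram integral is homogeneous in [x - t]. *)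
Definition gram_kernel a b p t r : R :=
  if (a < t) && (t < b) && (r < t) then (t - r) `^ (- p) else 0.

Definition gram_integrand p u : R :=
  if 0 < u then (1 + u) `^ (- p) * u `^ (- p) else 0.

Lemma gram_kernel_ge0 a b p t r : 0 <= gram_kernel a b p t r.
Proof. by rewrite /gram_kernel; case: ifP => // _; exact: powR_ge0. Qed.

Lemma measurable_gram_kernel a b p :
  measurable_fun setT (fun z : R * R => gram_kernel a b p z.1 z.2).
Proof.
apply: measurable_fun_ifT => //.
- apply: measurable_and; first apply: measurable_and.
  + by apply: measurable_fun_ltr; [exact: measurable_cst|exact: measurable_fst].
  + by apply: measurable_fun_ltr; [exact: measurable_fst|exact: measurable_cst].
  + by apply: measurable_fun_ltr; [exact: measurable_snd|exact: measurable_fst].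
- apply: (measurableT_comp (measurable_powR _)).
  by apply: measurable_funB; [exact: measurable_fst|exact: measurable_snd].
Qed.

Lemma gram_integrand_ge0 p u : 0 <= gram_integrand p u.
Proof. by rewrite /gram_integrand; case: ifP => // _; rewrite mulr_ge0 ?powR_ge0. Qed.

Lemma measurable_gram_integrand p : measurable_fun setT (gram_integrand p).
Proof.
apply: measurable_fun_ifT => //; first exact: measurable_fun_ltr.
apply: measurable_funM; last exact: measurable_powR.
by apply: (measurableT_comp (measurable_powR _)); exact: measurable_funD.
Qed.

(** [u^(- p)] is integrable at 0 because [p < 1], and [u^(- 2 p)] at infinity because
    [p > 1 / 2]. *)
Lemma gram_integrand_fin p : 2^-1 < p < 1 ->
  (\int[leb]_u (gram_integrand p u)%:E)%E \is a fin_num.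
Proof.
move=> /andP[p2 p1]; rewrite ge0_fin_numE; last first.
  by apply: integral_ge0 => u _; rewrite lee_fin gram_integrand_ge0.
pose hd (t : R) : R := if t \in `]0%R, 1%R[ then t `^ (1 - p - 1) else 0.
pose tl (t : R) : R := if 1 <= t then t `^ (- (2 * p)) else 0.
have mhd : measurable_fun setT (fun t => (hd t)%:E).
  by apply/measurable_EFinP; exact: measurable_itv_powR.
have mtl : measurable_fun setT (fun t => (tl t)%:E).
  apply/measurable_EFinP; apply: measurable_fun_ifT => //; exact: measurable_fun_ler.
have hd0 t : 0 <= hd t by rewrite /hd; case: ifP => // _; exact: powR_ge0.
have tl0 t : 0 <= tl t by rewrite /tl; case: ifP => // _; exact: powR_ge0.
have anti (y z : R) : 0 < y -> y <= z -> z `^ (- p) <= y `^ (- p).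
  move=> y0 yz; have z0 := lt_le_trans y0 yz.
  rewrite !powRN lef_pV2 ?posrE ?powR_gt0//.
  by apply: ge0_ler_powR => //; rewrite ?nnegrE; lra.
have gle u : gram_integrand p u <= hd u + tl u.
  rewrite /gram_integrand; case: ifPn => u0; last by rewrite addr_ge0.
  rewrite /hd /tl in_itv /= u0 /=; case: (ltP u 1) => u1.
    have -> : 1 - p - 1 = - p by ring.
    rewrite addr0 ler_piMl ?powR_ge0//.
    by have := anti 1 (1 + u) ltr01; rewrite powR1; apply; lra.
  rewrite add0r; have -> : - (2 * p) = - p + - p by ring.
  rewrite powRD; last by rewrite (gt_eqF u0) implybT.
  by rewrite ler_wpM2r ?powR_ge0// anti//; lra.
apply: (@le_lt_trans _ _ (\int[leb]_u ((hd u)%:E + (tl u)%:E))%E).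
  apply: ge0_le_integral => //=.
  - by move=> u _; rewrite lee_fin gram_integrand_ge0.
  - by apply/measurable_EFinP; exact: measurable_gram_integrand.
  - exact: emeasurable_funD.
  - by move=> u _; rewrite -EFinD lee_fin.
rewrite ge0_integralD//; last 2 first.
- by move=> x _; rewrite lee_fin.
- by move=> x _; rewrite lee_fin.
apply: (@le_lt_trans _ _ (((1 - p)^-1)%:E + ((2 * p - 1)^-1)%:E)%E); last exact: ltry.
by apply: leeD; [apply: integral_powR_head|apply: integral_powR_tail]; lra.
Qed.

Lemma gram_integrand_gt0 p : 0 < p -> (0 < \int[leb]_u (gram_integrand p u)%:E)%E.
Proof.
move=> p0.
apply: (@lt_le_trans _ _ (\int[leb]_u ((2 `^ (- p))%:E * (\1_(`]0%R, 1%R[ : set R) u)%:E))%E).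
  rewrite ge0_integralZl_EFin ?powR_ge0//; last first.
    by apply/measurable_EFinP; exact: measurable_indic.
  rewrite integral_indic//= setIT lebesgue_measure_itv/= lte_fin ltr01 oppr0 adde0.
  by rewrite mule1 lte_fin powR_gt0.
apply: ge0_le_integral => //=.
- by apply: emeasurable_funM => //; apply/measurable_EFinP; exact: measurable_indic.
- by apply/measurable_EFinP; exact: measurable_gram_integrand.
- move=> u _; rewrite -EFinM lee_fin indicE mem_setE in_itv /= /gram_integrand.
  case: (boolP (0 < u < 1)) => [/andP[u0 u1]|_] /=; last first.
    by rewrite mulr0; case: ifP => // _; rewrite mulr_ge0 ?powR_ge0.
  rewrite u0 mulr1 -[leLHS]mulr1; apply: ler_pM; rewrite ?powR_ge0//.
    rewrite !powRN lef_pV2 ?posrE ?powR_gt0//; last by lra.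
    by apply: ge0_ler_powR => //; rewrite ?nnegrE; lra.
  by apply: powRN_ge1 => //; lra.
Qed.

(** Substituting [r = t - (x - t) u] pulls out [(x - t)^(1 - 2 p)]; requiring [1 - 2 p = s - 1] is
    what fixes [p = 1 - s / 2]. *)
Lemma gram_kernel_comp a b s t x : 0 < s < 1 -> a < t -> t < x -> x < b ->
  (\int[leb]_r (gram_kernel a b (1 - s / 2) t r * gram_kernel a b (1 - s / 2) x r)%:E =
   ((x - t) `^ (s - 1))%:E * \int[leb]_u (gram_integrand (1 - s / 2) u)%:E)%E.
Proof.
move=> /andP[s0 s1] at_ tx xb; set p := 1 - s / 2.
have L0 : 0 < x - t by rewrite subr_gt0.
have mt : measurable_fun setT (gram_kernel a b p t).
  exact: (measurable_pair1 t (measurable_gram_kernel a b p)).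
have mx : measurable_fun setT (gram_kernel a b p x).
  exact: (measurable_pair1 x (measurable_gram_kernel a b p)).
have mP : measurable_fun setT (fun r => (gram_kernel a b p t r * gram_kernel a b p x r)%:E).
  by apply/measurable_EFinP; exact: measurable_funM.
have P0 r : (0 <= (gram_kernel a b p t r * gram_kernel a b p x r)%:E)%E.
  by rewrite lee_fin mulr_ge0 ?gram_kernel_ge0.
apply: (etrans (ge0_integral_reflect mP P0)).
have mPN : measurable_fun setT
    (fun r : R => (gram_kernel a b p t (- r) * gram_kernel a b p x (- r))%:E).
  exact: (measurableT_comp mP (oppr_measurable (R := R) (D := setT))).
apply: (etrans (ge0_integral_affine (- t) L0 mPN (fun r => P0 (- r)))).
have pt (u : R) : gram_kernel a b p t (- ((x - t) * u - t)) *
    gram_kernel a b p x (- ((x - t) * u - t)) =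
    ((x - t) `^ (- p) * (x - t) `^ (- p)) * gram_integrand p u.
  rewrite /gram_kernel /gram_integrand at_ xb (lt_trans at_ tx) (lt_trans tx xb) /=.
  have -> : (- ((x - t) * u - t) < t) = (0 < u).
    by rewrite opprB ltrBlDr ltrDl pmulr_rgt0.
  case: ifPn => u0; last by rewrite mul0r mulr0.
  have -> : - ((x - t) * u - t) < x.
    have : 0 < (x - t) * u by rewrite mulr_gt0.
    by lra.
  have -> : t - - ((x - t) * u - t) = (x - t) * u by ring.
  have -> : x - - ((x - t) * u - t) = (x - t) * (1 + u) by ring.
  rewrite (powRM_lt0 _ L0 u0) (powRM_lt0 _ L0 (addr_gt0 ltr01 u0)).
  by rewrite mulrACA [_ * (1 + u) `^ _]mulrC.
have c0 : 0 <= (x - t) `^ (- p) * (x - t) `^ (- p) by rewrite mulr_ge0 ?powR_ge0.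
have -> : (\int[leb]_u (gram_kernel a b p t (- ((x - t) * u - t)) *
    gram_kernel a b p x (- ((x - t) * u - t)))%:E =
    ((x - t) `^ (- p) * (x - t) `^ (- p))%:E * \int[leb]_u (gram_integrand p u)%:E)%E.
  rewrite -ge0_integralZl_EFin//; last 2 first.
  - by move=> u _; rewrite lee_fin gram_integrand_ge0.
  - by apply/measurable_EFinP; exact: measurable_gram_integrand.
  by apply: eq_integral => u _; rewrite pt EFinM.
rewrite muleA -EFinM; congr ((_)%:E * _)%E.
rewrite -{1}[x - t]powRr1 ?ltW// -!powRD ?(gt_eqF L0) ?implybT//.
by congr (_ `^ _); rewrite /p; field.
Qed.

(** The quadratic form of the kernel is half that of [K], its sum with the transpose. Off the
    diagonal [K] is [|x - t|^(s - 1)] on the open square and 0 elsewhere, a Gram kernel up to a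
    positive factor. *)
Lemma fker_positive a b s (f : R -> R) : a < b -> 0 < s <= 1 -> sqint leb f ->
  0 <= ip leb (kop leb (fker a b s) f) f.
Proof.
move=> ab /andP[s0 s1] f2; have sk := schur_fker ab s0.
have skT := schur_transpose sk.
have i1 := schur_integrable_mul sk f2 f2; have i2 := schur_integrable_mul skT f2 f2.
have [mf _] := f2.
pose K x t := fker a b s x t + fker a b s t x.
have iK : leb2.-integrable setT (EFin \o (fun z => K z.1 z.2 * f z.2 * f z.1)).
  by apply: eq_integrable (integrableD measurableT i1 i2) => // z _; rewrite /= -EFinD /K -!mulrDl.
have KE : \int[leb2]_z (K z.1 z.2 * f z.2 * f z.1) = 2 * ip leb (kop leb (fker a b s) f) f.
  rewrite [in RHS](ip_kop sk f2 f2).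
  transitivity (\int[leb2]_z (fker a b s z.1 z.2 * f z.2 * f z.1) +
    \int[leb2]_z (fker a b s z.2 z.1 * f z.2 * f z.1)).
    rewrite -RintegralD//; apply: eq_Rintegral => z _; by rewrite -!mulrDl.
  have mF : measurable_fun setT (fun z : R * R => fker a b s z.1 z.2 * f z.2 * f z.1).
    by apply/measurable_EFinP; exact: (measurable_int _ i1).
  have -> : \int[leb2]_z (fker a b s z.2 z.1 * f z.2 * f z.1) =
      \int[leb2]_z (fker a b s z.1 z.2 * f z.2 * f z.1).
    rewrite (Rintegral_swap leb leb mF).
    by apply: eq_Rintegral => z _ /=; rewrite mulrAC.
  by ring.
suff : 0 <= \int[leb2]_z (K z.1 z.2 * f z.2 * f z.1) by rewrite KE pmulr_rge0.
(* On the diagonal [K] is 0, by the strict inequalities in [fker], and the Gram formula fails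
   there. *)
have diag : {ae (@lebesgue_measure R \x @lebesgue_measure R)%E, forall z, z.1 <> z.2}.
  apply: prod_ae.
    rewrite (_ : [set z | _] = ~` ((fun z : R * R => z.1 - z.2) @^-1` [set 0])).
      apply: measurableC; rewrite -[X in measurable X]setTI.
      suff mB : measurable_fun setT (fun z : R * R => z.1 - z.2) by exact: mB.
      by apply: measurable_funB; [exact: measurable_fst|exact: measurable_snd].
    apply/seteqP; split => z /= h h'; apply: h; last by rewrite h' subrr.
    by apply/eqP; rewrite -subr_eq0; apply/eqP.
  apply: aeW => x; exists [set x]; split.
  - exact: measurable_set1.
  - exact: lebesgue_measure_set1.
  - by move=> y /= /contrapT.
have [s1'|s1'] := eqVneq s 1.
  (* At [s = 1] the exponent [p] would be [1 / 2] and the Gram integral infinite; [K] is then 1 on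
     the square, so a factor constant on a set of measure 1 is used. *)
  pose G t r : R := if (a < t) && (t < b) && (0 < r) && (r < 1) then 1 else 0.
  have mG : measurable_fun setT (fun z : R * R => G z.1 z.2).
    apply: measurable_fun_ifT => //.
    apply: measurable_and; first apply: measurable_and; first apply: measurable_and.
    + by apply: measurable_fun_ltr; [exact: measurable_cst|exact: measurable_fst].
    + by apply: measurable_fun_ltr; [exact: measurable_fst|exact: measurable_cst].
    + by apply: measurable_fun_ltr; [exact: measurable_cst|exact: measurable_snd].
    + by apply: measurable_fun_ltr; [exact: measurable_snd|exact: measurable_cst].
  apply: (@gram_ge0 _ _ _ _ _ leb leb K G f mG mf _ _ iK); first by move=> x r; rewrite /G; case: ifP.
  apply: filterS diag => -[x t] /= xt.
  have GG r : G x r * G t r = (if (a < x) && (x < b) && ((a < t) && (t < b)) then 1 else 0)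
      * \1_(`]0%R, 1%R[ : set R) r.
    rewrite indicE mem_setE in_itv /= /G.
    case: (a < x); case: (x < b); case: (a < t); case: (t < b) => /=;
      rewrite ?mul0r ?mulr0//.
    by case: (0 < r < 1); rewrite /= ?mulr1 ?mulr0.
  under eq_integral do rewrite GG EFinM.
  rewrite ge0_integralZl_EFin//; last 2 first.
  - by apply/measurable_EFinP; exact: measurable_indic.
  - by case: ifP.
  rewrite integral_indic//= setIT lebesgue_measure_itv/= lte_fin ltr01 oppr0 adde0.
  rewrite mule1 /K /fker s1' subrr !powRr0; congr EFin.
  have [xlt|tlx|//] := ltgtP x t.
  - rewrite !andbF /= add0r andbT.
    have [ax|_] := ltP a x; have [tb|_] := ltP t b; rewrite ?andbF//=.
    by rewrite (lt_trans xlt tb) (lt_trans ax xlt).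
  - rewrite !andbF /= addr0 andbT.
    have [at_|_] := ltP a t; have [xb|_] := ltP x b; rewrite ?andbF//=.
    by rewrite (lt_trans at_ tlx) (lt_trans tlx xb).
have s01 : 0 < s < 1 by rewrite s0 lt_neqAle s1'.
pose p := 1 - s / 2.
have p01 : 2^-1 < p < 1 by rewrite /p; lra.
have p0 : 0 < p by rewrite /p; lra.
pose C := fine (\int[leb]_u (gram_integrand p u)%:E)%E.
have CE : (C%:E = \int[leb]_u (gram_integrand p u)%:E)%E by rewrite fineK// gram_integrand_fin.
have C0 : 0 < C by rewrite -lte_fin CE gram_integrand_gt0.
have iCK : leb2.-integrable setT (EFin \o (fun z => C * K z.1 z.2 * f z.2 * f z.1)).
  by apply: eq_integrable (integrableZl measurableT C iK) => // z _; rewrite /= -EFinM !mulrA.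
have h : 0 <= \int[leb2]_z (C * K z.1 z.2 * f z.2 * f z.1).
  apply: (@gram_ge0 _ _ _ _ _ leb leb (fun x t => C * K x t) _ f
    (measurable_gram_kernel a b p) mf _ _ iCK).
    by move=> x r; exact: gram_kernel_ge0.
  apply: filterS diag => -[x t] /= xt.
  have [xab|xab] := boolP ((a < x) && (x < b)); last first.
    rewrite (eq_integral (cst 0%E)) ?integral0; last first.
      by move=> r _; rewrite /gram_kernel (negbTE xab) mul0r.
    rewrite /K /fker; congr EFin; apply/esym/eqP.
    rewrite mulf_eq0 gt_eqF//=; apply/eqP.
    case: ifPn => [/andP[/andP[at_ tx] xb]|_].
      by move: xab; rewrite xb (lt_trans at_ tx).
    case: ifPn => [/andP[/andP[ax xt'] tb]|_]; last by rewrite addr0.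
    by move: xab; rewrite ax (lt_trans xt' tb).
  have [tab|tab] := boolP ((a < t) && (t < b)); last first.
    rewrite (eq_integral (cst 0%E)) ?integral0; last first.
      by move=> r _; rewrite [gram_kernel a b p t r]/gram_kernel (negbTE tab) mulr0.
    rewrite /K /fker; congr EFin; apply/esym/eqP.
    rewrite mulf_eq0 gt_eqF//=; apply/eqP.
    case: ifPn => [/andP[/andP[at_ tx] xb]|_].
      by move: tab; rewrite at_ (lt_trans tx xb).
    case: ifPn => [/andP[/andP[ax xt'] tb]|_]; last by rewrite addr0.
    by move: tab; rewrite tb (lt_trans ax xt').
  have /andP[ax xb] := xab; have /andP[at_ tb] := tab.
  have [xlt|tlx|//] := ltgtP x t.
  - rewrite (gram_kernel_comp s01 ax xlt tb) -CE -EFinM /K /fker ax xlt tb /=.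
    by rewrite (lt_gtF xlt) andbF /= add0r mulrC.
  - under eq_integral do rewrite mulrC.
    rewrite (gram_kernel_comp s01 at_ tlx xb) -CE -EFinM /K /fker at_ tlx xb /=.
    by rewrite (lt_gtF tlx) andbF /= addr0 mulrC.
have CK : \int[leb2]_z (C * K z.1 z.2 * f z.2 * f z.1) =
    C * \int[leb2]_z (K z.1 z.2 * f z.2 * f z.1).
  by rewrite -RintegralZl//; apply: eq_Rintegral => z _; rewrite !mulrA.
by move: h; rewrite CK pmulr_rge0.
Qed.

End FractionalPositivity.

(** * Weak derivatives *)

Section AlmostEverywhere.
Context d (X : measurableType d) (K : realType) (m : {measure set X -> \bar K}).
Implicit Types (P Q S : X -> Prop).

Lemma ae_mono P Q : (forall x, P x -> Q x) ->
  {ae m, forall x, P x} -> {ae m, forall x, Q x}.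
Proof. by move=> PQ; apply: filterS. Qed.

Lemma ae_mono2 P Q S : (forall x, P x -> Q x -> S x) ->
  {ae m, forall x, P x} -> {ae m, forall x, Q x} -> {ae m, forall x, S x}.
Proof. by move=> PQ; apply: filterS2. Qed.

Lemma ae_all P : (forall x, P x) -> {ae m, forall x, P x}.
Proof. exact: aeW. Qed.

End AlmostEverywhere.

(** * A step function of class C^1 *)

Section Spline.
Context {R : realType}.
Implicit Types (x y r c l : R).

Definition ramp x : R := Num.max 0 x.

Definition ramp2 x : R := (ramp x) ^+ 2 / 2.

Lemma ramp_le0 x : x <= 0 -> ramp x = 0.
Proof. by rewrite /ramp => x0; apply/max_idPl. Qed.

Lemma ramp_ge0 x : 0 <= x -> ramp x = x.
Proof. by rewrite /ramp => x0; apply/max_idPr. Qed.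

(** [ramp] is 1-Lipschitz with primitive [ramp2]. The quadratic remainder gives the derivative at
    every point, the kink of [ramp] included. *)
Lemma ramp2_taylor x y : `|ramp2 y - ramp2 x - ramp x * (y - x)| <= (y - x) ^+ 2 / 2.
Proof.
rewrite /ramp2; have [x0|x0] := leP x 0; have [y0|y0] := leP y 0.
- by rewrite !ramp_le0// expr0n /= !mul0r !subrr normr0 divr_ge0 ?sqr_ge0.
- rewrite (ramp_le0 x0) (ramp_ge0 (ltW y0)) expr0n /= !mul0r !subr0.
  by rewrite ger0_norm ?divr_ge0 ?sqr_ge0//; nra.
- rewrite (ramp_ge0 (ltW x0)) (ramp_le0 y0) expr0n /= !mul0r sub0r.
  by rewrite ler_norml; apply/andP; split; nra.
- rewrite (ramp_ge0 (ltW x0)) (ramp_ge0 (ltW y0)).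
  have -> : y ^+ 2 / 2 - x ^+ 2 / 2 - x * (y - x) = (y - x) ^+ 2 / 2 by field.
  by rewrite ger0_norm// divr_ge0 ?sqr_ge0.
Qed.

Lemma is_derive_ramp2 x : is_derive x 1 ramp2 (ramp x).
Proof.
have h : h^-1 *: (ramp2 (h *: (1 : R) + x) - ramp2 x) @[h --> (0 : R)^'] --> ramp x.
  apply/cvgrPdist_le => e e0; near=> t.
  have t0 : t != 0 by near: t; exact: nbhs_dnbhs_neq.
  have tp : 0 < `|t| by rewrite normr_gt0.
  have := ramp2_taylor x (t *: (1 : R) + x); rewrite addrK /GRing.scale /= mulr1.
  set D := ramp2 _ - ramp2 x => hD.
  rewrite distrC -(ler_pM2l tp) -normrM mulrBr mulrA mulfV// mul1r [t * ramp x]mulrC.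
  apply: (le_trans hD); rewrite -(real_normK (num_real t)).
  suff : `|t| <= e by move=> te; nra.
  near: t; apply: dnbhs0_le => //.
by apply: DeriveDef; [apply/cvg_ex; exists (ramp x)|apply/cvg_lim].
Unshelve. all: by end_near. Qed.

Lemma continuous_ramp : continuous ramp.
Proof.
move=> x; apply: (@continuous_max _ _ (fun=> 0) (fun y : R => y)).
  exact: cvg_cst.
exact: cvg_id.
Qed.

(** Rises from 0 to 1 over [[0, 2]], with the continuous derivative [hat]. Differences of two
    rescaled steps serve as test functions in the lemma of du Bois-Reymond. *)
Definition step x : R := ramp2 x - 2 * ramp2 (x - 1) + ramp2 (x - 2).

Definition hat x : R := ramp x - 2 * ramp (x - 1) + ramp (x - 2).

Lemma step_le0 x : x <= 0 -> step x = 0.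
Proof.
move=> x0; rewrite /step /ramp2 !ramp_le0//; [|lra|lra].
by rewrite expr0n /= !mul0r mulr0 subrr addr0.
Qed.

Lemma step_ge2 x : 2 <= x -> step x = 1.
Proof.
by move=> x2; rewrite /step /ramp2 !ramp_ge0//; [field|lra|lra|lra].
Qed.

Lemma hat_out x : x <= 0 \/ 2 <= x -> hat x = 0.
Proof.
case=> h; rewrite /hat.
  by rewrite !ramp_le0//; [ring|lra|lra].
by rewrite !ramp_ge0//; [ring|lra|lra|lra].
Qed.

Lemma hat_bound x : 0 <= hat x <= 1.
Proof.
have [x0|x0] := leP x 0; first by rewrite hat_out ?lexx ?ler01//; left.
have [x2|x2] := leP 2 x; first by rewrite hat_out ?lexx ?ler01//; right.
rewrite /hat (ramp_ge0 (ltW x0)) (@ramp_le0 (x - 2)); last by lra.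
have [x1|x1] := leP x 1; first by rewrite ramp_le0; lra.
by rewrite ramp_ge0; lra.
Qed.

Lemma continuous_hat : continuous hat.
Proof.
move=> x; apply: cvgD.
  apply: cvgB; first exact: continuous_ramp.
  apply: cvgM; first exact: cvg_cst.
  apply: (@continuous_comp _ _ _ (fun y : R => y - 1) ramp); last exact: continuous_ramp.
  by apply: cvgB; [exact: cvg_id|exact: cvg_cst].
apply: (@continuous_comp _ _ _ (fun y : R => y - 2) ramp); last exact: continuous_ramp.
by apply: cvgB; [exact: cvg_id|exact: cvg_cst].
Qed.

Lemma is_derive_step_affine l c x :
  is_derive x 1 (fun y => step (l * (y - c))) (l * hat (l * (x - c))).
Proof.
have aff e : is_derive x (1 : R) (fun y : R => l * (y - c) - e) l.
  have -> : (fun y : R => l * (y - c) - e) = (fun y => l * y + (- (l * c) - e)).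
    by apply/funext => y; ring.
  have h := is_deriveD (is_deriveZ l (is_derive_id x (1 : R)))
    (is_derive_cst (- (l * c) - e) x (1 : R)).
  rewrite [X in is_derive _ _ _ X](_ : l = l *: (1 : R) + 0); first exact: h.
  by rewrite addr0 /GRing.scale /= mulr1.
have comp e : is_derive x (1 : R) (fun y : R => ramp2 (l * (y - c) - e))
    (l * ramp (l * (x - c) - e)).
  have := @is_derive1_comp _ ramp2 (fun y : R => l * (y - c) - e) x _ _
    (is_derive_ramp2 (l * (x - c) - e)) (aff e).
  by rewrite mulrC.
have := is_deriveD (is_deriveB (comp 0) (is_deriveZ 2 (comp 1))) (comp 2).
rewrite /step /hat !subr0.
congr is_derive.
- apply/funext => y; rewrite -[LHS]/(ramp2 (l * (y - c) - 0) -
    2 * ramp2 (l * (y - c) - 1) + ramp2 (l * (y - c) - 2)).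
  by rewrite subr0.
- by rewrite /GRing.scale /=; ring.
Qed.

End Spline.

(** * Integration by parts against test functions *)

Section WeakDerivative.
Context {R : realType}.
Implicit Types (a b c d x y r : R) (F g h chi : R -> R).

(** The support lies strictly inside the interval, so [chi] vanishes near every outer point, the end
    points included. *)
Lemma test_function_out a b chi x : test_function a b chi ->
  x \notin `]a, b[ -> chi x = 0 /\ derive1 chi x = 0.
Proof.
move=> [dchi cchi [c [d [ac db out]]]] xab.
have far y : y < c \/ d < y -> chi y = 0.
  by move=> h; apply: out; rewrite in_itv /= negb_and -!ltNge; apply/orP.
have xcd : x < c \/ d < x.
  move: xab; rewrite in_itv /= negb_and -!leNgt => /orP[h|h].
    by left; exact: le_lt_trans h ac.
  by right; exact: lt_le_trans db h.
split; first exact: far.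
rewrite derive1E; suff h : is_derive x (1 : R) chi 0 by exact: derive_val.
have cst0 : is_derive x (1 : R) (cst (0 : R)) 0 by exact: is_derive_cst.
apply: near_eq_is_derive cst0.
case: xcd => h.
- near=> y; rewrite far//; left; near: y; exact: lt_nbhsl.
- near=> y; rewrite far//; right; near: y; exact: lt_nbhsr.
Unshelve. all: by end_near. Qed.

Lemma test_function_bounded a b chi : test_function a b chi ->
  exists M, forall x, `|derive1 chi x| <= M.
Proof.
move=> tc; have [dchi cchi [c [d [ac db out]]]] := tc.
have [ab|ba] := leP a b; last first.
  exists 0 => x; have xab : x \notin `]a, b[.
    rewrite in_itv /=; apply/negP => /andP[h1 h2]; have := lt_trans h1 h2.
    by move/(lt_trans ba); rewrite ltxx.
  by have [_ ->] := test_function_out tc xab; rewrite normr0.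
have cw : {within `[a, b], continuous (fun x => `|derive1 chi x|)}.
  by apply: continuous_subspaceT => x; apply: continuous_comp; [exact: cchi|exact: norm_continuous].
have [m _ mP] := EVT_max ab cw.
exists (`|derive1 chi m|) => x.
have [xab|xab] := boolP (x \in `[a, b]); first exact: mP.
have xab' : x \notin `]a, b[ by apply: contra xab; exact: subset_itv_oo_cc.
by have [_ ->] := test_function_out tc xab'; rewrite normr0.
Qed.

Lemma test_function_FTC a b chi x : test_function a b chi -> x < b ->
  \int[leb]_(t in `]x, b[) derive1 chi t = - chi x.
Proof.
move=> tc xb; have [dchi cchi _] := tc.
rewrite -[RHS]add0r -(test_function_out (x := b) tc _).1; last by rewrite in_itv /= ltxx andbF.
have ccw : {within `[x, b], continuous (derive1 chi)} by exact: continuous_subspaceT.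
have dR : derivable_oo_LRcontinuous chi x b.
  have cc y : {for y, continuous chi}.
    by apply: differentiable_continuous; apply/derivable1_diffP.
  split; first by move=> y _.
  - by apply: cvg_at_right_filter; exact: cc.
  - by apply: cvg_at_left_filter; exact: cc.
have h := continuous_FTC2 xb ccw dR (fun y _ => erefl).
have mchi : measurable_fun setT (derive1 chi) by exact: continuous_measurable_fun.
rewrite /Rintegral integral_itv_bndo_bndc ?integral_itv_obnd_cbnd ?h//.
- by apply/measurable_EFinP; exact: measurable_funTS.
- by apply/measurable_EFinP; exact: measurable_funTS.
Qed.

Lemma integral_cst_itv_lty (M : R) a b : (\int[leb]_(x in `]a, b[) M%:E < +oo)%E.
Proof.
rewrite /= integral_cst//= lebesgue_measure_itv/=; case: ifP => _.
  by rewrite -EFinB -EFinM ltry.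
by rewrite mule0.
Qed.

Lemma integrable_bounded_itv a b (f : R -> R) M : measurable_fun setT f ->
  (forall x, `|f x| <= M) -> leb.-integrable `]a, b[ (EFin \o f).
Proof.
move=> mf fM; have M0 : 0 <= M by exact: le_trans (fM 0).
apply: (@le_integrable _ _ _ leb _ (measurable_itv _) _ (EFin \o cst M)).
- by apply/measurable_EFinP; exact: measurable_funTS.
- by move=> x _; rewrite /= lee_fin [leRHS]ger0_norm.
- apply/integrableP; split; first exact/measurable_EFinP.
  under eq_integral do rewrite /= ger0_norm//.
  exact: integral_cst_itv_lty.
Qed.

(** Fubini on the triangle [a < t < x < b]: integrating [derive1 chi] over []t, b[] leaves
    [- chi t]. The constant [c] is multiplied by the integral of [derive1 chi] over []a, b[], which
    is 0. *)
Lemma wderiv_primitive a b F g c : a < b ->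
  measurable_fun `]a, b[ F -> leb.-integrable `]a, b[ (EFin \o g) ->
  {ae leb, forall x, x \in `]a, b[ -> F x = c + \int[leb]_(t in `]a, x[) g t} ->
  is_wderiv a b F g.
Proof.
move=> ab mF ig FE.
pose g0 := g \_ `]a, b[.
have ig0 : leb.-integrable setT (EFin \o g0).
  by rewrite /g0 -restrict_EFin; apply/integrable_restrict => //; rewrite setTI.
have mg0 : measurable_fun setT g0 by apply/measurable_EFinP; exact: (measurable_int _ ig0).
pose P x := \int[leb]_t (if (a < t) && (t < x) && (x < b) then g0 t else 0).
have PE x : x \in `]a, b[ -> \int[leb]_(t in `]a, x[) g t = P x.
  rewrite in_itv /= => /andP[ax xb]; rewrite Rintegral_mkcond; apply: eq_Rintegral => t _.
  rewrite /g0 !patchE !mem_setE !in_itv /= xb andbT.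
  by case: ifPn => // /andP[at_ tx]; rewrite at_ (lt_trans tx xb).
have mH : measurable_fun setT (fun z : R * R => (a < z.2) && (z.2 < z.1) && (z.1 < b)).
  apply: measurable_and; first apply: measurable_and.
  + by apply: measurable_fun_ltr; [exact: measurable_cst|exact: measurable_snd].
  + by apply: measurable_fun_ltr; [exact: measurable_snd|exact: measurable_fst].
  + by apply: measurable_fun_ltr; [exact: measurable_fst|exact: measurable_cst].
pose H (z : R * R) := if (a < z.2) && (z.2 < z.1) && (z.1 < b) then g0 z.2 else 0.
have mHf : measurable_fun setT H.
  apply: measurable_fun_ifT => //; exact: (measurableT_comp mg0 measurable_snd).
have mP : measurable_fun setT P by exact: (@measurable_param_Rintegral _ _ _ _ _ leb H).
pose M0 := fine (\int[leb]_t `|(g0 t)%:E|)%E.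
have gfin : (\int[leb]_t `|(g0 t)%:E| < +oo)%E by have /integrableP[] := ig0.
have M0E : (\int[leb]_t `|(g0 t)%:E| = M0%:E)%E.
  by rewrite fineK// ge0_fin_numE//; exact: integral_ge0.
have Hg x t : `|H (x, t)| <= `|g0 t| by rewrite /H /=; case: ifP; rewrite ?normr0.
have iH x : leb.-integrable setT (EFin \o (fun t => H (x, t))).
  apply: (le_integrable measurableT _ _ ig0).
    by apply/measurable_EFinP; exact: (measurable_pair1 x mHf).
  by move=> t _; rewrite /= lee_fin.
have HM x : (\int[leb]_t `|(H (x, t))%:E| <= M0%:E)%E.
  rewrite -M0E; apply: ge0_le_integral => //=.
  - by apply: measurableT_comp => //; apply: measurableT_comp => //; exact: (measurable_pair1 x mHf).
  - by apply: measurableT_comp => //; apply: measurableT_comp.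
  - by move=> t _; rewrite lee_fin.
have PM x : `|P x| <= M0.
  apply: (le_trans (le_normr_Rintegral measurableT (iH x))).
  rewrite /Rintegral -[leRHS]/(fine M0%:E) fine_le//; last exact: HM.
  by rewrite ge0_fin_numE ?integral_ge0//; apply: le_lt_trans (HM x) (ltry _).
have iP : leb.-integrable `]a, b[ (EFin \o (fun x => c + P x)).
  apply: (@integrable_bounded_itv _ _ _ (`|c| + M0)); first exact: measurable_funD.
  by move=> x; apply: (le_trans (ler_normD _ _)); rewrite lerD2l.
have FE' : {ae leb, forall x, x \in `]a, b[ -> F x = c + P x}.
  by apply: ae_mono FE => x h xab; rewrite h// PE.
have iF : leb.-integrable `]a, b[ (EFin \o F).
  apply/integrableP; split; first exact/measurable_EFinP.
  have /integrableP[mcP cPf] := iP; apply: le_lt_trans cPf.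
  rewrite le_eqVlt; apply/orP; left; apply/eqP; apply: ae_eq_integral => //.
  - by apply: measurableT_comp => //; exact/measurable_EFinP.
  - exact: measurableT_comp.
  - by apply: ae_mono FE' => x h /= xab; rewrite h.
split => // chi tc; have [M chiM] := test_function_bounded tc.
have [dchi cchi _] := tc.
have mchi' : measurable_fun setT (derive1 chi) by exact: continuous_measurable_fun.
have mchi : measurable_fun setT chi.
  apply: continuous_measurable_fun => x.
  by apply: differentiable_continuous; apply/derivable1_diffP.
have M_0 : 0 <= M by apply: le_trans (chiM 0).
pose Phi (z : R * R) := H z * derive1 chi z.1.
have mPhi : measurable_fun setT Phi.
  by apply: measurable_funM => //; exact: (measurableT_comp mchi' measurable_fst).
have iPhi : leb2.-integrable setT (EFin \o Phi).
  apply/integrable12ltyP; first exact/measurable_EFinP.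
  apply: (@le_lt_trans _ _ (\int[leb]_(x in `]a, b[) (M * M0)%:E)%E); last exact: integral_cst_itv_lty.
  rewrite [leRHS]integral_mkcond; apply: ge0_le_integral => //=.
  - by move=> x _; exact: integral_ge0.
  - by apply: (@measurable_fun_fubini_tonelli_F _ _ _ _ _ leb (fun z => `|(Phi z)%:E|%E)) => //;
    apply: measurableT_comp => //; exact/measurable_EFinP.
  - by apply/(measurable_restrictT _ _).1.
  - move=> x _; rewrite patchE mem_setE in_itv /=; case: ifPn => xab.
      apply: (@le_trans _ _ (\int[leb]_t (M%:E * `|(H (x, t))%:E|))%E).
        apply: ge0_le_integral => //=.
        - by apply: measurableT_comp => //; apply: measurableT_comp => //; exact: (measurable_pair1 x mPhi).
        - by apply: emeasurable_funM => //; apply: measurableT_comp => //; apply: measurableT_comp => //; exact: (measurable_pair1 x mHf).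
        - by move=> t _; rewrite -EFinM lee_fin normrM mulrC ler_wpM2r.
      rewrite ge0_integralZl_EFin//; last first.
        by apply: measurableT_comp => //; apply: measurableT_comp => //; exact: (measurable_pair1 x mHf).
      by rewrite EFinM lee_wpmul2l ?lee_fin.
    rewrite (eq_integral (cst 0%E)) ?integral0// => t _.
    rewrite /Phi /H /=; case: ifPn => [/andP[/andP[at_ tx] xb]|_]; last by rewrite mul0r normr0.
    by move: xab; rewrite (lt_trans at_ tx) xb.
have P0 x : x \notin `]a, b[ -> P x = 0.
  rewrite in_itv /= => xab; rewrite /P /Rintegral (eq_integral (cst 0%E)) ?integral0//= => t _.
  case: ifPn => [/andP[/andP[at_ tx] xb]|//].
  by move: xab; rewrite (lt_trans at_ tx) xb.
have iF' : leb.-integrable `]a, b[ (EFin \o (fun x => derive1 chi x)).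
  exact: integrable_bounded_itv chiM.
have iPchi : leb.-integrable `]a, b[ (EFin \o (fun x => P x * derive1 chi x)).
  apply: (@integrable_bounded_itv _ _ _ (M0 * M)); first exact: measurable_funM.
  by move=> x; rewrite normrM ler_pM.
transitivity (\int[leb]_(x in `]a, b[) (c * derive1 chi x + P x * derive1 chi x)).
  rewrite /Rintegral; congr fine; apply: ae_eq_integral => //.
  - apply/measurable_EFinP; apply: measurable_funM => //; exact: measurable_funTS.
  - apply/measurable_EFinP; apply: measurable_funTS; apply: measurable_funD; apply: measurable_funM => //.
  - by apply: ae_mono FE' => x h /= xab; rewrite h// mulrDl.
rewrite RintegralD//; last by apply: eq_integrable (integrableZl _ c iF').
rewrite RintegralZl// (test_function_FTC tc ab).
rewrite (test_function_out tc (x := a) _).1 ?in_itv /= ?ltxx// oppr0 mulr0 add0r.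
transitivity (\int[leb]_x \int[leb]_t Phi (x, t)).
  rewrite [LHS]Rintegral_mkcond; apply: eq_Rintegral => x _.
  rewrite patchE mem_setE; case: ifPn => xab.
    exact: (esym (RintegralZr (derive1 chi x) measurableT (iH x))).
  rewrite /Rintegral (eq_integral (cst 0%E)) ?integral0//= => t _.
  by rewrite /Phi /= (test_function_out tc xab).2 mulr0.
rewrite -Rintegral_prod1// Rintegral_prod2//.
have mgchi : measurable_fun setT (fun t => g0 t * chi t) by exact: measurable_funM.
have igchi : leb.-integrable setT (EFin \o (fun t => g0 t * chi t)).
  have cw : {within `[a, b], continuous (fun x => `|chi x|)}.
    apply: continuous_subspaceT => x; apply: continuous_comp; last exact: norm_continuous.
    by apply: differentiable_continuous; apply/derivable1_diffP.
  have [m _ mchiP] := EVT_max (ltW ab) cw.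
  apply: (le_integrable measurableT _ _ (integrableZl measurableT `|chi m| ig0)).
    exact/measurable_EFinP.
  move=> t _; rewrite /= lee_fin !normrM normr_id mulrC ler_wpM2r//.
  have [tab|tab] := boolP (t \in `[a, b]); first exact: mchiP.
  have tab' : t \notin `]a, b[ by apply: contra tab; exact: subset_itv_oo_cc.
  by have [-> _] := test_function_out tc tab'; rewrite normr0.
rewrite [X in - X]Rintegral_mkcond.
have -> : (fun t => g t * chi t) \_ `]a, b[ = (fun t => g0 t * chi t).
  by apply/funext => t; rewrite /g0 !patchE; case: ifP => // _; rewrite mul0r.
rewrite -[RHS]mulN1r -RintegralZl//.
apply: eq_Rintegral => t _.
have [tab|tab] := boolP (t \in `]a, b[); last first.
  rewrite /g0 patchE mem_setE (negbTE tab) mul0r mulr0.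
  rewrite /Rintegral (eq_integral (cst 0%E)) ?integral0//= => x _.
  rewrite /Phi /H /=; case: ifPn => [/andP[/andP[at_ tx] xb]|_]; last by rewrite mul0r.
  by move: tab; rewrite in_itv /= at_ (lt_trans tx xb).
have := tab; rewrite in_itv /= => /andP[at_ tb].
rewrite mulN1r -mulrN -(test_function_FTC tc tb).
have itb : leb.-integrable `]t, b[ (EFin \o derive1 chi) by exact: integrable_bounded_itv chiM.
rewrite -RintegralZl// [RHS]Rintegral_mkcond; apply: eq_Rintegral => x _.
rewrite patchE mem_setE in_itv /= /Phi /H /= at_ /=.
by case: ifP => // _; rewrite mul0r.
Qed.

End WeakDerivative.

(** * The lemma of du Bois-Reymond and boundary values *)

Section Uniqueness.
Context {R : realType}.
Implicit Types (a b c d x y r : R) (F g h : R -> R).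

(** The derivative of a rescaled [step]: unit mass on [[c, c + r]] and height at most [2 / r], hence
    an averaging kernel to the right of [c]. *)
Definition bump c r x : R := 2 / r * hat (2 / r * (x - c)).

Lemma bump_out c r x : 0 < r -> x \notin `]c, c + r[ -> bump c r x = 0.
Proof.
move=> r0; rewrite in_itv /= negb_and -!leNgt => h; rewrite /bump hat_out ?mulr0//.
have r2 : 0 < 2 / r by rewrite divr_gt0.
case/orP: h => h; [left|right].
  by rewrite pmulr_rle0// subr_le0.
rewrite -[leLHS](mulfVK (lt0r_neq0 r0)) ler_wpM2l// ?(ltW r2)//; lra.
Qed.

Lemma bump_bound c r x : 0 < r -> 0 <= bump c r x <= 2 / r.
Proof.
move=> r0; rewrite /bump; have r2 : 0 < 2 / r by rewrite divr_gt0.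
have /andP[h0 h1] := hat_bound (2 / r * (x - c)).
by rewrite mulr_ge0 ?(ltW r2)//= -[leRHS]mulr1 ler_wpM2l// ltW.
Qed.

Lemma continuous_bump c r : continuous (bump c r).
Proof.
move=> x; apply: cvgM; first exact: cvg_cst.
apply: (@continuous_comp _ _ _ (fun y : R => 2 / r * (y - c)) hat); last exact: continuous_hat.
by apply: cvgM; [exact: cvg_cst|apply: cvgB; [exact: cvg_id|exact: cvg_cst]].
Qed.

Lemma measurable_bump c r : measurable_fun setT (bump c r).
Proof. by apply: continuous_measurable_fun; exact: continuous_bump. Qed.

Lemma derivable_step_affine l c x : derivable (fun y : R => step (l * (y - c))) x 1.
Proof. by have [] := is_derive_step_affine l c x. Qed.

Lemma derive1_step_affine l c x :
  derive1 (fun y : R => step (l * (y - c))) x = l * hat (l * (x - c)).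
Proof. by rewrite derive1E; apply: derive_val; exact: is_derive_step_affine. Qed.

Lemma integral_bump c r : 0 < r -> \int[leb]_x bump c r x = 1.
Proof.
move=> r0; have cr : c < c + r by rewrite ltrDl.
pose chi (y : R) := step (2 / r * (y - c)).
have ccw : {within `[c, c + r], continuous (bump c r)}.
  by apply: continuous_subspaceT => x; exact: continuous_bump.
have dR : derivable_oo_LRcontinuous chi c (c + r).
  have cc y : {for y, continuous chi}.
    apply: differentiable_continuous; apply/derivable1_diffP.
    exact: derivable_step_affine.
  split; first by move=> y _; exact: derivable_step_affine.
  - by apply: cvg_at_right_filter; exact: cc.
  - by apply: cvg_at_left_filter; exact: cc.
have := continuous_FTC2 cr ccw dR (fun y _ => derive1_step_affine _ _ _).
have -> : chi c = 0 by rewrite /chi subrr mulr0 step_le0.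
have -> : chi (c + r) = 1.
  by rewrite /chi [c + r]addrC addrK mulfVK ?gt_eqF// step_ge2.
rewrite sube0 => h.
rewrite /Rintegral -[RHS]/(fine 1%:E) -h [in RHS]integral_mkcond; congr fine.
apply: eq_integral => x _; rewrite patchE mem_setE; case: ifPn => // xc.
by rewrite bump_out//; apply: contra xc; rewrite addrC; exact: subset_itv_oo_cc.
Qed.

Lemma integrable_bump c r : 0 < r -> leb.-integrable setT (EFin \o bump c r).
Proof.
move=> r0; have ib : leb.-integrable `]c, c + r[ (EFin \o bump c r).
  apply: (@integrable_bounded_itv _ _ _ _ (2 / r) (measurable_bump c r)) => x.
  by have /andP[h0 h1] := bump_bound c x r0; rewrite ger0_norm.
have -> : EFin \o bump c r = ((EFin \o bump c r) \_ `]c, c + r[).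
  by apply/funext => x; rewrite patchE mem_setE /=; case: ifPn => // /(bump_out r0) ->.
by apply/integrable_restrict => //; rewrite setTI.
Qed.

Lemma integrable_mul_bump h c r : 0 < r -> leb.-integrable setT (EFin \o h) ->
  leb.-integrable setT (EFin \o (fun x => h x * bump c r x)).
Proof.
move=> r0 ih; apply: (le_integrable measurableT _ _ (integrableZl measurableT (2 / r) ih)).
  apply/measurable_EFinP; apply: measurable_funM; last exact: measurable_bump.
  by apply/measurable_EFinP; exact: (measurable_int _ ih).
move=> x _; have /andP[h0 h1] := bump_bound c x r0.
rewrite /= lee_fin (normrM (h x) (bump c r x)) (normrM (2 / r) (h x)).
by rewrite (ger0_norm h0) (ger0_norm (le_trans h0 h1)) mulrC ler_wpM2r.
Qed.

(** The factor 4 is the height [2 / r] times the length [2 r] of the ball over which [davg]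
    averages. *)
Lemma bump_mean h c r : 0 < r -> leb.-integrable setT (EFin \o h) ->
  (`|\int[leb]_x (h x * bump c r x) - h c|%:E <= 4%:E * davg h c r)%E.
Proof.
move=> r0 ih.
have ib := integrable_bump c r0; have ihb := integrable_mul_bump c r0 ih.
have ihc : leb.-integrable setT (EFin \o (fun x => h c * bump c r x)).
  exact: (integrableZl measurableT (h c) ib).
have -> : \int[leb]_x (h x * bump c r x) - h c =
    \int[leb]_x (h x * bump c r x - h c * bump c r x).
  by rewrite RintegralB// RintegralZl// integral_bump// mulr1.
have mh : measurable_fun setT h by apply/measurable_EFinP; exact: (measurable_int _ ih).
have mb := measurable_bump c r.
pose k (x : R) := h x * bump c r x - h c * bump c r x.
have mk : measurable_fun setT k.
  by apply: measurable_funB; apply: measurable_funM => //; exact: measurable_cst.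
have ik : leb.-integrable setT (EFin \o k) by exact: (integrableB measurableT ihb ihc).
apply: (@le_trans _ _ (\int[leb]_x `|(k x)%:E|)%E).
  apply: le_trans (le_abse_integral leb measurableT (measurable_int _ ik)).
  have fin := integrable_fin_num measurableT ik.
  by rewrite -[X in (_ <= `|X|)%E](fineK fin).
rewrite /davg /iavg lebesgue_measure_ball ?(ltW r0)// muleA.
have -> : (4%:E * ((r *+ 2)%:E)^-1 = (2 / r)%:E :> \bar R)%E.
  rewrite inver mulrn_eq0 /= gt_eqF// -EFinM; congr EFin.
  by rewrite -mulr_natr; field; rewrite gt_eqF.
rewrite -ge0_integralZl_EFin//=; last 3 first.
- exact: measurable_ball.
- apply: measurableT_comp => //; apply: measurableT_comp => //; apply: measurable_funTS.
  by apply: measurable_funB => //; exact: measurable_cst.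
- by rewrite divr_ge0// ltW.
rewrite [leRHS]integral_mkcond; apply: ge0_le_integral => //=.
- by apply: measurableT_comp => //; apply: measurableT_comp.
- apply/(measurable_restrictT _ _).1; first exact: measurable_ball.
  apply: measurable_funTS; apply: emeasurable_funM => //.
  by apply: measurableT_comp => //; apply: measurableT_comp => //; apply: measurable_funB.
- move=> x _; rewrite patchE; case: ifPn => xc.
    rewrite -EFinM lee_fin /k -mulrBl (normrM (h x - h c) (bump c r x)) mulrC.
    by have /andP[h0 h1] := bump_bound c x r0; rewrite (ger0_norm h0) ler_wpM2r.
  rewrite /k bump_out ?mulr0 ?subrr ?normr0//; apply: contra xc.
  rewrite in_itv /= => /andP[cx xr]; rewrite inE /ball /= ltr_norml; lra.
Qed.

Lemma ae_ex_itv (P : R -> Prop) a b : a < b -> {ae leb, forall x, P x} ->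
  exists2 x, x \in `]a, b[ & P x.
Proof.
move=> ab [N [mN N0 PN]]; apply: contrapT => nP.
have sub : `]a, b[ `<=` N.
  by move=> x xab; apply: PN => Px; apply: nP; exists x.
have le0 := le_measure leb (mem_set (measurable_itv `]a, b[)) (mem_set mN) sub.
have N0' : (leb N <= 0)%E by rewrite [X in (X <= _)%E]N0.
have : ((b - a)%:E <= 0 :> \bar R)%E.
  apply: le_trans (le_trans le0 N0').
  by rewrite [leRHS]lebesgue_measure_itv /= lte_fin ab -EFinB.
by rewrite lee_fin leNgt subr_gt0 ab.
Qed.

Lemma lebesgue_pt_near f x (e : R) : lebesgue_pt f x -> 0 < e ->
  \forall r \near 0^'+, (davg f x r < e%:E)%E.
Proof. by move=> fx e0; apply: (fx [set u | (u < e%:E)%E]); apply: open_ereal_lt'; rewrite lte_fin. Qed.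

(** A single step does not have compact support; in the difference the two values 1 cancel on the
    right. *)
Lemma test_function_bump a b c d r : 0 < r -> c \in `]a, b[ -> d \in `]a, b[ ->
  c + r < b -> d + r < b ->
  test_function a b (fun y => step (2 / r * (y - c)) - step (2 / r * (y - d))) /\
  derive1 (fun y => step (2 / r * (y - c)) - step (2 / r * (y - d))) =
    (fun y => bump c r y - bump d r y).
Proof.
move=> r0 cab dab crb drb.
have dE : derive1 (fun y => step (2 / r * (y - c)) - step (2 / r * (y - d))) =
    (fun y => bump c r y - bump d r y).
  apply/funext => y; rewrite derive1E; apply: derive_val.
  exact: is_deriveB (is_derive_step_affine (2 / r) c y) (is_derive_step_affine (2 / r) d y).
split => //; split.
- move=> y; have [] // := is_deriveB (is_derive_step_affine (2 / r) c y) (is_derive_step_affine (2 / r) d y).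
- by rewrite dE => y; apply: cvgB; exact: continuous_bump.
- move: cab dab; rewrite !in_itv /= => /andP[ac cb] /andP[ad db].
  exists (Num.min c d), (Num.max (c + r) (d + r)); split.
  + by rewrite lt_min ac.
  + by rewrite gt_max crb.
  + move=> x; rewrite in_itv /= negb_and -!ltNge lt_min gt_max => /orP[/andP[xc xd]|/andP[xc xd]].
      have r2 : 0 < 2 / r by rewrite divr_gt0.
      by rewrite !step_le0 ?subrr// pmulr_rle0// subr_le0 ltW.
    have r2 : 0 <= 2 / r by rewrite divr_ge0// ltW.
    rewrite !step_ge2 ?subrr// -[leLHS](mulfVK (lt0r_neq0 r0)) ler_wpM2l//; lra.
Qed.

(* du Bois-Reymond, by comparing the averages of h over [c, c + r] and
   [d, d + r] at two Lebesgue points c and d. *)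
Lemma wderiv0_const a b h : a < b -> leb.-integrable `]a, b[ (EFin \o h) ->
  (forall chi, test_function a b chi ->
     \int[leb]_(x in `]a, b[) (h x * derive1 chi x) = 0) ->
  exists c, {ae leb, forall x, x \in `]a, b[ -> h x = c}.
Proof.
move=> ab ih hchi; pose h0 := h \_ `]a, b[.
have ih0 : leb.-integrable setT (EFin \o h0).
  by rewrite /h0 -restrict_EFin; apply/integrable_restrict => //; rewrite setTI.
have lebP : {ae leb, forall x, lebesgue_pt h0 x}.
  by apply: lebesgue_differentiation; exact: open_integrable_locally openT ih0.
have h0E x : x \in `]a, b[ -> h0 x = h x by move=> xab; rewrite /h0 patchE mem_setE xab.
have [c cab cleb] := ae_ex_itv ab lebP.
exists (h c); apply: ae_mono lebP => d dleb dab; apply: contrapT => ne.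
(* Each mean is within [4 e] of the value at its point and the two means coincide, so
   [|h d - h c| < 8 e], a contradiction. *)
pose e := `|h d - h c| / 8.
have e0 : 0 < e by rewrite divr_gt0// normr_gt0 subr_eq0; apply/eqP.
have : \forall r \near 0^'+, [/\ 0 < r, c + r < b, d + r < b,
    (davg h0 c r < e%:E)%E & (davg h0 d r < e%:E)%E].
  near=> r; split.
  - by near: r; exact: nbhs_right_gt.
  - rewrite -ltrBrDl; near: r; apply: nbhs_right_lt.
    by rewrite subr_gt0; move: cab; rewrite in_itv => /andP[].
  - rewrite -ltrBrDl; near: r; apply: nbhs_right_lt.
    by rewrite subr_gt0; move: dab; rewrite in_itv => /andP[].
  - by near: r; exact: lebesgue_pt_near.
  - by near: r; exact: lebesgue_pt_near.
move=> /filter_ex[r [r0 crb drb cr dr]].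
have [tchi dchi] := test_function_bump r0 cab dab crb drb.
have := hchi _ tchi; rewrite dchi => /eqP.
have -> : \int[leb]_(x in `]a, b[) (h x * (bump c r x - bump d r x)) =
    \int[leb]_x (h0 x * bump c r x) - \int[leb]_x (h0 x * bump d r x).
  rewrite -RintegralB//; [|exact: integrable_mul_bump|exact: integrable_mul_bump].
  rewrite Rintegral_mkcond; apply: eq_Rintegral => x _.
  by rewrite -mulrBr /h0 !patchE; case: ifP => // _; rewrite mul0r.
rewrite subr_eq0 => /eqP hE.
have bd : 0 < e -> forall u, (davg h0 u r < e%:E)%E ->
    `|\int[leb]_x (h0 x * bump u r x) - h0 u| < 4 * e.
  move=> _ u ur; rewrite -lte_fin; apply: (le_lt_trans (bump_mean u r0 ih0)).
  by rewrite EFinM lte_pmul2l// lte_fin.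
have := bd e0 c cr; have := bd e0 d dr; rewrite hE !h0E//.
set A := \int[leb]_x _ => hd hc.
have : `|h d - h c| < 8 * e.
  have -> : h d - h c = (A - h c) - (A - h d) by ring.
  apply: (le_lt_trans (ler_normB _ _)); lra.
by rewrite /e mulrC mulfVK// ltxx.
Unshelve. all: by end_near. Qed.

Lemma continuous_ae_eq a b F G : a < b ->
  {within `[a, b], continuous F} -> {within `[a, b], continuous G} ->
  {ae leb, forall x, x \in `]a, b[ -> F x = G x} ->
  forall x, x \in `[a, b] -> F x = G x.
Proof.
move=> ab cF cG FG x xab; apply: contrapT => ne.
pose D y := F y - G y.
have cD : {within `[a, b], continuous D}.
  by move=> y; apply: cvgB; [exact: cF|exact: cG].
have Dx : 0 < `|D x| by rewrite normr_gt0 subr_eq0; apply/eqP.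
have /subspace_continuousP/(_ x xab) := cD.
move=> /cvgrPdist_lt/(_ _ Dx)/nbhs_ballP[/= e e0 xe].
move: (xab); rewrite in_itv /= => /andP[ax xb].
have lu : Num.max a (x - e) < Num.min b (x + e).
  rewrite gt_max !lt_min ab /=; apply/andP; split; first lra.
  by apply/andP; split; lra.
have [y yi yE] := ae_ex_itv lu FG.
move: yi; rewrite in_itv /= gt_max lt_min => /andP[/andP[ay xey] /andP[yb yxe]].
have yab : y \in `]a, b[ by rewrite in_itv /= ay yb.
have := xe y; rewrite /from_subspace /ball /= ltr_norml.
have -> : D y = 0 by rewrite /D yE// subrr.
rewrite subr0 ltxx => h; suff : false by []; apply: h; first by lra.
by rewrite in_itv /= !ltW.
Qed.

(** Two continuous representatives agree on the closed interval, so the one picked by [xget] can be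
    computed from any other, end point values included. *)
Lemma cont_reprE a b F G : a < b -> {within `[a, b], continuous G} ->
  {ae leb, forall x, x \in `]a, b[ -> F x = G x} ->
  forall x, x \in `[a, b] -> cont_repr a b F x = G x.
Proof.
move=> ab cG FG; have [cH FH] : [set H | {within `[a, b], continuous H} /\
    {ae leb, forall x, x \in `]a, b[ -> F x = H x}] (cont_repr a b F).
  by apply: (@xgetPex _ (cst 0)); exists G.
apply: (continuous_ae_eq ab cH cG).
by apply: ae_mono2 FG FH => x h1 h2 xab; rewrite -h1// -h2.
Qed.

Definition primitive a g x : R := \int[leb]_(t in `]a, x[) g t.

Lemma primitiveE a b g x : leb.-integrable `]a, b[ (EFin \o g) -> x \in `[a, b] ->
  primitive a g x = parameterized_integral leb a x (g \_ `]a, b[).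
Proof.
move=> ig; rewrite in_itv /= => /andP[ax xb]; rewrite /primitive /parameterized_integral.
have ig0 : leb.-integrable setT (EFin \o (g \_ `]a, b[)).
  by rewrite -restrict_EFin; apply/integrable_restrict => //; rewrite setTI.
have mg0 : measurable_fun setT (EFin \o (g \_ `]a, b[)) by exact: (measurable_int _ ig0).
rewrite /Rintegral [in RHS](integral_itv_bndoo (f := EFin \o (g \_ `]a, b[))); last first.
  exact: measurable_funTS.
congr fine; apply: eq_integral => t; rewrite inE /= in_itv /= => /andP[at_ tx].
by rewrite patchE mem_setE in_itv /= at_ (lt_le_trans tx xb).
Qed.

Lemma continuous_primitive a b g : a < b -> leb.-integrable `]a, b[ (EFin \o g) ->
  {within `[a, b], continuous (primitive a g)}.
Proof.
move=> ab ig.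
have ig0 : leb.-integrable `[a, b] (EFin \o (g \_ `]a, b[)).
  apply: (@integrableS _ _ _ _ setT) => //.
  by rewrite -restrict_EFin; apply/integrable_restrict => //; rewrite setTI.
have c := parameterized_integral_continuous (ltW ab) ig0.
apply/subspace_continuousP => x xab.
rewrite /from_subspace (primitiveE ig xab); have /subspace_continuousP/(_ x xab) := c.
apply: cvg_trans; apply: near_eq_cvg; near=> y.
have yab : y \in `[a, b] by near: y; exact: withinT.
by rewrite (primitiveE ig yab).
Unshelve. all: by end_near. Qed.

Lemma measurable_primitive a b g : a < b -> leb.-integrable `]a, b[ (EFin \o g) ->
  measurable_fun `]a, b[ (primitive a g).
Proof.
move=> ab ig; apply: (@measurable_funS _ _ _ _ `[a, b]) => //.
  by move=> x /=; exact: subset_itv_oo_cc.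
apply: subspace_continuous_measurable_fun => //; exact: continuous_primitive.
Qed.

Lemma integrable_itvB a b F G : leb.-integrable `]a, b[ (EFin \o F) ->
  leb.-integrable `]a, b[ (EFin \o G) ->
  leb.-integrable `]a, b[ (EFin \o (fun x => F x - G x)).
Proof.
move=> iF iG; rewrite (_ : EFin \o _ = ((EFin \o F) \- (EFin \o G))%E)//.
by apply: integrableB.
Qed.

(** [F] minus the primitive of [g] has weak derivative 0, so [wderiv0_const] applies. *)
Lemma is_wderivP a b F g : a < b -> is_wderiv a b F g ->
  exists c, {ae leb, forall x, x \in `]a, b[ -> F x = c + primitive a g x}.
Proof.
move=> ab [iF ig FG].
have [iP _ PG] : is_wderiv a b (primitive a g) g.
  apply: (@wderiv_primitive _ _ _ _ _ 0) => //; first exact: measurable_primitive.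
  by apply: ae_all => x _; rewrite add0r.
have iFP : leb.-integrable `]a, b[ (EFin \o (fun x => F x - primitive a g x)).
  exact: integrable_itvB.
have [|c cP] := wderiv0_const ab iFP; last first.
  exists c; apply: ae_mono cP => x h xab; rewrite -h//; ring.
move=> chi tc; have [M chiM] := test_function_bounded tc.
have [dchi cchi _] := tc.
have mchi : measurable_fun setT (derive1 chi) by exact: continuous_measurable_fun.
have M0 : 0 <= M by apply: le_trans (chiM 0).
have im h : leb.-integrable `]a, b[ (EFin \o h) ->
    leb.-integrable `]a, b[ (EFin \o (fun x => h x * derive1 chi x)).
  move=> ih; have iMh := @integrableZl _ _ _ leb _ (measurable_itv `]a, b[) M _ ih.
  apply: (@le_integrable _ _ _ leb _ (measurable_itv `]a, b[) _ _ _ _ iMh).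
    apply/measurable_EFinP; apply: measurable_funM; last exact: measurable_funTS.
    by apply/measurable_EFinP; exact: (measurable_int _ ih).
  move=> x _; rewrite /= lee_fin (normrM (h x)) (normrM M) (ger0_norm M0) mulrC.
  by rewrite ler_wpM2r.
have -> : \int[leb]_(x in `]a, b[) ((F x - primitive a g x) * derive1 chi x) =
  \int[leb]_(x in `]a, b[) (F x * derive1 chi x - primitive a g x * derive1 chi x).
  by apply: eq_Rintegral => x _; rewrite mulrBl.
by rewrite RintegralB ?FG ?PG ?subrr//; exact: im.
Qed.

(** At a Lebesgue point of [g] the primitive has derivative [g x]; being constant it has derivative
    0. *)
Lemma primitive_const a b g c : a < b -> leb.-integrable `]a, b[ (EFin \o g) ->
  {ae leb, forall x, x \in `]a, b[ -> primitive a g x = c} ->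
  {ae leb, forall x, x \in `]a, b[ -> g x = 0}.
Proof.
move=> ab ig gc.
have gcE x : x \in `[a, b] -> primitive a g x = c.
  apply: (@continuous_ae_eq _ _ _ (cst c) ab (continuous_primitive ab ig)) => //.
  by apply: continuous_subspaceT => y; exact: cvg_cst.
pose g0 := g \_ `]a, b[.
have ig0 : leb.-integrable setT (EFin \o g0).
  by rewrite /g0 -restrict_EFin; apply/integrable_restrict => //; rewrite setTI.
have lebP : {ae leb, forall x, lebesgue_pt g0 x}.
  by apply: lebesgue_differentiation; exact: open_integrable_locally openT ig0.
apply: ae_mono lebP => x lx xab; move: (xab); rewrite in_itv /= => /andP[ax xb].
have igb : leb.-integrable [set` Interval (BLeft a) (BRight b)] (EFin \o g0).
  exact: integrableS ig0.
have ax' : (a%:E < x%:E)%E by rewrite lte_fin.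
have [_ dF] := FTC1_lebesgue_pt xb igb ax' lx.
have <- : g0 x = g x by rewrite /g0 patchE mem_setE xab.
rewrite -dF derive1E; apply: derive_val.
have cst0 : is_derive x (1 : R) (cst c) 0 by exact: is_derive_cst.
apply: near_eq_is_derive cst0; near=> y.
have yab : y \in `[a, b].
  rewrite in_itv /=; apply/andP; split; apply/ltW; near: y.
    exact: lt_nbhsr.
  exact: lt_nbhsl.
by rewrite -[LHS]/(c) -(gcE y yab) (primitiveE ig yab).
Unshelve. all: by end_near. Qed.

Lemma is_wderiv_unique a b F g g' : a < b -> is_wderiv a b F g -> is_wderiv a b F g' ->
  {ae leb, forall x, x \in `]a, b[ -> g x = g' x}.
Proof.
move=> ab wg wg'; have [_ ig _] := wg; have [_ ig' _] := wg'.
have [c cP] := is_wderivP ab wg; have [c' cP'] := is_wderivP ab wg'.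
have igg : leb.-integrable `]a, b[ (EFin \o (fun x => g x - g' x)).
  exact: integrable_itvB.
have : {ae leb, forall x, x \in `]a, b[ -> primitive a (fun x => g x - g' x) x = c' - c}.
  apply: ae_mono2 cP cP' => x h h' xab.
  have sub : `]a, x[ `<=` `]a, b[.
    move=> y; move: xab; rewrite /= !in_itv /= => /andP[_ xb] /andP[-> yx].
    exact: lt_trans yx xb.
  have := h xab; rewrite h'// /primitive RintegralB//; last 2 first.
  - exact: integrableS ig.
  - exact: integrableS ig'.
  move=> E; set u := \int[leb]_(_ in _) _ in E *; set w := \int[leb]_(_ in _) _ in E *; lra.
move=> /(primitive_const ab igg); apply: ae_mono => x h xab.
by apply/eqP; rewrite -subr_eq0 h.
Qed.

End Uniqueness.

(** * Inversion of fractional integrals *)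

Section KernelComposition.
Context d (T : measurableType d) (R : realType).
Context (m : {sigma_finite_measure set T -> \bar R}).
Implicit Types (k l : T -> T -> R) (f g w : T -> R).

Lemma Rintegral_ae f g : measurable_fun setT f -> measurable_fun setT g ->
  {ae m, forall x, f x = g x} -> \int[m]_x f x = \int[m]_x g x.
Proof.
move=> mf mg fg; rewrite /Rintegral; congr fine; apply: ae_eq_integral => //.
- exact/measurable_EFinP.
- exact/measurable_EFinP.
- by apply: filterS fg => x h _; rewrite h.
Qed.

(** The kernels are nonnegative, so integrating [k x t * l t r * |f r|] first in [t] gives
    [w r * |f r|]: integrability of [w * f] alone justifies Fubini. *)
Lemma kop_comp k l w f x :
  measurable_fun setT (fun z : T * T => k z.1 z.2) ->
  measurable_fun setT (fun z : T * T => l z.1 z.2) ->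
  (forall y s, 0 <= k y s) -> (forall y s, 0 <= l y s) ->
  measurable_fun setT f ->
  (forall r, (\int[m]_t (k x t * l t r)%:E = (w r)%:E)%E) ->
  m.-integrable setT (EFin \o (fun r => w r * f r)) ->
  kop m k (kop m l f) x = \int[m]_r (w r * f r).
Proof.
move=> mk ml k0 l0 mf wE iw.
have w0 r : 0 <= w r.
  by rewrite -lee_fin -wE; apply: integral_ge0 => t _; rewrite lee_fin mulr_ge0.
have mkx : measurable_fun setT (k x) by exact: (measurable_pair1 x mk).
have mlr r : measurable_fun setT (fun t => l t r) by exact: (measurable_pair2 r ml).
pose Phi (z : T * T) := k x z.1 * (l z.1 z.2 * f z.2).
have mPhi : measurable_fun setT Phi.
  apply: measurable_funM; first exact: (measurableT_comp mkx measurable_fst).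
  by apply: measurable_funM => //; exact: (measurableT_comp mf measurable_snd).
have iPhi : (m \x m)%E.-integrable setT (EFin \o Phi).
  apply/integrable21ltyP; first exact/measurable_EFinP.
  have /integrableP[_] := iw; apply: le_lt_trans.
  rewrite le_eqVlt; apply/orP; left; apply/eqP; apply: eq_integral => r _.
  transitivity (\int[m]_t (`|f r|%:E * (k x t * l t r)%:E))%E.
    apply: eq_integral => t _; rewrite /= -EFinM /Phi /= mulrA normrM.
    by rewrite [`|k x t * l t r|]ger0_norm ?mulr_ge0// mulrC.
  rewrite ge0_integralZl_EFin//=.
  - by rewrite wE -EFinM normrM (ger0_norm (w0 r)) mulrC.
  - by move=> t _; rewrite lee_fin mulr_ge0.
  - by apply/measurable_EFinP; exact: measurable_funM.
transitivity (\int[m]_t \int[m]_r Phi (t, r)).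
  rewrite /kop; apply: Rintegral_ae.
  - by apply: measurable_funM => //; exact: measurable_kop.
  - exact: measurable_param_Rintegral.
  - apply: filterS (ae_integrable1 iPhi) => t it.
    rewrite -Rintegral_scale//.
    by apply: measurable_funM => //; exact: (measurable_pair1 t ml).
rewrite -(Rintegral_prod1 iPhi) (Rintegral_prod2 iPhi).
apply: eq_Rintegral => r _.
have ikl : m.-integrable setT (EFin \o (fun t => k x t * l t r)).
  apply/integrableP; split; first by apply/measurable_EFinP; exact: measurable_funM.
  under eq_integral do rewrite /= ger0_norm ?mulr_ge0//.
  by rewrite wE ltry.
transitivity (\int[m]_t (k x t * l t r * f r)).
  by apply: eq_Rintegral => t _; rewrite /Phi /= mulrA.
by rewrite RintegralZr// /Rintegral wE.
Qed.

End KernelComposition.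

(** * Composition and inversion of fractional integrals, left and right at once *)

Section FractionalInverse.
Context {R : realType}.
Implicit Types (a b s alpha x t r : R) (f g h u v : R -> R).

Lemma beta_const_sym s : beta_const (1 - s) = beta_const s.
Proof.
rewrite /beta_const; congr fine.
have m1 : measurable_fun setT (fun u : R => (beta_integrand s u)%:E).
  by apply/measurable_EFinP; exact: measurable_beta_integrand.
have b0 (y : R) : (0 <= (beta_integrand s y)%:E)%E by rewrite lee_fin beta_integrand_ge0.
pose F (y : R) := (beta_integrand s (1 * y + 1))%:E.
have mF : measurable_fun setT F.
  have -> : F = (fun u : R => (beta_integrand s u)%:E) \o (fun y : R => 1 * y + 1) by [].
  by apply: measurableT_comp => //; apply: measurable_funD.
have F0 (y : R) : (0 <= F y)%E by exact: b0.
have E1 := ge0_integral_affine 1 (@ltr01 R) m1 b0.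
have E2 := ge0_integral_reflect mF F0.
rewrite [RHS]E1 mul1e; apply: (etrans _ (esym E2)).
apply: eq_integral => x _; rewrite /F mul1r /beta_integrand; congr EFin.
have -> : (0 < - (x : R) + 1) && (- (x : R) + 1 < 1) = (0 < (x : R)) && ((x : R) < 1).
  by rewrite andbC addrC gtrDl oppr_lt0 subr_gt0.
case: ifP => // _; rewrite mulrC; congr (_ `^ _ * _ `^ _); ring.
Qed.

Lemma measurable_fkerT a b s :
  measurable_fun setT (fun z : R * R => fker a b s z.2 z.1).
Proof. exact: (measurable_fun_swap (measurable_fker a b s)). Qed.

Lemma fkerT_comp a b s x r : 0 < s < 1 ->
  (\int[leb]_t (fker a b (1 - s) t x * fker a b s r t)%:E =
   (if (a < x) && (x < r) && (r < b) then beta_const s else 0)%:E)%E.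
Proof.
move=> s01; have s01' : 0 < 1 - s < 1 by case/andP: s01 => s0 s1; lra.
have := fker_comp a b r x s01'; rewrite beta_const_sym subKr => <-.
by apply: eq_integral => t _; rewrite mulrC.
Qed.

(** Chosen so that the composition of [(Gamma (1 - alpha))^-1 * K (1 - alpha)] with
    [cker alpha * K alpha] has kernel 1 on the triangle. At [alpha = 1] the first factor is replaced
    by the identity. *)
Definition cker alpha : R :=
  if alpha == 1 then 1 else Gamma (1 - alpha) / beta_const alpha.

Lemma cker_gt0 alpha : 0 < alpha -> alpha <= 1 -> 0 < cker alpha.
Proof.
move=> a0 a1; rewrite /cker; case: eqP => // /eqP n1.
have lt1 : alpha < 1 by rewrite lt_neqAle n1.
by rewrite divr_gt0 ?Gamma_gt0 ?beta_const_gt0//; lra.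
Qed.

Lemma sqint_integrable_itv a b g : sqint leb g -> leb.-integrable `]a, b[ (EFin \o g).
Proof.
move=> sg; pose i : R -> R := (fun=> 1 : R) \_ `]a, b[.
have mi : measurable_fun setT i.
  by apply/(measurable_restrictT _ _).1 => //; exact: measurable_cst.
have si : sqint leb i.
  split => //; apply: (@le_lt_trans _ _ (\int[leb]_(x in `]a, b[) 1%:E)%E); last exact: integral_cst_itv_lty.
  rewrite [leRHS]integral_mkcond le_eqVlt; apply/orP; left; apply/eqP.
  apply: eq_integral => x _; rewrite /i !patchE; case: ifP => _; first by rewrite expr1n.
  by rewrite expr0n.
have := sqint_integrable_mul sg si.
have -> : (fun x => g x * i x) = g \_ `]a, b[.
  by apply/funext => x; rewrite /i !patchE; case: ifP => _; rewrite ?mulr1 ?mulr0.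
by rewrite -restrict_EFin => /integrable_restrict; rewrite setTI; apply.
Qed.

(* What the left and the right fractional calculus on (a, b) have in common:
   K s is the kernel of Gamma s * I^s and i x the interval over which the
   fractional integrals at x are taken. *)
Record fractional_side a b (K : R -> R -> R -> R) (i : R -> interval R)
    (I : R -> (R -> R) -> R -> R) : Prop := FractionalSide {
  fs_lt : a < b;
  fs_sub : forall x t, x \in `]a, b[ -> t \in i x -> t \in `]a, b[;
  fs_schur : forall s, 0 < s -> exists C, schur leb (K s) C;
  fs_out : forall s x t, ~~ ((x \in `]a, b[) && (t \in i x)) -> K s x t = 0;
  fs_one : forall x t, x \in `]a, b[ -> t \in i x -> K 1 x t = 1;
  fs_comp : forall s x r, 0 < s < 1 ->
    (\int[leb]_t (K (1 - s) x t * K s t r)%:E =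
     (if (x \in `]a, b[) && (r \in i x) then beta_const s else 0)%:E)%E;
  fs_int : forall s u x, x \in `]a, b[ -> s != 0 ->
    I s u x = (Gamma s)^-1 * kop leb (K s) (u \_ `]a, b[) x;
  fs_int0 : forall u x, I 0 u x = u x;
  fs_inj : forall h, leb.-integrable `]a, b[ (EFin \o h) ->
    {ae leb, forall x, x \in `]a, b[ -> \int[leb]_(t in [set` i x]) h t = 0} ->
    {ae leb, forall x, x \in `]a, b[ -> h x = 0} }.

Section OneSide.
Variables (a b : R) (K : R -> R -> R -> R) (i : R -> interval R).
Variables (I : R -> (R -> R) -> R -> R) (fs : fractional_side a b K i I).

Let mK s : 0 < s -> measurable_fun setT (fun z : R * R => K s z.1 z.2).
Proof. by move=> s0; have [C []] := fs_schur fs s0. Qed.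

Let K0 s x t : 0 < s -> 0 <= K s x t.
Proof. by move=> s0; have [C []] := fs_schur fs s0. Qed.

Lemma kop_side_out s c f x : x \notin `]a, b[ ->
  kop leb (fun x t => c * K s x t) f x = 0.
Proof.
move=> xab; rewrite /kop /Rintegral (eq_integral (cst 0%E)) ?integral0//= => t _.
by rewrite (fs_out fs) ?mulr0 ?mul0r// (negbTE xab).
Qed.

Lemma kop_side_eq s c f g x : 0 < s -> measurable_fun setT f -> measurable_fun setT g ->
  {ae leb, forall t, t \in `]a, b[ -> f t = g t} ->
  kop leb (fun x t => c * K s x t) f x = kop leb (fun x t => c * K s x t) g x.
Proof.
move=> s0 mf mg fg; have mKx := measurable_pair1 x (mK s0).
apply: Rintegral_ae.
- by apply: measurable_funM => //; apply: measurable_funM.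
- by apply: measurable_funM => //; apply: measurable_funM.
apply: ae_mono fg => t h; have [tab|tab] := boolP (t \in `]a, b[); first by rewrite h.
rewrite (fs_out fs) ?mulr0 ?mul0r//; apply: contra tab => /andP[xab tx].
exact: (@fs_sub _ _ _ _ _ fs x).
Qed.

Lemma schur_side alpha : 0 < alpha -> alpha <= 1 ->
  exists C, schur leb (fun x t => cker alpha * K alpha x t) C.
Proof.
move=> a0 a1; have [C [mk k0 C0 row col]] := fs_schur fs a0.
have c0 := cker_gt0 a0 a1.
exists (cker alpha * C); split.
- by apply: measurable_funM.
- by move=> x t; rewrite mulr_ge0// ltW.
- exact: mulr_gt0.
- move=> x; under eq_integral do rewrite EFinM.
  rewrite ge0_integralZl_EFin//= ?(ltW c0)//.
  + by rewrite EFinM lee_wpmul2l// lee_fin ltW.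
  + by move=> t _; rewrite lee_fin.
  + by apply/measurable_EFinP; exact: (measurable_pair1 x mk).
- move=> t; under eq_integral do rewrite EFinM.
  rewrite ge0_integralZl_EFin//= ?(ltW c0)//.
  + by rewrite EFinM lee_wpmul2l// lee_fin ltW.
  + by move=> x _; rewrite lee_fin.
  + by apply/measurable_EFinP; exact: (measurable_pair2 t mk).
Qed.

Lemma kop_side_comp s c g x : 0 < s < 1 -> 0 <= c -> sqint leb g -> x \in `]a, b[ ->
  kop leb (K (1 - s)) (kop leb (fun x t => c * K s x t) g) x =
  c * beta_const s * \int[leb]_(t in [set` i x]) g t.
Proof.
move=> /andP[s0 s1] c0 sg xab; have [mg _] := sg.
have s0' : 0 < 1 - s by rewrite subr_gt0.
have igx : leb.-integrable [set` i x] (EFin \o g).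
  apply: (integrableS _ _ _ (sqint_integrable_itv a b sg)) => //.
  by move=> t /=; exact: (@fs_sub _ _ _ _ _ fs x).
pose w r := if r \in i x then c * beta_const s else 0.
have wg : (fun r => w r * g r) = (fun r => c * beta_const s * (g \_ [set` i x]) r).
  apply/funext => r; rewrite /w patchE mem_setE; case: ifP => // _.
  by rewrite mul0r mulr0.
have igx0 : leb.-integrable setT (EFin \o (g \_ [set` i x])).
  by rewrite -restrict_EFin; apply/integrable_restrict => //; rewrite setTI.
rewrite (@kop_comp _ _ _ leb _ _ w); last first.
- by rewrite wg; exact: (integrableZl measurableT (c * beta_const s) igx0).
- move=> r; have mKx := measurable_pair1 x (mK s0').
  have mKr := measurable_pair2 r (mK s0).
  under eq_integral do rewrite mulrCA EFinM.
  rewrite ge0_integralZl_EFin//=.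
  + rewrite (fs_comp fs) ?s0// xab /= /w -EFinM; case: ifP => // _.
    by rewrite mulr0.
  + by move=> t _; rewrite lee_fin mulr_ge0// K0.
  + by apply/measurable_EFinP; exact: measurable_funM.
- exact: mg.
- by move=> y t; rewrite mulr_ge0// K0.
- by move=> y t; exact: K0.
- by apply: measurable_funM => //; exact: mK.
- exact: mK.
by rewrite wg RintegralZl// -Rintegral_mkcond.
Qed.

(** The identity [I^(1 - alpha) I^alpha = I^1]. A kernel operator does not see null sets, so [u] may
    be given almost everywhere; at [alpha = 1], where [I^0] is pointwise, the conclusion keeps the
    exceptional set of [u]. *)
Lemma frac_int_side alpha g u : 0 < alpha -> alpha <= 1 -> sqint leb g ->
  measurable_fun `]a, b[ u ->
  {ae leb, forall x, x \in `]a, b[ ->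
     u x = kop leb (fun x t => cker alpha * K alpha x t) g x} ->
  {ae leb, forall x, x \in `]a, b[ ->
     I (1 - alpha) u x = \int[leb]_(t in [set` i x]) g t}.
Proof.
move=> a0 a1 sg mu uE; have [mg _] := sg.
have [aE|an] := eqVneq alpha 1.
  apply: ae_mono uE => x h xab; rewrite aE subrr (fs_int0 fs) h// /cker aE eqxx.
  rewrite /kop [RHS]Rintegral_mkcond; apply: eq_Rintegral => t _.
  rewrite patchE mem_setE; case: ifPn => ti; first by rewrite (fs_one fs)// !mul1r.
  by rewrite (fs_out fs) ?mulr0 ?mul0r// negb_and ti orbT.
have lt1 : alpha < 1 by rewrite lt_neqAle an.
have a1' : 0 < 1 - alpha by rewrite subr_gt0.
have c0 := cker_gt0 a0 a1; have [C sC] := schur_side a0 a1.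
apply: ae_all => x xab; rewrite (fs_int fs)//; last by rewrite gt_eqF.
have m1 : measurable_fun setT (u \_ `]a, b[) by exact/(measurable_restrictT _ _).1.
have [m2 _] := kop_sqint sC sg.
have := @kop_side_eq (1 - alpha) 1 _ _ x a1' m1 m2.
have one f : kop leb (fun x t => 1 * K (1 - alpha) x t) f = kop leb (K (1 - alpha)) f.
  by congr (kop leb _ f); apply/funext => y; apply/funext => t; rewrite mul1r.
rewrite !one => ->; last first.
  by apply: ae_mono uE => t h tab; rewrite patchE mem_setE tab h.
rewrite kop_side_comp ?a0// ?(ltW c0)// /cker (negbTE an) mulfVK; last first.
  by rewrite gt_eqF// beta_const_gt0// a0.
by rewrite mulKf// gt_eqF// Gamma_gt0// a1' /=; lra.
Qed.

(** Applying the operator of order [alpha] to the difference gives [I^alpha I^(1 - alpha) = I^1] up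
    to a nonzero factor, and functions with vanishing primitive vanish. *)
Lemma frac_int_side_inj alpha u v : 0 < alpha -> alpha <= 1 ->
  sqint leb (u \_ `]a, b[) -> sqint leb (v \_ `]a, b[) ->
  {ae leb, forall x, x \in `]a, b[ -> I (1 - alpha) u x = I (1 - alpha) v x} ->
  {ae leb, forall x, x \in `]a, b[ -> u x = v x}.
Proof.
move=> a0 a1 su sv uv; have [aE|an] := eqVneq alpha 1.
  by apply: ae_mono uv => x; rewrite aE subrr !(fs_int0 fs).
have lt1 : alpha < 1 by rewrite lt_neqAle an.
have a1' : 0 < 1 - alpha by rewrite subr_gt0.
pose h := (u \_ `]a, b[) \- (v \_ `]a, b[).
have sh : sqint leb h by exact: sqintB.
have [mh _] := sh; have [C sC] := fs_schur fs a1'.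
have G0 : (Gamma (1 - alpha))^-1 != 0.
  by rewrite invr_eq0 gt_eqF// Gamma_gt0// a1' /=; lra.
have z : {ae leb, forall x, kop leb (K (1 - alpha)) h x = 0}.
  apply: (ae_mono2 _ uv) (filterI (kop_integrable_ae sC su) (kop_integrable_ae sC sv)).
  move=> x uvx [iu iv]; have [xab|xab] := boolP (x \in `]a, b[); last first.
    have := kop_side_out (1 - alpha) 1 h xab; rewrite /kop.
    by under eq_Rintegral do rewrite mul1r.
  have := uvx xab; rewrite !(fs_int fs) ?gt_eqF// => /(mulfI G0) /eqP.
  rewrite -subr_eq0 => /eqP <-; rewrite /kop -RintegralB//.
  by apply: eq_Rintegral => t _; rewrite /h /= mulrBr.
have ih : leb.-integrable `]a, b[ (EFin \o h) by exact: sqint_integrable_itv.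
have : {ae leb, forall x, x \in `]a, b[ -> h x = 0}.
  apply: (fs_inj fs ih); apply: ae_all => x xab.
  have := @kop_side_comp (1 - alpha) 1 h x _ ler01 sh xab.
  rewrite subKr a1' ltrBlDr ltrDl a0 => /(_ isT) e.
  have b0 : 1 * beta_const (1 - alpha) != 0.
    by rewrite mul1r gt_eqF// beta_const_gt0// a1' ltrBlDr ltrDl a0.
  apply: (mulfI b0); rewrite mulr0 -e.
  have one : kop leb (fun x t => 1 * K (1 - alpha) x t) h = kop leb (K (1 - alpha)) h.
    by congr (kop leb _ h); apply/funext => y; apply/funext => t; rewrite mul1r.
  rewrite one /kop; have [mz _] := kop_sqint sC sh.
  rewrite (Rintegral_ae (g := cst 0)) ?Rintegral_cst ?mul0r//.
    by apply: measurable_funM => //; exact: (measurable_pair1 x (mK a0)).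
  by apply: ae_mono z => t; rewrite /kop => ->; rewrite mulr0.
apply: ae_mono => x hx xab; apply/eqP; rewrite -subr_eq0; apply/eqP.
by have := hx xab; rewrite /h /= !patchE mem_setE xab.
Qed.

(** Applying [I^(1 - alpha)] turns the hypothesis into the vanishing of the integrals of [g] over
    the intervals [i x]. *)
Lemma kop_side_inj alpha g : 0 < alpha -> alpha <= 1 -> sqint leb g ->
  {ae leb, forall x, x \in `]a, b[ ->
     kop leb (fun x t => cker alpha * K alpha x t) g x = 0} ->
  {ae leb, forall x, x \in `]a, b[ -> g x = 0}.
Proof.
move=> a0 a1 sg gz; have m0 : measurable_fun `]a, b[ (cst (0 : R)) by exact: measurable_cst.
apply: (fs_inj fs (sqint_integrable_itv a b sg)).
have := @frac_int_side alpha g (cst 0) a0 a1 sg m0.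
have h0 : {ae leb, forall x, x \in `]a, b[ -> cst 0 x =
    kop leb (fun x t => cker alpha * K alpha x t) g x}.
  by apply: ae_mono gz => x h xab; rewrite h.
move=> /(_ h0); apply: ae_mono => x h xab; rewrite -h//.
have [aE|an] := eqVneq alpha 1; first by rewrite aE subrr (fs_int0 fs).
rewrite (fs_int fs)//; last by rewrite subr_eq0 eq_sym.
rewrite /kop /Rintegral (eq_integral (cst 0%E)) ?integral0 ?mulr0//= => t _.
by rewrite patchE; case: ifP; rewrite mulr0.
Qed.

End OneSide.

End FractionalInverse.

(** * The domain of the form and the graph of A *)

Lemma ipBl d (T : measurableType d) (R : realType)
    (mu : {measure set T -> \bar R}) (f g h : T -> R) :
  sqint mu f -> sqint mu g -> sqint mu h ->
  ip mu (f \- g) h = ip mu f h - ip mu g h.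
Proof.
move=> sf sg sh; have -> : f \- g = f \+ (-1 \*o g).
  by apply/funext => x /=; rewrite mulN1r.
rewrite ipDl//; last exact: sqintZ.
by rewrite ipZl// mulN1r.
Qed.

(** * The two sides of an interval and the form domain as the range of J *)

Section Sides.
Context {R : realType}.
Implicit Types (a b s alpha x t r : R) (f g h u v w : R -> R).

Lemma fractional_side_left a b : a < b ->
  fractional_side a b (fker a b) (fun x => `]a, x[) (frac_int_left a).
Proof.
move=> ab; split => //.
- move=> x t; rewrite !in_itv /= => /andP[ax xb] /andP[-> tx].
  exact: lt_trans tx xb.
- by move=> s s0; exists ((b - a) `^ s / s); exact: schur_fker.
- move=> s x t; rewrite !in_itv /= /fker; case: ifP => // /andP[/andP[at_ tx] xb].
  by rewrite at_ tx xb (lt_trans at_ tx).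
- move=> x t; rewrite !in_itv /= /fker => /andP[ax ->] /andP[-> ->] /=.
  by rewrite subrr powRr0.
- move=> s x r s01; rewrite fker_comp// !in_itv /=; congr EFin; congr (if _ then _ else _).
  apply/idP/idP.
    by move=> /andP[/andP[ar rx] ->]; rewrite ar rx (lt_trans ar rx).
  by move=> /andP[/andP[_ ->] /andP[-> ->]].
- move=> s u x; rewrite in_itv /= => /andP[ax xb] sn; rewrite /frac_int_left (negbTE sn).
  congr (_ * _); rewrite /kop [LHS]Rintegral_mkcond; apply: eq_Rintegral => t _.
  rewrite !patchE !mem_setE !in_itv /= /fker xb andbT.
  case: ifP => [/andP[at_ tx]|_]; last by rewrite mul0r.
  by rewrite at_ (lt_trans tx xb).
- by move=> u x; rewrite /frac_int_left eqxx.
- by move=> h ih; exact: primitive_const.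
Qed.

Lemma fractional_side_right a b : a < b ->
  fractional_side a b (fun s x t => fker a b s t x) (fun x => `]x, b[) (frac_int_right b).
Proof.
move=> ab; split => //.
- move=> x t; rewrite !in_itv /= => /andP[ax xb] /andP[xt ->].
  by rewrite (lt_trans ax xt).
- by move=> s s0; exists ((b - a) `^ s / s); apply: schur_transpose; exact: schur_fker.
- move=> s x t; rewrite !in_itv /= /fker; case: ifP => // /andP[/andP[ax xt] tb].
  by rewrite ax xt tb (lt_trans xt tb).
- move=> x t; rewrite !in_itv /= /fker => /andP[-> xb] /andP[-> ->] /=.
  by rewrite subrr powRr0.
- move=> s x r s01; rewrite fkerT_comp// !in_itv /=; congr EFin; congr (if _ then _ else _).
  apply/idP/idP.
    by move=> /andP[/andP[-> xr] rb]; rewrite xr rb (lt_trans xr rb).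
  by move=> /andP[/andP[-> _] /andP[-> ->]].
- move=> s u x; rewrite in_itv /= => /andP[ax xb] sn; rewrite /frac_int_right (negbTE sn).
  congr (_ * _); rewrite /kop [LHS]Rintegral_mkcond; apply: eq_Rintegral => t _.
  rewrite !patchE !mem_setE !in_itv /= /fker ax /=.
  case: ifP => [/andP[xt tb]|_]; last by rewrite mul0r.
  by rewrite tb (lt_trans ax xt).
- by move=> u x; rewrite /frac_int_right eqxx.
(* If the integrals up to [b] vanish, those from [a] are constant, equal to the integral over []a,
   b[]. *)
- move=> h ih hz; apply: (@primitive_const _ a b h (\int[leb]_(t in `]a, b[) h t)) => //.
  apply: ae_mono hz => x hx xab; have := hx xab.
  move: xab; rewrite in_itv /= => /andP[ax xb].
  have igx : leb.-integrable `]a, x[ (EFin \o h).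
    apply: (integrableS _ _ _ ih) => //; move=> t /=; rewrite !in_itv /= => /andP[-> tx].
    exact: lt_trans tx xb.
  have ax' : (BRight a <= BRight x)%O by rewrite bnd_simp ltW.
  have xb' : (BRight x <= BLeft b)%O by rewrite bnd_simp.
  rewrite -(@Rintegral_itvB _ h (BRight a) (BLeft b) x)// -Rintegral_itv_bndo_bndc// => /eqP; rewrite subr_eq0 => /eqP ->.
  by [].
Qed.

Lemma inLp2P a b u : inLp leb 2%:E `]a, b[ u <-> sqint leb (u \_ `]a, b[).
Proof. by rewrite /inLp; exact: Lfun2P. Qed.

Lemma measurable_restrict_itv a b u : measurable_fun setT (u \_ `]a, b[) ->
  measurable_fun `]a, b[ u.
Proof. by move=> h; apply/(measurable_restrictT _ _).2. Qed.

Lemma Rintegral_itv_ae a b f g : measurable_fun `]a, b[ f -> measurable_fun setT g ->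
  {ae leb, forall x, x \in `]a, b[ -> f x = g x} ->
  (forall x, x \notin `]a, b[ -> g x = 0) ->
  \int[leb]_(x in `]a, b[) f x = \int[leb]_x g x.
Proof.
move=> mf mg fg g0; rewrite Rintegral_mkcond; apply: Rintegral_ae => //.
  exact/(measurable_restrictT _ _).1.
apply: ae_mono fg => x h; rewrite patchE mem_setE; case: ifPn => xab; first exact: h.
by rewrite g0.
Qed.

Lemma sqint_restrict a b f : sqint leb f -> sqint leb (f \_ `]a, b[).
Proof.
move=> sf; have [mf _] := sf; apply: (sqint_le _ sf) => //.
  by apply/(measurable_restrictT _ _).1 => //; exact: measurable_funTS.
by move=> x; rewrite patchE; case: ifP => // _; rewrite normr0.
Qed.

Lemma measurable_frac_int_left a b alpha u : a < b -> 0 < alpha -> alpha <= 1 ->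
  measurable_fun `]a, b[ u -> measurable_fun `]a, b[ (frac_int_left a (1 - alpha) u).
Proof.
move=> ab a0 a1 mu; have [->|an] := eqVneq alpha 1.
  by apply: (eq_measurable_fun u) => // x _; rewrite subrr /frac_int_left eqxx.
have a1' : 0 < 1 - alpha by rewrite subr_gt0 lt_neqAle an.
have mu0 : measurable_fun setT (u \_ `]a, b[) by exact/(measurable_restrictT _ _).1.
have mk : measurable_fun setT (kop leb (fker a b (1 - alpha)) (u \_ `]a, b[)).
  by apply: measurable_kop => //; exact: measurable_fker.
apply: (eq_measurable_fun (fun x : R => (Gamma (1 - alpha))^-1 *
    kop leb (fker a b (1 - alpha)) (u \_ `]a, b[) x)).
  move=> x xab; rewrite (fs_int (fractional_side_left ab)) ?gt_eqF//.
  by move: xab; rewrite inE.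
by apply: measurable_funTS; apply: measurable_funM.
Qed.

Lemma measurable_frac_int_right a b alpha u : a < b -> 0 < alpha -> alpha <= 1 ->
  measurable_fun `]a, b[ u -> measurable_fun `]a, b[ (frac_int_right b (1 - alpha) u).
Proof.
move=> ab a0 a1 mu; have [->|an] := eqVneq alpha 1.
  by apply: (eq_measurable_fun u) => // x _; rewrite subrr /frac_int_right eqxx.
have a1' : 0 < 1 - alpha by rewrite subr_gt0 lt_neqAle an.
have mu0 : measurable_fun setT (u \_ `]a, b[) by exact/(measurable_restrictT _ _).1.
have mk : measurable_fun setT
    (kop leb (fun x t => fker a b (1 - alpha) t x) (u \_ `]a, b[)).
  by apply: measurable_kop => //; exact: measurable_fkerT.
apply: (eq_measurable_fun (fun x : R => (Gamma (1 - alpha))^-1 *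
    kop leb (fun x t => fker a b (1 - alpha) t x) (u \_ `]a, b[) x)).
  move=> x xab; rewrite (fs_int (fractional_side_right ab)) ?gt_eqF//.
  by move: xab; rewrite inE.
by apply: measurable_funTS; apply: measurable_funM.
Qed.

(* kop (jker a b alpha) is I_{a+}^alpha: the factor, whose value is
   1 / Gamma alpha, is given the form in which it is used. *)
Definition jker a b alpha x t : R := cker alpha * fker a b alpha x t.

Lemma schur_jker a b alpha : a < b -> 0 < alpha -> alpha <= 1 ->
  exists C, schur leb (jker a b alpha) C.
Proof. by move=> ab; exact: (schur_side (fractional_side_left ab)). Qed.

(** [I^(1 - alpha) u] is a constant plus the primitive of [g], and the trace condition at [a]
    removes the constant. This is also [I^(1 - alpha) (J g)], so injectivity gives [u = J g]; the
    trace at [b] is the full integral of [g]. *)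
Lemma dom_form_elim a b alpha u : a < b -> 0 < alpha -> alpha <= 1 ->
  dom_form a b alpha u ->
  [/\ sqint leb (u \_ `]a, b[), sqint leb (left_RL a b alpha u \_ `]a, b[),
    {ae leb, forall x, x \in `]a, b[ ->
      u x = kop leb (jker a b alpha) (left_RL a b alpha u \_ `]a, b[) x} &
    frac_trace a b alpha u b = \int[leb]_(x in `]a, b[) left_RL a b alpha u x].
Proof.
move=> ab a0 a1 [[/inLp2P su [g0 g0P] /inLp2P sg] tr0].
have fl := fractional_side_left ab.
set g := left_RL a b alpha u in sg *.
have gP : is_left_RL a b alpha u g.
  by apply: (@xgetPex _ (cst 0) [set g | is_left_RL a b alpha u g]); exists g0.
have [_ ig _] := gP; have [c cP] := is_wderivP ab gP.
have cG : {within `[a, b], continuous (fun x => c + primitive a g x)}.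
  have cp := continuous_primitive ab ig.
  by move=> x; apply: cvgD; [exact: cvg_cst|exact: cp].
have trE := cont_reprE ab cG cP.
have prima : primitive a g a = 0.
  by rewrite /primitive set_itv_ge ?Rintegral_set0// bnd_simp ltxx.
have c0 : c = 0.
  by move: tr0; rewrite /frac_trace trE ?prima ?addr0// in_itv /= lexx ltW.
split => //; last first.
  by rewrite /frac_trace trE ?c0 ?add0r// in_itv /= lexx ltW.
have [C sC] := schur_jker ab a0 a1.
have sJ := sqint_restrict a b (kop_sqint sC sg).
apply: (frac_int_side_inj fl a0 a1 su sJ).
have mJ : measurable_fun `]a, b[ (kop leb (jker a b alpha) (g \_ `]a, b[)).
  by have [mJ _] := kop_sqint sC sg; exact: measurable_funTS.
have h := frac_int_side fl a0 a1 sg mJ (ae_all leb (fun x _ => erefl)).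
apply: ae_mono2 cP h => x h1 h2 xab; rewrite h1// h2// c0 add0r /primitive.
apply: eq_Rintegral => t; rewrite inE /= in_itv /= patchE mem_setE in_itv /=.
move: xab; rewrite in_itv /= => /andP[ax xb] /andP[at_ tx].
by rewrite at_ (lt_trans tx xb).
Qed.

(** [g] is a weak derivative of [I^(1 - alpha) u], and the representative picked by [left_RL] agrees
    with it by uniqueness. The primitive vanishes at [a], which is the trace condition. *)
Lemma dom_form_intro a b alpha u g : a < b -> 0 < alpha -> alpha <= 1 ->
  sqint leb (u \_ `]a, b[) -> sqint leb g ->
  {ae leb, forall x, x \in `]a, b[ -> u x = kop leb (jker a b alpha) g x} ->
  dom_form a b alpha u /\
  {ae leb, forall x, x \in `]a, b[ -> left_RL a b alpha u x = g x}.
Proof.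
move=> ab a0 a1 su sg uE; have fl := fractional_side_left ab.
have mu : measurable_fun `]a, b[ u by have [m0 _] := su; exact: measurable_restrict_itv.
have ig := sqint_integrable_itv a b sg.
have h := frac_int_side fl a0 a1 sg mu uE.
have gP : is_left_RL a b alpha u g.
  apply: (@wderiv_primitive _ _ _ _ _ 0) => //; first exact: measurable_frac_int_left.
  by apply: ae_mono h => x hx xab; rewrite hx// add0r.
have lP : is_left_RL a b alpha u (left_RL a b alpha u).
  by apply: (@xgetPex _ (cst 0) [set g | is_left_RL a b alpha u g]); exists g.
have lg := is_wderiv_unique ab lP gP.
split => //; split; first split; first exact/inLp2P.
- by exists g.
- have [_ il _] := lP; have [mg _] := sqint_restrict a b sg.
  apply/inLp2P; apply: (sqint_ae _ _ (sqint_restrict a b sg)).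
    apply/(measurable_restrictT _ _).1 => //.
    by apply/measurable_EFinP; exact: (measurable_int _ il).
  apply: ae_mono lg => x hx; rewrite !patchE mem_setE; case: ifPn => // xab.
  by rewrite hx.
rewrite /frac_trace (cont_reprE ab (continuous_primitive ab ig) h) ?in_itv /= ?lexx ?ltW//.
by rewrite /primitive set_itv_ge ?Rintegral_set0// bnd_simp ltxx.
Qed.

Lemma sqint_bounded_mul_itv (M : R) f g : measurable_fun setT f ->
  (forall x, `|f x| <= M) -> sqint leb g -> sqint leb (fun x => f x * g x).
Proof. by move=> mf fM sg; exact: (@sqint_bounded_mul _ _ R leb M g f mf fM sg). Qed.

(** * The operator A as an integral equation *)

Section Graph.
Variables (a b alpha : R) (ab : a < b) (a0 : 0 < alpha) (a1 : alpha <= 1).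
Variables (beta q bt qt : R -> R) (M : R).
Hypotheses (mbeta : measurable_fun `]a, b[ beta) (mq : measurable_fun `]a, b[ q).
Hypotheses (mbt : measurable_fun setT bt) (mqt : measurable_fun setT qt).
Hypotheses (btM : forall x, `|bt x| <= M) (qtM : forall x, `|qt x| <= M).
Hypotheses (btE : {ae leb, forall x, x \in `]a, b[ -> beta x = bt x})
  (qtE : {ae leb, forall x, x \in `]a, b[ -> q x = qt x}).

Lemma energy_formE y z gy gz : sqint leb (y \_ `]a, b[) -> sqint leb (z \_ `]a, b[) ->
  sqint leb gy -> sqint leb gz -> (forall x, x \notin `]a, b[ -> gy x = 0) ->
  measurable_fun `]a, b[ (left_RL a b alpha y) ->
  measurable_fun `]a, b[ (left_RL a b alpha z) ->
  {ae leb, forall x, x \in `]a, b[ -> left_RL a b alpha y x = gy x} ->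
  {ae leb, forall x, x \in `]a, b[ -> left_RL a b alpha z x = gz x} ->
  energy_form a b alpha beta q y z =
    ip leb (fun x => bt x * gy x) gz +
    ip leb (fun x => qt x * (y \_ `]a, b[) x) (z \_ `]a, b[).
Proof.
move=> sy sz [mgy _] [mgz _] gy0 mly mlz lyE lzE; rewrite /energy_form /ip.
have [my0 _] := sy; have [mz0 _] := sz.
have my := measurable_restrict_itv my0; have mz := measurable_restrict_itv mz0.
move: (left_RL a b alpha y) (left_RL a b alpha z) mly mlz lyE lzE => ly lz mly mlz lyE lzE.
have m1 : measurable_fun `]a, b[ (fun x => beta x * ly x * lz x).
  by apply: measurable_funM => //; apply: measurable_funM.
have m2 : measurable_fun setT (fun x => bt x * gy x * gz x).
  by apply: measurable_funM => //; apply: measurable_funM.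
have m3 : measurable_fun `]a, b[ (fun x => q x * y x * z x).
  by apply: measurable_funM => //; apply: measurable_funM.
have m4 : measurable_fun setT (fun x => qt x * (y \_ `]a, b[) x * (z \_ `]a, b[) x).
  by apply: measurable_funM => //; apply: measurable_funM.
have lE : {ae leb, forall x, x \in `]a, b[ ->
    ly x = gy x /\ lz x = gz x}.
  by apply: ae_mono2 lyE lzE => x h1 h2 xab; rewrite h1// h2.
have e1 := @Rintegral_itv_ae a b _ _ m1 m2.
have e2 := @Rintegral_itv_ae a b _ _ m3 m4.
rewrite e1 ?e2 //.
- by apply: ae_mono qtE => x h xab; rewrite h// !patchE mem_setE xab.
- by move=> x xab; rewrite !patchE mem_setE (negbTE xab) !mulr0.
- by apply: ae_mono2 btE lE => x h h' xab; rewrite h//; have [-> ->] := h' xab.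
- by move=> x xab; rewrite gy0// mulr0 mul0r.
Qed.

(** The last equation is the integrated form of [A u = w], with the right fractional integral of
    [w - q u]. Its defect [r] satisfies [ip r r = 0]: test the variational identity with [J r],
    which lies in the form domain, and move [J] to the other side. *)
Lemma graphA_elim u w : graphA a b alpha beta q u w ->
  let g := (left_RL a b alpha u \_ `]a, b[) in
  [/\ sqint leb g, sqint leb (w \_ `]a, b[),
    {ae leb, forall x, x \in `]a, b[ -> u x = kop leb (jker a b alpha) g x},
    frac_trace a b alpha u b = \int[leb]_x g x &
    {ae leb, forall x, bt x * g x = kop leb (fun x t => jker a b alpha t x)
       (fun x => (w \_ `]a, b[) x - qt x * (u \_ `]a, b[) x) x}].
Proof.
move=> [du /inLp2P sw H] g; have [su sg uE trE] := dom_form_elim ab a0 a1 du.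
split => //; first by rewrite trE Rintegral_mkcond.
have [C sC] := schur_jker ab a0 a1; have sCt := schur_transpose sC.
have squ : sqint leb (fun x => qt x * (u \_ `]a, b[) x) by exact: sqint_bounded_mul_itv mqt qtM su.
have sbg : sqint leb (fun x => bt x * g x) by exact: sqint_bounded_mul_itv mbt btM sg.
pose p := (w \_ `]a, b[) \- (fun x => qt x * (u \_ `]a, b[) x).
have sp : sqint leb p by exact: sqintB.
pose r := (fun x => bt x * g x) \- kop leb (fun x t => jker a b alpha t x) p.
have sr : sqint leb r by apply: sqintB => //; exact: kop_sqint sCt sp.
suff : ip leb r r = 0.
  by move/(ip_eq0 sr); apply: ae_mono => x /eqP; rewrite subr_eq0 => /eqP.
have r0 x : x \notin `]a, b[ -> r x = 0.
  move=> xab; rewrite /r /= (kop_side_out (fractional_side_right ab))// subr0.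
  by rewrite /g patchE mem_setE (negbTE xab) mulr0.
have sJr : sqint leb (kop leb (jker a b alpha) r) by exact: kop_sqint sC sr.
have Jr0 : kop leb (jker a b alpha) r \_ `]a, b[ = kop leb (jker a b alpha) r.
  apply/funext => x; rewrite patchE mem_setE; case: ifPn => // xab.
  by rewrite (kop_side_out (fractional_side_left ab)).
have [dz lz] : dom_form a b alpha (kop leb (jker a b alpha) r) /\ _ :=
  dom_form_intro ab a0 a1 (sqint_restrict a b sJr) sr (ae_all leb (fun x _ => erefl)).
have [_ [mlz _] _ _] := dom_form_elim ab a0 a1 dz.
have [mlu _] := sg.
have g0 x : x \notin `]a, b[ -> g x = 0 by move=> xab; rewrite /g patchE mem_setE (negbTE xab).
have luE : {ae leb, forall x, x \in `]a, b[ -> left_RL a b alpha u x = g x}.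
  by apply: ae_all => x xab; rewrite /g patchE mem_setE xab.
have := H _ dz.
rewrite (energy_formE su (sqint_restrict a b sJr) sg sr g0 (measurable_restrict_itv mlu)
  (measurable_restrict_itv mlz) luE lz) Jr0.
have [mw _] := sw; have [mJr _] := sJr.
rewrite (@Rintegral_itv_ae _ _ _ (fun x => (w \_ `]a, b[) x * kop leb (jker a b alpha) r x)); last 4 first.
- by apply: measurable_funM; [exact: measurable_restrict_itv|exact: measurable_funTS].
- exact: measurable_funM.
- by apply: ae_all => x xab; rewrite patchE mem_setE xab.
- by move=> x xab; rewrite patchE mem_setE (negbTE xab) mul0r.
rewrite -/(ip leb (w \_ `]a, b[) _) => E.
have e1 : ip leb p (kop leb (jker a b alpha) r) =
    ip leb (kop leb (fun x t => jker a b alpha t x) p) r.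
  by rewrite ipC (kop_adjoint sC sr sp) ipC.
have e2 : ip leb p (kop leb (jker a b alpha) r) =
    ip leb (w \_ `]a, b[) (kop leb (jker a b alpha) r) -
    ip leb (fun x => qt x * (u \_ `]a, b[) x) (kop leb (jker a b alpha) r).
  exact: ipBl.
have e3 : ip leb r r = ip leb (fun x => bt x * g x) r -
    ip leb (kop leb (fun x t => jker a b alpha t x) p) r.
  exact: (ipBl sbg (kop_sqint sCt sp) sr).
by rewrite e3 -e1 e2 -E; ring.
Qed.

(** Every [z] of the form domain is [J gz]; pairing the integral equation with [gz] and transposing
    [J] gives the variational identity. *)
Lemma graphA_intro u w g : sqint leb (u \_ `]a, b[) -> sqint leb (w \_ `]a, b[) ->
  sqint leb g -> (forall x, x \notin `]a, b[ -> g x = 0) ->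
  {ae leb, forall x, x \in `]a, b[ -> u x = kop leb (jker a b alpha) g x} ->
  {ae leb, forall x, bt x * g x = kop leb (fun x t => jker a b alpha t x)
     (fun x => (w \_ `]a, b[) x - qt x * (u \_ `]a, b[) x) x} ->
  graphA a b alpha beta q u w.
Proof.
move=> su sw sg g0 uE gE; have [du lu] := dom_form_intro ab a0 a1 su sg uE.
split => //; first exact/inLp2P.
move=> z dz; have [sz sgz zE _] := dom_form_elim ab a0 a1 dz.
have [_ [mlu _] _ _] := dom_form_elim ab a0 a1 du.
have [C sC] := schur_jker ab a0 a1; have sCt := schur_transpose sC.
set gz := (left_RL a b alpha z \_ `]a, b[) in sgz zE *.
have lz : {ae leb, forall x, x \in `]a, b[ -> left_RL a b alpha z x = gz x}.
  by apply: ae_all => x xab; rewrite /gz patchE mem_setE xab.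
have [mgz _] := sgz.
rewrite (energy_formE su sz sg sgz g0 (measurable_restrict_itv mlu)
  (measurable_restrict_itv mgz) lu lz).
have squ : sqint leb (fun x => qt x * (u \_ `]a, b[) x) by exact: sqint_bounded_mul_itv mqt qtM su.
have sbg : sqint leb (fun x => bt x * g x) by exact: sqint_bounded_mul_itv mbt btM sg.
pose p := (w \_ `]a, b[) \- (fun x => qt x * (u \_ `]a, b[) x).
have sp : sqint leb p by exact: sqintB.
have sJz : sqint leb (kop leb (jker a b alpha) gz) by exact: kop_sqint sC sgz.
have sJp : sqint leb (kop leb (fun x t => jker a b alpha t x) p) by exact: kop_sqint sCt sp.
have [mbg _] := sbg; have [mJp _] := sJp; have [mJz _] := sJz.
have [mw _] := sw; have [mz _] := sz.
have zJ : {ae leb, forall x, (z \_ `]a, b[) x = kop leb (jker a b alpha) gz x}.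
  apply: ae_mono zE => x h; rewrite patchE mem_setE; case: ifPn => xab; first exact: h.
  by rewrite (kop_side_out (fractional_side_left ab)).
rewrite (ip_ae mbg mJp mgz mgz gE (ae_all leb (fun x => erefl))).
rewrite [X in X + _]ipC -(kop_adjoint sC sgz sp) ipC.
have [mqu _] := squ.
have [mp _] := sp.
rewrite -(ip_ae mp mp mz mJz (ae_all leb (fun x => erefl)) zJ).
rewrite ipBl// subrK.
rewrite (@Rintegral_itv_ae _ _ _ (fun x => (w \_ `]a, b[) x * (z \_ `]a, b[) x))//.
- by apply: measurable_funM; exact: measurable_restrict_itv.
- exact: measurable_funM.
- by apply: ae_all => x xab; rewrite !patchE mem_setE xab.
- by move=> x xab; rewrite patchE mem_setE (negbTE xab) mul0r.
Qed.

End Graph.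

End Sides.

(** * The backward problem in L^2(Q) *)

Section Cylinder.
Context {R : realType}.

Let V : lmodType R := (R * R -> R^o)%type.

Implicit Types (f g h : R * R -> R) (x t : R).

Lemma Rintegral_ae_ge0 d (X : measurableType d) (m : {measure set X -> \bar R})
    (g : X -> R) : measurable_fun setT g -> {ae m, forall y, 0 <= g y} ->
  0 <= \int[m]_y g y.
Proof.
move=> mg g0; have mg' : measurable_fun setT (fun y => Num.max 0 (g y)).
  by apply: measurable_maxr.
rewrite [leRHS](_ : _ = \int[m]_y Num.max 0 (g y)).
  by apply: Rintegral_ge0 => y _; rewrite le_max lexx.
rewrite /Rintegral; congr fine; apply: ae_eq_integral => //.
- exact/measurable_EFinP.
- exact/measurable_EFinP.
by apply: filterS g0 => y g0y _; rewrite max_r.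
Qed.

Lemma ip_mul_ge0 d (X : measurableType d) (m : {measure set X -> \bar R})
    (c f : X -> R) : (forall y, 0 <= c y) -> 0 <= ip m (fun y => c y * f y) f.
Proof.
by move=> c0; apply: Rintegral_ge0 => y _; rewrite -mulrA mulr_ge0// -expr2 sqr_ge0.
Qed.

Lemma ip_le d (X : measurableType d) (m : {measure set X -> \bar R}) (f g : X -> R) :
  sqint m f -> measurable_fun setT g -> (forall y, `|g y| <= `|f y|) ->
  ip m g g <= ip m f f.
Proof.
move=> sf mg gf; have sg := sqint_le mg sf gf; have [mf _] := sf.
rewrite -lee_fin !ip_sqE//; apply: ge0_le_integral => //.
- by move=> x _; rewrite lee_fin sqr_ge0.
- exact: measurable_sqE.
- exact: measurable_sqE.
move=> x _; rewrite lee_fin -(real_normK (num_real (g x))) -(real_normK (num_real (f x))).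
by rewrite lerXn2r ?nnegrE.
Qed.

Variables (T a b : R).

Definition inQ (z : R * R) : bool := (z.1 \in `]0, T[) && (z.2 \in `]a, b[).

Lemma domQE : domQ T a b = [set z | inQ z].
Proof.
apply/seteqP; split => z; rewrite /domQ /inQ /=.
  by move=> [-> ->].
by move=> /andP[].
Qed.

Lemma measurable_inQ : measurable_fun setT inQ.
Proof.
apply: measurable_and.
- have -> : (fun z : R * R => z.1 \in `]0, T[) = (fun z => (0 < z.1) && (z.1 < T)).
    by apply/funext => z; rewrite in_itv.
  by apply: measurable_and; apply: measurable_fun_ltr.
- have -> : (fun z : R * R => z.2 \in `]a, b[) = (fun z => (a < z.2) && (z.2 < b)).
    by apply/funext => z; rewrite in_itv.
  by apply: measurable_and; apply: measurable_fun_ltr.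
Qed.

Definition cutQ f z : R := if inQ z then f z else 0.

Lemma restrict_domQ f : f \_ (domQ T a b) = cutQ f.
Proof.
apply/funext => z; rewrite patchE domQE /cutQ; case: ifPn => h.
  by move: h; rewrite inE /= => ->.
by move: h; rewrite notin_setE /= => /negP/negbTE ->.
Qed.

Lemma measurable_cutQ f : measurable_fun setT f -> measurable_fun setT (cutQ f).
Proof. by move=> mf; apply: measurable_fun_ifT => //; exact: measurable_inQ. Qed.

Lemma cutQ_le f z : `|cutQ f z| <= `|f z|.
Proof. by rewrite /cutQ; case: ifP; rewrite // normr0. Qed.

(** L^2(Q) as functions on the plane that vanish off [Q], so that kernels and products are those of
    the whole plane. *)
Definition EQ : set V := [set f | sqint leb2 (f : R * R -> R) /\ forall z, ~~ inQ z -> f z = 0].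

Definition ipQ (f g : V) : R := ip leb2 (f : R * R -> R) (g : R * R -> R).

Lemma EQ_sqint f : EQ f -> sqint leb2 f. Proof. by case. Qed.

Lemma EQ_out f z : EQ f -> ~~ inQ z -> f z = 0. Proof. by case=> _; apply. Qed.

Lemma EQ_cutQ f : sqint leb2 f -> EQ (cutQ f).
Proof.
move=> sf; split; last by move=> z /negbTE zQ; rewrite /cutQ zQ.
have [mf _] := sf; apply: sqint_le sf _; last exact: cutQ_le.
exact: measurable_cutQ.
Qed.

Lemma EQ_semihilbert : semihilbert EQ ipQ.
Proof.
split.
- move=> c f g [sf f0] [sg g0]; split.
    exact: (sqintD (sqintZ c sf) sg).
  move=> z zQ; rewrite -[LHS]/(c * f z + g z) f0// g0// mulr0 addr0//.
- move=> c f g h [sf _] [sg _] [sh _].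
  by rewrite /ipQ (ipDl (sqintZ c sf) sg sh) (ipZl c sf sh).
- by move=> f g _ _; exact: ipC.
- by move=> f _; exact: ip_ge0.
move=> u C uE uC; have [v [sv vC]] := sqint_complete (fun n => (uE n).1) uC.
(* Cutting the limit to [Q] does not increase its distance to functions that vanish off [Q]. *)
exists (cutQ v), C; split; first exact: EQ_cutQ.
move=> n; apply: le_trans (vC n); have [mv _] := sv; have [[mu _] u0] := uE n.
apply: ip_le.
- exact: (sqintB sv (uE n).1).
- by apply: measurable_funB => //; exact: measurable_cutQ.
move=> z; rewrite -[(cutQ v - u n) z]/(cutQ v z - u n z) /cutQ; case: ifPn => // zQ.
by rewrite u0// subrr normr0.
Qed.

Lemma EQ_op1 (l : R -> R -> R) C f : schur leb l C ->
  (forall t s, ~~ ((t \in `]0, T[) && (s \in `]0, T[)) -> l t s = 0) ->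
  EQ f -> EQ (op1 leb l f).
Proof.
move=> sl lout [sf f0]; split; first exact: op1_sqint sl sf.
move=> [t x] /=; rewrite negb_and /= => /orP tx.
rewrite /op1 /kop /Rintegral (eq_integral (cst 0%E)) ?integral0//= => s _.
have [st|st] := boolP ((t \in `]0, T[) && ((s : R) \in `]0, T[)); last by rewrite lout// mul0r.
rewrite f0 ?mulr0//= /inQ /=; case: tx => h; last by rewrite (negbTE h) andbF.
by move: st; rewrite (negbTE h).
Qed.

Lemma EQ_op2 (k : R -> R -> R) C f : schur leb k C ->
  (forall t s, ~~ ((t \in `]a, b[) && (s \in `]a, b[)) -> k t s = 0) ->
  EQ f -> EQ (op2 leb k f).
Proof.
move=> sk kout [sf f0]; split; first exact: op2_sqint sk sf.
move=> [t x] /=; rewrite negb_and /= => /orP tx.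
rewrite /op2 /kop /Rintegral (eq_integral (cst 0%E)) ?integral0//= => s _.
have [xs|xs] := boolP ((x \in `]a, b[) && ((s : R) \in `]a, b[)); last by rewrite kout// mul0r.
rewrite f0 ?mulr0//= /inQ /=; case: tx => h; first by rewrite (negbTE h).
by move: xs; rewrite (negbTE h).
Qed.

(** Linearity is read off the adjoint: pointwise it would hold only where the sections are
    integrable. *)
Lemma bounded_op1 (l : R -> R -> R) C : schur leb l C ->
  (forall t s, ~~ ((t \in `]0, T[) && (s \in `]0, T[)) -> l t s = 0) ->
  bounded_op EQ ipQ (op1 leb l).
Proof.
move=> sl lout; split; first by move=> f; exact: (EQ_op1 sl lout).
- move=> c f g h Ef Eg Eh; have Efg := sh_lin EQ_semihilbert c Ef Eg.
  rewrite /ipQ !(@op1_adjoint _ _ _ _ _ leb leb l C)//; [|exact: EQ_sqint..].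
  have El : EQ (op1 leb (fun x s => l s x) h).
    apply: (EQ_op1 (schur_transpose sl)) => // t s ts; apply: lout.
    by rewrite andbC.
  exact: (sh_linl EQ_semihilbert c Ef Eg El).
- exists (C ^+ 2); split; first exact: sqr_ge0.
  by move=> f Ef; apply: (op1_bounded sl); exact: EQ_sqint.
Qed.

Lemma bounded_op2 (k : R -> R -> R) C : schur leb k C ->
  (forall t s, ~~ ((t \in `]a, b[) && (s \in `]a, b[)) -> k t s = 0) ->
  bounded_op EQ ipQ (op2 leb k).
Proof.
move=> sk kout; split; first by move=> f; exact: (EQ_op2 sk kout).
- move=> c f g h Ef Eg Eh; have Efg := sh_lin EQ_semihilbert c Ef Eg.
  rewrite /ipQ !(@op2_adjoint _ _ _ _ _ leb leb k C)//; [|exact: EQ_sqint..].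
  have El : EQ (op2 leb (fun x s => k s x) h).
    apply: (EQ_op2 (schur_transpose sk)) => // t s ts; apply: kout.
    by rewrite andbC.
  exact: (sh_linl EQ_semihilbert c Ef Eg El).
- exists (C ^+ 2); split; first exact: sqr_ge0.
  by move=> f Ef; apply: (op2_bounded sk); exact: EQ_sqint.
Qed.

(** A function of [x] is a constant for the integration in time; by [Rintegral_scale] it comes out
    at every point, whether or not the section is integrable. *)
Lemma op1_scale (l : R -> R -> R) C (c : R -> R) f : schur leb l C ->
  measurable_fun setT f ->
  op1 leb l (fun z => c z.2 * f z) = (fun z => c z.2 * op1 leb l f z).
Proof.
move=> sl mf; apply/funext => -[t x]; rewrite /op1 /kop /=.
rewrite -Rintegral_scale; first by apply: eq_Rintegral => s _; rewrite mulrCA.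
apply: measurable_funM; first exact: (measurable_schur_row t sl).
exact: (measurable_pair2 x mf).
Qed.

Lemma sqint_space_mul (M : R) (c : R -> R) f : measurable_fun setT c ->
  (forall x, `|c x| <= M) -> sqint leb2 f -> sqint leb2 (fun z => c z.2 * f z).
Proof.
move=> mc cM sf; apply: (@sqint_bounded_mul _ _ _ _ M) => //.
exact: (measurableT_comp mc measurable_snd).
Qed.

Lemma op1_ge0 (l : R -> R -> R) C f : schur leb l C ->
  (forall u : R -> R, sqint leb u -> 0 <= ip leb (kop leb l u) u) ->
  sqint leb2 f -> 0 <= ip leb2 (op1 leb l f) f.
Proof.
move=> sl lpos sf; have slf := op1_sqint sl sf.
have [mf _] := sf; have [mlf _] := slf.
rewrite (ip_swap leb leb mlf mf) ip_sections; [|exact: sqint_swap..].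
apply: Rintegral_ae_ge0.
  have [msf _] := sqint_swap sf; have [mslf _] := sqint_swap slf.
  rewrite /ip; apply: (@measurable_param_Rintegral _ _ _ _ _ leb
    (fun z => op1 leb l f (z.2, z.1) * f (z.2, z.1))).
  exact: measurable_funM.
have h := sqint_sections (sqint_swap sf).
by apply: ae_mono h => x sfx; rewrite /op1 /=; exact: (lpos _ sfx).
Qed.

(** * The energy form on L^2(Q) *)

Section EvolutionForm.
Variables (l k : R -> R -> R) (Cl Ck : R).
Hypotheses (sl : schur leb l Cl) (sk : schur leb k Ck).
Hypothesis lout : forall t s, ~~ ((t \in `]0, T[) && (s \in `]0, T[)) -> l t s = 0.
Hypothesis kout : forall x s, ~~ ((x \in `]a, b[) && (s \in `]a, b[)) -> k x s = 0.
Hypothesis lpos : forall u : R -> R, sqint leb u -> 0 <= ip leb (kop leb l u) u.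
Hypothesis kinj : forall u : R -> R, sqint leb u ->
  {ae leb, forall x, kop leb (fun x s => k s x) u x = 0} ->
  {ae leb, forall x, x \in `]a, b[ -> u x = 0}.
Variables (bt qt : R -> R) (beta0 M : R).
Hypotheses (mbt : measurable_fun setT bt) (mqt : measurable_fun setT qt).
Hypotheses (beta0_gt0 : 0 < beta0) (bt_ge : forall x, beta0 <= bt x).
Hypotheses (qt_ge0 : forall x, 0 <= qt x).
Hypotheses (btM : forall x, bt x <= M) (qtM : forall x, qt x <= M).

Let lT := fun t s => l s t.
Let kT := fun x s => k s x.
Let slT : schur leb lT Cl. Proof. exact: schur_transpose. Qed.
Let skT : schur leb kT Ck. Proof. exact: schur_transpose. Qed.
Let lTout t s : ~~ ((t \in `]0, T[) && (s \in `]0, T[)) -> lT t s = 0.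
Proof. by rewrite andbC; exact: lout. Qed.
Let kTout x s : ~~ ((x \in `]a, b[) && (s \in `]a, b[)) -> kT x s = 0.
Proof. by rewrite andbC; exact: kout. Qed.

Definition formQ (f g : V) : R :=
  ip leb2 (fun z => bt z.2 * f z) g +
  ip leb2 (fun z => qt z.2 * op2 leb k f z) (op2 leb k g).

Let btn x : `|bt x| <= M.
Proof. by rewrite ger0_norm// (le_trans (ltW beta0_gt0)). Qed.

Let qtn x : `|qt x| <= M. Proof. by rewrite ger0_norm. Qed.

Let M0 : 0 <= M. Proof. exact: le_trans (qt_ge0 0) (qtM 0). Qed.

Let EJ f : EQ f -> EQ (op2 leb k f). Proof. exact: (EQ_op2 sk kout). Qed.
Let EW f : EQ f -> EQ (op1 leb l f). Proof. exact: (EQ_op1 sl lout). Qed.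
Let EWs f : EQ f -> EQ (op1 leb lT f). Proof. exact: (EQ_op1 slT lTout). Qed.

Let sbt f : sqint leb2 f -> sqint leb2 (fun z => bt z.2 * f z).
Proof. exact: (sqint_space_mul mbt btn). Qed.

Let sqt f : sqint leb2 f -> sqint leb2 (fun z => qt z.2 * f z).
Proof. exact: (sqint_space_mul mqt qtn). Qed.

Let subM (c : R -> R) f g : sqint leb2 (fun z => c z.2 * f z) -> sqint leb2 f ->
  sqint leb2 g -> forall e : R,
  ip leb2 (fun z => (c z.2 - e) * f z) g =
  ip leb2 (fun z => c z.2 * f z) g - e * ip leb2 f g.
Proof.
move=> scf sf sg e; rewrite -(ipZl e sf sg) -(ipBl scf (sqintZ e sf) sg) /ip.
by apply: eq_Rintegral => z _ /=; rewrite mulrBl.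
Qed.

Lemma formQ_ge f : EQ f -> beta0 * ipQ f f <= formQ f f.
Proof.
move=> Ef; have sf := EQ_sqint Ef.
have q0 : 0 <= ip leb2 (fun z => qt z.2 * op2 leb k f z) (op2 leb k f).
  by apply: ip_mul_ge0 => z.
have b0 : 0 <= ip leb2 (fun z => (bt z.2 - beta0) * f z) f.
  by apply: ip_mul_ge0 => z; rewrite subr_ge0.
move: b0; rewrite (subM (sbt sf) sf sf) subr_ge0 => b0.
by apply: le_trans b0 _; rewrite lerDl.
Qed.

Lemma ip_mul_le (c : R -> R) f : measurable_fun setT c -> (forall x, `|c x| <= M) ->
  sqint leb2 f -> ip leb2 (fun z => c z.2 * f z) f <= M * ip leb2 f f.
Proof.
move=> mc cM sf; have scf := sqint_space_mul mc cM sf.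
have : 0 <= ip leb2 (fun z => (M - c z.2) * f z) f.
  apply: ip_mul_ge0 => z.
  by rewrite subr_ge0 (le_trans (ler_norm _)).
pose h (z : R * R) := (c z.2 - M) * f z.
have sh : sqint leb2 h.
  have -> : h = (fun z => c z.2 * f z) \- (M \*o f).
    by apply/funext => z; rewrite /h mulrBl.
  exact: (sqintB scf (sqintZ M sf)).
have -> : (fun z => (M - c z.2) * f z) = -1 \*o h.
  by apply/funext => z; rewrite /h /= mulN1r -mulNr opprB.
by rewrite (ipZl (-1) sh sf) /h (subM scf sf sf) mulN1r opprB subr_ge0.
Qed.

Lemma formQ_le f : EQ f -> formQ f f <= (M + M * Ck ^+ 2) * ipQ f f.
Proof.
move=> Ef; have sf := EQ_sqint Ef; have sJ := EQ_sqint (EJ Ef).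
rewrite /formQ mulrDl lerD//; first exact: ip_mul_le.
apply: (le_trans (ip_mul_le mqt qtn sJ)).
by rewrite -mulrA ler_wpM2l//; exact: (op2_bounded sk).
Qed.

Lemma formQ_linl c f g h : EQ f -> EQ g -> EQ h ->
  formQ (c *: f + g) h = c * formQ f h + formQ g h.
Proof.
move=> Ef Eg Eh; have sf := EQ_sqint Ef; have sg := EQ_sqint Eg.
have sh := EQ_sqint Eh; have sJh := EQ_sqint (EJ Eh).
have Efg := sh_lin EQ_semihilbert c Ef Eg; have sfg := EQ_sqint Efg.
have qJ u : EQ u -> ip leb2 (fun z => qt z.2 * op2 leb k u z) (op2 leb k h) =
    ipQ (op2 leb k u) (fun z => qt z.2 * op2 leb k h z).
  by move=> _; apply: eq_Rintegral => z _; rewrite mulrAC mulrC.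
rewrite /formQ !qJ//.
have EqJh : EQ (fun z => qt z.2 * op2 leb k h z).
  by split; [exact: sqt|move=> z zQ; rewrite (EQ_out (EJ Eh) zQ) mulr0].
rewrite (op_lin (bounded_op2 sk kout) c Ef Eg EqJh).
have -> : (fun z => bt z.2 * (c *: (f : V) + g) z) =
    (c \*o (fun z => bt z.2 * f z)) \+ (fun z => bt z.2 * g z).
  apply/funext => z; rewrite -[(c *: (f : V) + g) z]/(c * f z + g z) /=.
  by rewrite mulrDr mulrCA.
rewrite (ipDl (sqintZ c (sbt sf)) (sbt sg) sh) (ipZl c (sbt sf) sh).
by rewrite mulrDr addrACA.
Qed.

Lemma formQ_sym f g : EQ f -> EQ g -> formQ f g = formQ g f.
Proof.
move=> _ _; rewrite /formQ; congr (_ + _); apply: eq_Rintegral => z _.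
  by rewrite mulrAC mulrC.
by rewrite mulrAC mulrC.
Qed.

Lemma formQ_semihilbert : semihilbert EQ formQ.
Proof.
apply: (sh_equiv EQ_semihilbert beta0_gt0 formQ_linl formQ_sym formQ_ge formQ_le).
Qed.

Let ip_aeL f f' g : sqint leb2 f -> sqint leb2 f' -> sqint leb2 g ->
  {ae (@lebesgue_measure R \x @lebesgue_measure R)%E, forall z, f z = f' z} ->
  ip leb2 f g = ip leb2 f' g.
Proof.
move=> [mf _] [mf' _] [mg _] ff'.
exact: (ip_ae mf mf' mg mg ff' (ae_all _ (fun z => erefl))).
Qed.

Lemma op1_op2_ip f g : EQ f -> EQ g ->
  ipQ (op2 leb k (op1 leb l f)) g = ipQ (op1 leb l (op2 leb k f)) g.
Proof.
move=> Ef Eg; have sf := EQ_sqint Ef; have sg := EQ_sqint Eg.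
have s1 := EQ_sqint (EJ (EW Ef)); have s2 := EQ_sqint (EW (EJ Ef)).
apply: esym; exact: (ip_aeL s2 s1 sg (op_comm sl sk sf)).
Qed.

Lemma op1T_op2_ip f g : EQ f -> EQ g ->
  ipQ g (op2 leb k (op1 leb lT f)) = ipQ g (op1 leb lT (op2 leb k f)).
Proof.
move=> Ef Eg; have sf := EQ_sqint Ef; have sg := EQ_sqint Eg.
have s1 := EQ_sqint (EJ (EWs Ef)); have s2 := EQ_sqint (EWs (EJ Ef)).
rewrite /ipQ [LHS]ipC [RHS]ipC.
apply: esym; exact: (ip_aeL s2 s1 sg (op_comm slT sk sf)).
Qed.

Lemma ip_op1_adj f g : EQ f -> EQ g -> ipQ (op1 leb l f) g = ipQ f (op1 leb lT g).
Proof. by move=> Ef Eg; apply: (op1_adjoint sl); exact: EQ_sqint. Qed.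

Let formW1 (c : R -> R) f g : measurable_fun setT c -> (forall x, `|c x| <= M) ->
  EQ f -> EQ g -> ip leb2 (fun z => c z.2 * op1 leb l f z) g =
    ip leb2 (fun z => c z.2 * f z) (op1 leb lT g).
Proof.
move=> mc cM Ef Eg; have sf := EQ_sqint Ef; have [mf _] := sf.
rewrite -(op1_scale c sl mf); apply: ip_op1_adj => //.
split; first exact: (sqint_space_mul mc cM).
by move=> z zQ; rewrite (EQ_out Ef zQ) mulr0.
Qed.

Let qJW f g : EQ f -> EQ g ->
  ip leb2 (fun z => qt z.2 * op2 leb k (op1 leb l f) z) g =
  ip leb2 (fun z => qt z.2 * op1 leb l (op2 leb k f) z) g.
Proof.
move=> Ef Eg; have sg := EQ_sqint Eg.
have s1 := sqt (EQ_sqint (EJ (EW Ef))); have s2 := sqt (EQ_sqint (EW (EJ Ef))).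
apply: (ip_aeL s1 s2 sg).
apply: ae_mono (op_comm sl sk (EQ_sqint Ef)) => z h.
exact: (congr1 (fun y => qt z.2 * y) (esym h)).
Qed.

(** [W] acts in time, [J] and the coefficients in space: [W] commutes with the coefficients
    everywhere and with [J] almost everywhere. *)
Lemma formQ_op1 f g : EQ f -> EQ g -> formQ (op1 leb l f) g = formQ f (op1 leb lT g).
Proof.
move=> Ef Eg; have h1 := formW1 mbt btn Ef Eg; have h2 := qJW Ef (EJ Eg).
have h3 := formW1 mqt qtn (EJ Ef) (EJ Eg).
have EqJ : EQ (fun z => qt z.2 * op2 leb k f z).
  split; first exact: sqt (EQ_sqint (EJ Ef)).
  by move=> z zQ; rewrite (EQ_out (EJ Ef) zQ) mulr0.
have h4 := esym (op1T_op2_ip Eg EqJ).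
exact: (f_equal2 +%R h1 (etrans h2 (etrans h3 h4))).
Qed.

Lemma ip_op1_ge0 f : EQ f -> 0 <= ipQ (op1 leb l f) f.
Proof. by move=> Ef; apply: (op1_ge0 sl lpos); exact: EQ_sqint. Qed.

Let op1_mul_ge0 (c : R -> R) f : measurable_fun setT c -> (forall x, 0 <= c x) ->
  (forall x, c x <= M) -> sqint leb2 f ->
  0 <= ip leb2 (fun z => c z.2 * op1 leb l f z) f.
Proof.
move=> mc c0 cM sf; have [mf _] := sf.
(* The square root is shared between the two arguments: [W] commutes with it, so the product is the
   quadratic form of [W] at [r f]. *)
pose r x := Num.sqrt (c x).
have mr : measurable_fun setT r by exact: (measurableT_comp (measurable_funTS (continuous_measurable_fun (@sqrt_continuous R))) mc).
have sr : sqint leb2 (fun z => r z.2 * f z).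
  apply: (@sqint_space_mul (Num.sqrt M)) => // x.
  by rewrite ger0_norm ?sqrtr_ge0// ler_wsqrtr.
have := op1_ge0 sl lpos sr; rewrite (op1_scale r sl mf) /ip.
by under eq_Rintegral do rewrite mulrACA -expr2 sqr_sqrtr// mulrA.
Qed.

Lemma formQ_op1_ge0 f : EQ f -> 0 <= formQ (op1 leb l f) f.
Proof.
move=> Ef; rewrite /formQ (qJW Ef (EJ Ef)) addr_ge0//; apply: op1_mul_ge0 => //.
- by move=> x; apply: le_trans (bt_ge x); exact: ltW.
- exact: EQ_sqint.
- exact: (EQ_sqint (EJ Ef)).
Qed.

(** Testing with [g] equal to the adjoint of [J] at [f] shows that this adjoint vanishes; on almost
    every section, [kinj] then gives [f = 0]. *)
Lemma op2_dense f : EQ f -> (forall g, EQ g -> ipQ f (op2 leb k g) = 0) -> ipQ f f = 0.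
Proof.
move=> Ef f0; have sf := EQ_sqint Ef; have [mf _] := sf.
have ET : EQ (op2 leb kT f) by exact: (EQ_op2 skT kTout).
have : ipQ (op2 leb kT f) (op2 leb kT f) = 0.
  by rewrite -(f0 _ ET) /ipQ [RHS]ipC (op2_adjoint sk (EQ_sqint ET) sf).
move/(ip_eq0 (EQ_sqint ET))/ae_prod => h.
apply: (sqint_ae0 mf); apply: prod_ae.
  have -> : [set z | f z = 0] = f @^-1` [set 0] by [].
  by rewrite -[X in measurable X]setTI; exact: mf.
apply: ae_mono2 h (sqint_sections sf) => t ht sft.
apply: ae_mono (kinj sft ht) => x hx.
have [xab|xab] := boolP ((x : R) \in `]a, b[); first exact: hx.
by rewrite (EQ_out Ef)// /inQ /= (negbTE xab) andbF.
Qed.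

Definition backwardQ := backward EQ ipQ formQ (op2 leb k) (op1 leb l).

Let EQ0 : exists f : V, EQ f.
Proof. by exists 0; split; [exact: sqint0|]. Qed.

Definition ellipticQ_dense := elliptic_dense EQ_semihilbert formQ_semihilbert
  beta0_gt0 formQ_ge (bounded_op2 sk kout) (bounded_op1 sl lout) EQ0
  ip_op1_ge0 op2_dense.

Definition backwardQ_dual := backward_dual EQ_semihilbert formQ_semihilbert
  beta0_gt0 formQ_ge (bounded_op2 sk kout) (bounded_op1 sl lout)
  (bounded_op1 slT lTout) EQ0 ip_op1_adj op1_op2_ip op1T_op2_ip formQ_op1
  ip_op1_ge0 formQ_op1_ge0 op2_dense.

Definition ellipticQ_W := elliptic_W (bounded_op2 sk kout) (bounded_op1 slT lTout)
  ip_op1_adj op1T_op2_ip formQ_op1.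

End EvolutionForm.

End Cylinder.

(** * Traces in time *)

Section NonMeasurable.
Context d (X : measurableType d) (R : realType) (m : {measure set X -> \bar R}).
Import HBNNSimple.

(** A simple function below [f] is almost everywhere below [h]. Conversely, one below [h], set to 0
    on the exceptional null set, lies below [f] everywhere. This serves the boundary trace, whose
    measurability in time is not at hand. *)
Lemma ge0_le_integral_nonmeasurable (f h : X -> \bar R) :
  (forall x, 0 <= f x)%E -> (forall x, 0 <= h x)%E -> measurable_fun setT h ->
  {ae m, forall x, f x = h x} -> (\int[m]_x f x = \int[m]_x h x)%E.
Proof.
move=> f0 h0 mh fh; apply/eqP; rewrite eq_le; apply/andP; split.
  rewrite (ge0_integralE _ (fun x _ => f0 x)) patch_setT.
  apply: ge_ereal_sup => _ [s /= sf <-].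
  have -> : sintegral m s = (\int[m]_x (s x)%:E)%E.
    by rewrite integral_nnsfun// patch_setT.
  apply: ae_ge0_le_integral => //.
  - by move=> x _; rewrite lee_fin.
  - exact/measurable_EFinP.
  - by apply: filterS fh => x <- _; exact: sf.
rewrite (ge0_integralE _ (fun x _ => h0 x)) patch_setT.
apply: ge_ereal_sup => _ [s /= sh <-].
have [N [mN N0 fhN]] := fh.
pose s' := proj_nnsfun s (measurableC mN).
have -> : sintegral m s = sintegral m s'.
  transitivity (\int[m]_x (s x)%:E)%E; first by rewrite integral_nnsfun// patch_setT.
  transitivity (\int[m]_x (s' x)%:E)%E; last by rewrite integral_nnsfun// patch_setT.
  apply: ae_eq_integral => //; [exact/measurable_EFinP|exact/measurable_EFinP|].
  exists N; split => // x /= xN; apply: contrapT => nN; apply: xN => _.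
  rewrite /s' /= /mindic indicE mem_set ?mulr1//.
rewrite (ge0_integralE _ (fun x _ => f0 x)) patch_setT.
apply: ereal_sup_ubound; exists s' => //= x; rewrite /mindic indicE.
have [xN|xN] := pselect (N x).
  by rewrite memNset ?mulr0//; exact.
rewrite mem_set// mulr1; have -> : f x = h x by apply: contrapT => /fhN.
exact: sh.
Qed.

(* The integral of a non-measurable function is a supremum over measurable
   simple functions, hence insensitive to null sets as soon as the function is
   almost everywhere equal to a measurable one. *)
Lemma Rintegral_ae_nonmeasurable (f h : X -> R) : measurable_fun setT h ->
  {ae m, forall x, f x = h x} -> \int[m]_x f x = \int[m]_x h x.
Proof.
move=> mh fh; rewrite /Rintegral integralE [in RHS]integralE; congr fine.
have mh' : measurable_fun setT (EFin \o h) by exact/measurable_EFinP.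
congr (_ - _)%E; apply: ge0_le_integral_nonmeasurable => //.
- exact: measurable_funepos.
- by apply: filterS fh => x fhx; rewrite !funeposE /= fhx.
- exact: measurable_funeneg.
- by apply: filterS fh => x fhx; rewrite !funenegE /= fhx.
Qed.

End NonMeasurable.

(** * Integrals up to the final time, with values in L^2 *)

Section TimeIntegral.
Context {R : realType}.
Implicit Types (f g h : R * R -> R) (u v : R -> R) (x t s gamma : R).

Lemma sqint_semihilbert d (X : measurableType d) (m : {measure set X -> \bar R}) :
  @semihilbert R (X -> R^o)%type [set y | sqint m (y : X -> R)]
    (fun y z : (X -> R^o)%type => ip m (y : X -> R) (z : X -> R)).
Proof.
split.
- by move=> c f g sf sg; exact: (sqintD (sqintZ c sf) sg).
- move=> c f g h sf sg sh.
  by rewrite (ipDl (sqintZ c sf) sg sh) (ipZl c sf sh).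
- by move=> f g _ _; exact: ipC.
- by move=> f _; exact: ip_ge0.
move=> y C yE yC; have [z [sz zC]] := sqint_complete yE yC.
by exists z, C.
Qed.

Definition itv_ind t s x : R := if x \in `]t, s[ then 1 else 0.

Lemma sqint_itv_ind t s : t <= s -> sqint leb (itv_ind t s) /\
  ip leb (itv_ind t s) (itv_ind t s) = s - t.
Proof.
move=> ts; have mi : measurable_fun setT (itv_ind t s).
  have -> : itv_ind t s = (fun=> 1 : R) \_ `]t, s[.
    by apply/funext => x; rewrite /itv_ind patchE mem_setE.
  by apply/(measurable_restrictT _ _).1 => //; exact: measurable_cst.
have iE : (\int[leb]_x (itv_ind t s x ^+ 2)%:E = (s - t)%:E)%E.
  transitivity (\int[leb]_(x in `]t, s[) (1 : R)%:E)%E.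
    rewrite [RHS]integral_mkcond; apply: eq_integral => x _.
    rewrite /itv_ind patchE mem_setE; case: ifP => _; first by rewrite expr1n.
    by rewrite expr0n.
  rewrite integral_cst//= mul1e lebesgue_measure_itv /= lte_fin.
  by case: ltP => // st; rewrite (le_anti (introT andP (conj ts st))) subrr.
have si : sqint leb (itv_ind t s) by split => //; rewrite iE ltry.
by split => //; apply: EFin_inj; rewrite ip_sqE.
Qed.

Lemma Rintegral_itv_sq_le u t s : t <= s -> sqint leb u ->
  (\int[leb]_(x in `]t, s[) u x) ^+ 2 <= (s - t) * ip leb u u.
Proof.
move=> ts su; have [si iE] := sqint_itv_ind ts.
have := sh_CS (sqint_semihilbert leb) si su; rewrite iE; apply: le_trans.
rewrite le_eqVlt; apply/orP; left; apply/eqP; congr (_ ^+ 2).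
rewrite Rintegral_mkcond; apply: eq_Rintegral => x _.
by rewrite /itv_ind patchE mem_setE; case: ifP => _; rewrite ?mul1r ?mul0r.
Qed.

Variable (T : R).

Definition tail_int h t x : R := \int[leb]_(s in `]t, T[) h (s, x).

Lemma measurable_tail_int h t : measurable_fun setT h ->
  measurable_fun setT (tail_int h t).
Proof.
move=> mh; pose k (z : R * R) : R := itv_ind t T z.2 * h (z.2, z.1).
have mk : measurable_fun setT k.
  apply: measurable_funM; last exact: (measurable_fun_swap mh).
  apply: (measurableT_comp (f := itv_ind t T) _ measurable_snd).
  have -> : itv_ind t T = (fun=> 1 : R) \_ `]t, T[.
    by apply/funext => x; rewrite /itv_ind patchE mem_setE.
  by apply/(measurable_restrictT _ _).1 => //; exact: measurable_cst.
have := @measurable_param_Rintegral _ _ _ _ _ leb k mk.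
have -> // : (fun x : R => \int[leb]_y k (x, y)) = tail_int h t.
apply/funext => x; rewrite /tail_int [RHS]Rintegral_mkcond; apply: eq_Rintegral => s _.
by rewrite /k /itv_ind patchE mem_setE /=; case: ifP => _; rewrite ?mul1r ?mul0r.
Qed.

Lemma Rintegral_itv0 u t : \int[leb]_(s in `]t, t[) u s = 0.
Proof. by rewrite set_itv_ge ?Rintegral_set0// bnd_simp ltxx. Qed.

Lemma tail_int_diff h t s x : t <= s -> s <= T -> sqint leb (fun r => h (r, x)) ->
  tail_int h t x - tail_int h s x = \int[leb]_(r in `]t, s[) h (r, x).
Proof.
move=> ts sT sh; rewrite /tail_int.
have iq t' s' := sqint_integrable_itv t' s' sh.
have [<-|tns] := eqVneq t s.
  by rewrite subrr Rintegral_itv0.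
have [->|snT] := eqVneq s T.
  by rewrite [X in _ - X]Rintegral_itv0 subr0.
have tb : (BRight t <= BRight s)%O by rewrite bnd_simp.
have sb : (BRight s <= BLeft T)%O by rewrite bnd_simp lt_neqAle snT.
rewrite -(@Rintegral_itvB _ _ (BRight t) (BLeft T) s)//.
by rewrite -Rintegral_itv_bndo_bndc// opprB addrC subrK.
Qed.

(** Cauchy-Schwarz on almost every line of constant [x], integrated in [x]: the tail integral is
    Holder continuous of exponent [1 / 2] in time with values in L^2. *)
Lemma tail_int_cont h t s : sqint leb2 h -> t <= s -> s <= T ->
  sqint leb (fun x => tail_int h t x - tail_int h s x) /\
  ip leb (fun x => tail_int h t x - tail_int h s x)
         (fun x => tail_int h t x - tail_int h s x) <= (s - t) * ip leb2 h h.
Proof.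
move=> sh ts sT; have [mh hfin] := sh.
have md : measurable_fun setT (fun x => tail_int h t x - tail_int h s x).
  by apply: measurable_funB; exact: measurable_tail_int.
have mh2 : measurable_fun setT (fun z : R * R => (h (z.2, z.1) ^+ 2)%:E).
  by apply: measurable_sqE; exact: (measurable_fun_swap mh).
have sw := sqint_swap sh.
have ipE : (\int[leb]_x \int[leb]_r ((h (r, x)) ^+ 2)%:E = (ip leb2 h h)%:E)%E.
  rewrite (ip_sqE sh) (ge0_integral_swap leb leb (measurable_sqE mh)); last first.
    by move=> z; rewrite lee_fin sqr_ge0.
  rewrite fubini_tonelli1//= => z.
  by rewrite lee_fin sqr_ge0.
have bd : (\int[leb]_x ((tail_int h t x - tail_int h s x) ^+ 2)%:E <=
    ((s - t) * ip leb2 h h)%:E)%E.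
  rewrite EFinM -ipE -ge0_integralZl_EFin ?subr_ge0//; last first.
  - by apply: (@measurable_fun_fubini_tonelli_F _ _ _ _ _ leb (fun z => (h (z.2, z.1) ^+ 2)%:E)) => // z; rewrite lee_fin sqr_ge0.
  - by move=> x _; apply: integral_ge0 => r _; rewrite lee_fin sqr_ge0.
  apply: ae_ge0_le_integral => //.
  - by move=> x _; rewrite lee_fin sqr_ge0.
  - exact: measurable_sqE.
  - move=> x _; apply: mule_ge0; first by rewrite lee_fin subr_ge0.
    by apply: integral_ge0 => r _; rewrite lee_fin sqr_ge0.
  - apply: measurable_funeM.
    by apply: (@measurable_fun_fubini_tonelli_F _ _ _ _ _ leb (fun z => (h (z.2, z.1) ^+ 2)%:E)) => // z; rewrite lee_fin sqr_ge0.
  apply: ae_mono (sqint_sections sw) => x shx _.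
  have shx' : sqint leb (fun r => h (r, x)) := shx.
  rewrite -(ip_sqE shx') -EFinM lee_fin (tail_int_diff ts sT shx').
  exact: Rintegral_itv_sq_le.
have sd : sqint leb (fun x => tail_int h t x - tail_int h s x).
  by split => //; apply: le_lt_trans bd _; rewrite ltry.
by split => //; rewrite -lee_fin ip_sqE.
Qed.

Lemma tail_int_T h x : tail_int h T x = 0.
Proof. exact: Rintegral_itv0. Qed.

Lemma sqint_tail_int h t : sqint leb2 h -> t <= T -> sqint leb (tail_int h t).
Proof.
move=> sh tT; have [+ _] := tail_int_cont sh tT (lexx T).
by have -> : (fun x => tail_int h t x - tail_int h T x) = tail_int h t
  by apply/funext => x; rewrite tail_int_T subr0.
Qed.

End TimeIntegral.

Section AlmostEverywhereProduct.
Context d1 d2 (T1 : measurableType d1) (T2 : measurableType d2) (R : realType).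
Context (m1 : {sigma_finite_measure set T1 -> \bar R})
        (m2 : {sigma_finite_measure set T2 -> \bar R}).

Lemma prod_ae0 (h : T1 * T2 -> R) : measurable_fun setT h ->
  {ae m1, forall x, {ae m2, forall y, h (x, y) = 0}} ->
  {ae (m1 \x m2)%E, forall z, h z = 0}.
Proof.
move=> mh; apply: prod_ae.
have -> : [set z | h z = 0] = h @^-1` [set 0] by [].
by rewrite -[X in measurable X]setTI; exact: mh.
Qed.

End AlmostEverywhereProduct.

Lemma prod_ae0_swap d1 d2 (T1 : measurableType d1) (T2 : measurableType d2)
    (R : realType) (m1 : {sigma_finite_measure set T1 -> \bar R})
    (m2 : {sigma_finite_measure set T2 -> \bar R}) (h : T1 * T2 -> R) :
  measurable_fun setT h ->
  {ae m2, forall y, {ae m1, forall x, h (x, y) = 0}} ->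
  {ae (m1 \x m2)%E, forall z, h z = 0}.
Proof.
move=> mh hz; have := prod_ae0 (measurable_fun_swap mh) hz.
by move/ae_swap; apply: filterS => -[x y].
Qed.

Lemma ipNN d (X : measurableType d) (K : realType) (m : {measure set X -> \bar K})
  (f : X -> K) : ip m (\- f) (\- f) = ip m f f.
Proof. by apply: eq_Rintegral => x _ /=; rewrite mulrNN. Qed.

(** * Identification of the trace in time *)

Section TimeRepresentation.
Context {R : realType}.
Variables (T a b : R) (T_gt0 : 0 < T) (ab : a < b).
Implicit Types (f g h F psi : R * R -> R) (u v : R -> R) (x t s : R).

Let fr := fractional_side_right T_gt0.

(** The integral up to [T] as an operator on [EQ], which cuts it to 0 at [t = 0]; [tail_int] keeps
    the end point values that the traces require. *)
Definition tailQ h : R * R -> R := op1 leb (fun t s => fker 0 T 1 s t) h.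

Lemma fkerT_out s x t : ~~ ((x \in `]0, T[) && (t \in `]0, T[)) -> fker 0 T s t x = 0.
Proof.
move=> xt; apply: (fs_out fr); apply: contra xt => /andP[x0 tx].
by rewrite x0 (fs_sub fr x0 tx).
Qed.

Lemma EQ_tailQ h : EQ T a b h -> EQ T a b (tailQ h).
Proof.
have [C sC] := fs_schur fr (ltr01 : 0 < (1 : R)).
by apply: (EQ_op1 sC) => t s; exact: fkerT_out.
Qed.

Lemma tailQE h t x : t \in `]0, T[ -> tailQ h (t, x) = tail_int T h t x.
Proof.
move=> t0T; rewrite /tailQ /op1 /kop /tail_int [RHS]Rintegral_mkcond.
apply: eq_Rintegral => s _; rewrite patchE mem_setE; case: ifPn => st.
  by rewrite (fs_one fr)// mul1r.
by rewrite (fs_out fr) ?mul0r// negb_and st orbT.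
Qed.

Lemma tail_int_out h t x : EQ T a b h -> x \notin `]a, b[ -> tail_int T h t x = 0.
Proof.
move=> Eh xab; rewrite /tail_int /Rintegral (eq_integral (cst 0%E)) ?integral0//= => s _.
by rewrite (EQ_out Eh)// /inQ /= (negbTE xab) andbF.
Qed.

Lemma Rintegral_itv_ind t s : t <= s -> \int[leb]_x itv_ind t s x = s - t.
Proof.
move=> ts; have [_ <-] := sqint_itv_ind ts; apply: eq_Rintegral => x _.
by rewrite /itv_ind; case: ifP => _; rewrite ?mulr1 ?mulr0.
Qed.

Lemma ip_add_le u v : sqint leb u -> sqint leb v ->
  ip leb (u \+ v) (u \+ v) <= 2 * ip leb u u + 2 * ip leb v v.
Proof.
move=> su sv; have H := sqint_semihilbert (@lebesgue_measure R).
have h1 := sh_sqD H su sv; have h2 := sh_sqB H su sv.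
have h3 : 0 <= ip leb (u \- v) (u \- v) by exact: ip_ge0.
rewrite -[leLHS]/(ip leb ((u : R -> R^o) + v) ((u : R -> R^o) + v)) h1.
move: h3; rewrite -[X in 0 <= X]/(ip leb ((u : R -> R^o) - v) ((u : R -> R^o) - v)) h2.
lra.
Qed.

Section Limit.
Variables (F psi : R * R -> R) (J : R -> R -> R).
Hypotheses (EF : EQ T a b F) (Epsi : EQ T a b psi).
Hypothesis F_affine : {ae leb, forall x, x \in `]a, b[ ->
  exists c, {ae leb, forall t, t \in `]0, T[ -> F (t, x) = c + tail_int T psi t x}}.
Hypothesis J_cont : continuous_L2 T a b J.
Hypothesis JF : {ae leb, forall t, t \in `]0, T[ ->
  {ae leb, forall x, x \in `]a, b[ -> J t x = F (t, x)}}.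
Hypothesis JT : {ae leb, forall x, x \in `]a, b[ -> J T x = 0}.

(** On almost every line of constant [x] this is constant in time; the aim is that the constant is
    0. *)
Let D z := F z - tailQ psi z.

Let ED : EQ T a b D.
Proof.
split; first exact: (sqintB (EQ_sqint EF) (EQ_sqint (EQ_tailQ Epsi))).
by move=> z zQ; rewrite /D (EQ_out EF zQ) (EQ_out (EQ_tailQ Epsi) zQ) subrr.
Qed.

Let mD : measurable_fun setT D. Proof. by have [] := EQ_sqint ED. Qed.

(** [F_affine] provides a constant for each [x] with no measurability; the time average recovers it
    as a measurable function of [x]. *)
Let c0 x := T^-1 * \int[leb]_t D (t, x).

Let mc0 : measurable_fun setT c0.
Proof.
apply: measurable_funM => //.
exact: (@measurable_param_Rintegral _ _ _ _ _ leb (fun z => D (z.2, z.1)) (measurable_fun_swap mD)).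
Qed.

Let c0_out x : x \notin `]a, b[ -> c0 x = 0.
Proof.
move=> xab; rewrite /c0 /Rintegral (eq_integral (cst 0%E)) ?integral0 ?mulr0//= => t _.
by rewrite (EQ_out ED)// /inQ /= (negbTE xab) andbF.
Qed.

Let Dc0 : {ae leb, forall x, x \in `]a, b[ ->
  {ae leb, forall t, t \in `]0, T[ -> D (t, x) = c0 x}}.
Proof.
apply: ae_mono F_affine => x hx xab; have [c cP] := hx xab.
have Dc : {ae leb, forall t, t \in `]0, T[ -> D (t, x) = c}.
  by apply: ae_mono cP => t h t0T; rewrite /D h// tailQE// addrK.
suff -> : c0 x = c by [].
have mi : measurable_fun setT (itv_ind 0 T) by have [[]] := sqint_itv_ind (ltW T_gt0).
rewrite /c0 (@Rintegral_ae _ _ _ leb _ (fun t => c * itv_ind 0 T t)).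
- by rewrite Rintegral_scale// Rintegral_itv_ind ?(ltW T_gt0)// subr0 mulrCA mulVf ?mulr1// gt_eqF.
- exact: (measurable_pair2 x mD).
- exact: measurable_funM.
apply: ae_mono Dc => t h; rewrite /itv_ind; case: ifPn => t0T; first by rewrite h// mulr1.
by rewrite mulr0 (EQ_out ED)// /inQ /= (negbTE t0T).
Qed.

Let good : {ae leb, forall t, t \in `]0, T[ ->
  {ae leb, forall x, (J t \_ `]a, b[) x = c0 x + tail_int T psi t x /\ D (t, x) = c0 x}}.
Proof.
pose h z := cutQ T a b (fun z => D z - c0 z.2) z.
have mh : measurable_fun setT h.
  apply: measurable_cutQ; apply: measurable_funB => //.
  exact: (measurableT_comp mc0 measurable_snd).
have hz : {ae (@lebesgue_measure R \x @lebesgue_measure R)%E, forall z, h z = 0}.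
  apply: prod_ae0_swap => //; apply: ae_mono Dc0 => x hx.
  have [xab|xab] := boolP ((x : R) \in `]a, b[); last first.
    by apply: ae_all => t; rewrite /h /cutQ /inQ /= (negbTE xab) andbF.
  apply: ae_mono (hx xab) => t ht; rewrite /h /cutQ; case: ifP => // /andP[t0T _].
  by rewrite ht// subrr.
apply: ae_mono2 JF (ae_prod hz) => t hJ ht t0T.
apply: ae_mono2 (hJ t0T) ht => x hx; rewrite /h /cutQ /inQ /= t0T /= patchE mem_setE.
case: ifPn => xab.
  move/eqP; rewrite subr_eq0 => /eqP e; split => //.
  by rewrite hx// -e /D tailQE// subrK.
by move=> _; rewrite c0_out// (tail_int_out _ Epsi)// (EQ_out ED) ?addr0// /inQ /= (negbTE xab) andbF.
Qed.

(** At a single good time [c0] is a section of [D]. *)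
Let sc0 : sqint leb c0.
Proof.
have gd : {ae leb, forall t, t \in `]0, T[ ->
    {ae leb, forall x, D (t, x) = c0 x} /\ sqint leb (fun x => D (t, x))}.
  apply: ae_mono2 good (sqint_sections (EQ_sqint ED)) => t h1 h2 t0T; split => //.
  by apply: ae_mono (h1 t0T) => x [].
have [t t0T /(_ t0T)[h1 h2]] := ae_ex_itv T_gt0 gd.
exact: (@sqint_ae _ _ R leb (fun x => D (t, x)) c0 mc0 h1 h2).
Qed.

Let J_tail t0 : t0 \in `[0, T] ->
  {ae leb, forall x, (J t0 \_ `]a, b[) x = c0 x + tail_int T psi t0 x}.
Proof.
move=> t0T; have [J2 Jc] := J_cont.
have sJ t : t \in `[0, T] -> sqint leb (J t \_ `]a, b[) by move=> h; apply/inLp2P; exact: J2.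
have spsi := EQ_sqint Epsi.
have sI t : t \in `[0, T] -> sqint leb (tail_int T psi t).
  by rewrite in_itv /= => /andP[_ tT]; exact: sqint_tail_int.
pose r x := (J t0 \_ `]a, b[) x - (c0 x + tail_int T psi t0 x).
have sr : sqint leb r by exact: (sqintB (sJ _ t0T) (sqintD sc0 (sI _ t0T))).
suff r0 : ip leb r r <= 0.
  have := ip_eq0 sr (le_anti (introT andP (conj r0 (ip_ge0 _ _)))).
  by apply: ae_mono => x /eqP; rewrite /r subr_eq0 => /eqP.
apply/ler_addgt0Pr => e e0; rewrite add0r.
set P := ip leb2 psi psi; have P0 : 0 <= P by exact: ip_ge0.
(* [dl^2 <= e / 4] and, below, [rho * (P + 1) = e / 4]; the factors 2 of [ip_add_le] make the two
   contributions add up to at most [e]. *)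
pose dl := Num.min 1 (e / 4).
have dl0 : 0 < dl by rewrite lt_min ltr01 divr_gt0.
pose rho := e / (4 * (P + 1)).
have rho0 : 0 < rho by rewrite divr_gt0// mulr_gt0// ltr_wpDl.
have := Jc _ t0T; move=> /(_ [set y | (y < dl%:E)%E]) [].
  by apply: open_ereal_lt'; rewrite lte_fin.
move=> /= eps eps0 near0.
move: (t0T); rewrite in_itv /= => /andP[t00 t0T'].
pose del := Num.min eps rho.
have del0 : 0 < del by rewrite lt_min eps0.
have lu : Num.max 0 (t0 - del) < Num.min T (t0 + del).
  rewrite gt_max !lt_min T_gt0 /=; apply/andP; split; first lra.
  by apply/andP; split; lra.
have [t ti gt] := ae_ex_itv lu good.
move: ti; rewrite in_itv /= gt_max lt_min => /andP[/andP[t_0 td] /andP[tT dt]].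
have tab : t \in `]0, T[ by rewrite in_itv /= t_0.
have tab' : t \in `[0, T] by exact: subset_itv_oo_cc.
have dist : `|t0 - t| < del by rewrite ltr_norml; lra.
have Jclose : (normL2 leb `]a, b[ (fun x => J t x - J t0 x)%R < dl%:E)%E.
  apply: near0 => //=; apply: lt_le_trans dist _; by rewrite ge_min lexx.
pose u := (J t0 \_ `]a, b[) \- (J t \_ `]a, b[).
have su : sqint leb u by exact: (sqintB (sJ _ t0T) (sJ _ tab')).
have uu : ip leb u u <= dl ^+ 2.
  have uE : (fun x => J t x - J t0 x) \_ `]a, b[ = \- u.
    by apply/funext => x; rewrite /u /= !patchE; case: ifP => _; rewrite opprB ?subrr.
  move: Jclose; rewrite /normL2 uE Lnorm2E; last exact: sqintN.
  rewrite lte_fin => h.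
  have -> : ip leb u u = ip leb (\- u) (\- u).
    exact: (esym (ipNN _ _)).
  rewrite -[leLHS]sqr_sqrtr ?ip_ge0// lerXn2r ?nnegrE ?sqrtr_ge0 ?(ltW dl0)//.
  exact: ltW.
pose v x := tail_int T psi t x - tail_int T psi t0 x.
have [sv vv] : sqint leb v /\ ip leb v v <= `|t0 - t| * P.
  have [tt|tt] := leP t t0.
    have [s1 s2] := tail_int_cont spsi tt t0T'.
    by split => //; rewrite ger0_norm ?subr_ge0.
  have [s1 s2] := tail_int_cont spsi (ltW tt) (ltW tT).
  have vE : v = \- (fun x => tail_int T psi t0 x - tail_int T psi t x).
    by apply/funext => x /=; rewrite opprB.
  split; first by rewrite vE; exact: sqintN.
  have -> : `|t0 - t| = t - t0 by rewrite distrC ger0_norm// subr_ge0 ltW.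
  rewrite vE; apply: le_trans s2; rewrite le_eqVlt; apply/orP; left; apply/eqP.
  exact: ipNN.
have ruv : {ae leb, forall x, r x = (u \+ v) x}.
  by apply: ae_mono (gt tab) => x [h _]; rewrite /r /u /v /= h; ring.
have suv : sqint leb (u \+ v) by exact: sqintD.
have [mr _] := sr; have [muv _] := suv.
rewrite (ip_ae mr muv mr muv ruv ruv); apply: (le_trans (ip_add_le su sv)).
have h1 : dl ^+ 2 <= e / 4.
  rewrite expr2 -[leRHS]mulr1; apply: ler_pM; rewrite ?(ltW dl0)// ge_min lexx ?orbT//.
have h2 : `|t0 - t| * P <= e / 4.
  have hr : `|t0 - t| <= rho.
    by apply: le_trans (ltW dist) _; rewrite ge_min lexx orbT.
  have : rho * (P + 1) = e / 4 by rewrite /rho; field; rewrite gt_eqF// ltr_wpDl.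
  have : `|t0 - t| * P <= rho * (P + 1) by rewrite ler_pM// lerDl.
  lra.
lra.
Qed.

Let c0_0 : {ae leb, forall x, c0 x = 0}.
Proof.
have TT : T \in `[0, T] by rewrite in_itv /= lexx ltW.
apply: ae_mono2 (J_tail TT) JT => x h1 h2.
have [xab|xab] := boolP ((x : R) \in `]a, b[); last exact: c0_out.
by move: h1; rewrite tail_int_T addr0 patchE mem_setE xab h2.
Qed.

(** [J] and [F] are tied at almost every time only, while the final condition concerns [J T] alone.
    As [c0] is square integrable, continuity in L^2 carries [J t = c0 + tail_int T psi t] from
    almost every [t] to all of [[0, T]]; at [T] it reads [c0 = 0], and at 0 it gives the initial
    trace. *)
Lemma tail_representation :
  {ae (@lebesgue_measure R \x @lebesgue_measure R)%E, forall z, F z = tailQ psi z} /\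
  {ae leb, forall x, x \in `]a, b[ -> J 0 x = tail_int T psi 0 x}.
Proof.
split; last first.
  have T0 : 0 \in `[0, T] by rewrite in_itv /= lexx ltW.
  apply: ae_mono2 (J_tail T0) c0_0 => x h1 h2 xab.
  by move: h1; rewrite h2 add0r patchE mem_setE xab.
have : {ae (@lebesgue_measure R \x @lebesgue_measure R)%E, forall z, D z = 0}.
  apply: prod_ae0_swap => //; apply: ae_mono2 Dc0 c0_0 => x hx cx.
  have [xab|xab] := boolP ((x : R) \in `]a, b[); last first.
    by apply: ae_all => t; rewrite (EQ_out ED)// /inQ /= (negbTE xab) andbF.
  apply: ae_mono (hx xab) => t ht.
  have [t0T|t0T] := boolP ((t : R) \in `]0, T[); first by rewrite ht.
  by rewrite (EQ_out ED)// /inQ /= (negbTE t0T).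
by apply: ae_mono => z /eqP; rewrite /D subr_eq0 => /eqP.
Qed.

End Limit.

End TimeRepresentation.

(** * Test functions as solutions of the backward problem *)

Lemma ae_and d (X : measurableType d) (K : realType) (m : {measure set X -> \bar K})
    (P Q : X -> Prop) : {ae m, forall x, P x} -> {ae m, forall x, Q x} ->
  {ae m, forall x, P x /\ Q x}.
Proof. by apply: ae_mono2. Qed.

Section Correspondence.
Context {R : realType}.
Variables (T a b gamma alpha : R) (T_gt0 : 0 < T) (ab : a < b).
Hypotheses (gamma_gt0 : 0 < gamma) (gamma_le1 : gamma <= 1).
Hypotheses (alpha_gt0 : 0 < alpha) (alpha_le1 : alpha <= 1).
Implicit Types (f g h phi psi w : R * R -> R) (u v : R -> R) (x t s : R).

(** The kernel of [W]: transposing the left kernel on [(0, T)] gives the right integral of order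
    [gamma]. *)
Let l : R -> R -> R := fun t s => jker 0 T gamma s t.
Let k : R -> R -> R := jker a b alpha.
Let fr := fractional_side_right T_gt0.

Variables (Cl Ck : R) (sl : schur leb l Cl) (sk : schur leb k Ck).

Lemma jkerT_out t s : ~~ ((t \in `]0, T[) && (s \in `]0, T[)) -> l t s = 0.
Proof. by move=> ts; rewrite /l /jker (fkerT_out T_gt0)// mulr0. Qed.

Lemma jker_out x s : ~~ ((x \in `]a, b[) && (s \in `]a, b[)) -> k x s = 0.
Proof.
have fl := fractional_side_left ab.
move=> xs; rewrite /k /jker (fs_out fl) ?mulr0//; apply: contra xs => /andP[xab sx].
by rewrite xab (fs_sub fl xab sx).
Qed.

Lemma jkerT_positive u : sqint leb u -> 0 <= ip leb (kop leb l u) u.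
Proof.
move=> su; rewrite (kop_adjoint sl su su) ipC.
have kE : kop leb (fun x s => l s x) u = cker gamma \*o kop leb (fker 0 T gamma) u.
  apply/funext => x; rewrite /kop /= -Rintegral_scale; last first.
    have [mu _] := su; apply: measurable_funM => //.
    exact: (measurable_pair1 x (measurable_fker _ _ _)).
  by apply: eq_Rintegral => s _; rewrite mulrA.
rewrite kE ipZl//; last exact: (kop_sqint (schur_fker T_gt0 gamma_gt0) su).
rewrite mulr_ge0 ?(ltW (cker_gt0 gamma_gt0 gamma_le1))//.
by apply: fker_positive => //; rewrite gamma_gt0.
Qed.

Lemma jkerT_injective u : sqint leb u ->
  {ae leb, forall x, kop leb (fun x s => k s x) u x = 0} ->
  {ae leb, forall x, x \in `]a, b[ -> u x = 0}.
Proof.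
move=> su uz; apply: (kop_side_inj (fractional_side_right ab) alpha_gt0 alpha_le1 su).
by apply: ae_mono uz => x h _.
Qed.

(** [I_T^(1 - gamma)] as a map of L^2(Q), jointly measurable in both variables; the order 0 has no
    kernel and is treated apart. *)
Definition fracQ f : R * R -> R := cutQ T a b (fun z =>
  if gamma == 1 then f z
  else (Gamma (1 - gamma))^-1 * op1 leb (fun t s => fker 0 T (1 - gamma) s t) f z).

Lemma EQ_fracQ f : EQ T a b f -> EQ T a b (fracQ f).
Proof.
move=> Ef; have sf := EQ_sqint Ef; apply: EQ_cutQ; case: eqP => // /eqP gn.
have g1 : 0 < 1 - gamma by rewrite subr_gt0 lt_neqAle gn.
have [C sC] := fs_schur fr g1.
exact: (sqintZ _ (op1_sqint sC sf)).
Qed.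

Lemma fracQE f t x : EQ T a b f -> inQ T a b (t, x) ->
  fracQ f (t, x) = frac_int_right T (1 - gamma) (fun s => f (s, x)) t.
Proof.
move=> Ef tx; rewrite /fracQ /cutQ tx; have /andP[/= t0T _] := tx.
case: eqP => [->|/eqP gn]; first by rewrite subrr (fs_int0 fr).
rewrite (fs_int fr)//; last by rewrite subr_eq0 eq_sym.
congr (_ * _); rewrite /op1 /=; congr (kop leb _ _ t); apply/funext => s.
rewrite patchE mem_setE; case: ifPn => // s0T.
by rewrite (EQ_out Ef)// /inQ /= (negbTE s0T).
Qed.

Lemma frac_int_right_cutQ (e : R) phi t x : inQ T a b (t, x) ->
  frac_int_right T e (fun s => phi (s, x)) t =
  frac_int_right T e (fun s => cutQ T a b phi (s, x)) t.
Proof.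
move=> /andP[/= t0T xab]; rewrite /frac_int_right /cutQ /inQ /= t0T xab; case: ifP => // _.
congr (_ * _); apply: eq_Rintegral => s; rewrite inE /= in_itv /= => /andP[ts sT].
by move: t0T; rewrite !in_itv /= => /andP[t0 _]; rewrite (lt_trans t0 ts) sT.
Qed.

Lemma fracQ_tailQ psi : EQ T a b psi ->
  {ae (@lebesgue_measure R \x @lebesgue_measure R)%E, forall z,
     fracQ (op1 leb l psi) z = tailQ T psi z}.
Proof.
move=> Epsi; have Ephi := EQ_op1 sl jkerT_out Epsi.
have EF := EQ_fracQ Ephi; have EI := EQ_tailQ T_gt0 Epsi.
have sd := sqintB (EQ_sqint EF) (EQ_sqint EI); have [md _] := sd.
suff : {ae (@lebesgue_measure R \x @lebesgue_measure R)%E, forall z,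
    (fracQ (op1 leb l psi) \- tailQ T psi) z = 0}.
  by apply: ae_mono => z /eqP; rewrite subr_eq0 => /eqP.
apply: prod_ae0_swap => //.
apply: ae_mono (sqint_sections (sqint_swap (EQ_sqint Epsi))) => x spx.
have [xab|xab] := boolP ((x : R) \in `]a, b[); last first.
  apply: ae_all => t /=; rewrite (EQ_out EF) ?(EQ_out EI) ?subrr// /inQ /= (negbTE xab) andbF//.
have [mk _] := kop_sqint sl spx.
have mphi : measurable_fun `]0, T[ (fun t => op1 leb l psi (t, x)).
  exact: (measurable_funTS mk).
have := frac_int_side fr gamma_gt0 gamma_le1 spx mphi (ae_all leb (fun t _ => erefl)).
apply: ae_mono => t ht /=.
have [t0T|t0T] := boolP ((t : R) \in `]0, T[); last first.
  by rewrite (EQ_out EF) ?(EQ_out EI) ?subrr// /inQ /= (negbTE t0T).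
by rewrite fracQE ?(tailQE T_gt0) ?/inQ ?t0T ?xab// ht// subrr.
Qed.

(** On almost every line of constant [x], [phi] and [W psi] have the same image under
    [I_T^(1 - gamma)], which is injective. *)
Lemma fracQ_inj phi psi : EQ T a b phi -> EQ T a b psi ->
  {ae (@lebesgue_measure R \x @lebesgue_measure R)%E, forall z, fracQ phi z = tailQ T psi z} ->
  {ae (@lebesgue_measure R \x @lebesgue_measure R)%E, forall z, phi z = op1 leb l psi z}.
Proof.
move=> Ephi Epsi h; have Ep := EQ_op1 sl jkerT_out Epsi.
have sd := sqintB (EQ_sqint Ephi) (EQ_sqint Ep); have [md _] := sd.
suff : {ae (@lebesgue_measure R \x @lebesgue_measure R)%E, forall z,
    (phi \- op1 leb l psi) z = 0}.
  by apply: ae_mono => z /eqP; rewrite subr_eq0 => /eqP.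
apply: prod_ae0_swap => //.
have h1 := ae_prod (ae_swap h); have h2 := ae_prod (ae_swap (fracQ_tailQ Epsi)).
have h3 : {ae leb, forall x, {ae leb, forall t, fracQ phi (t, x) = fracQ (op1 leb l psi) (t, x)}}.
  by apply: ae_mono2 h1 h2 => x; apply: ae_mono2 => t /= -> ->.
have h4 := sqint_sections (sqint_swap (EQ_sqint Ephi)).
have h5 := sqint_sections (sqint_swap (EQ_sqint Ep)).
apply: ae_mono2 h3 (ae_and h4 h5) => x hx [s1 s2].
have [xab|xab] := boolP ((x : R) \in `]a, b[); last first.
  by apply: ae_all => t /=; rewrite (EQ_out Ephi) ?(EQ_out Ep) ?subrr// /inQ /= (negbTE xab) andbF.
have s1' := sqint_restrict 0 T s1; have s2' := sqint_restrict 0 T s2.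
have hI : {ae leb, forall t, t \in `]0, T[ ->
    frac_int_right T (1 - gamma) (fun t => phi (t, x)) t =
    frac_int_right T (1 - gamma) (fun t => op1 leb l psi (t, x)) t}.
  by apply: ae_mono hx => t ht t0T; rewrite -!fracQE// /inQ /= t0T xab.
have := frac_int_side_inj fr gamma_gt0 gamma_le1 s1' s2' hI.
apply: ae_mono => t ht /=.
have [t0T|t0T] := boolP ((t : R) \in `]0, T[); first by rewrite ht// subrr.
by rewrite (EQ_out Ephi) ?(EQ_out Ep) ?subrr// /inQ /= (negbTE t0T).
Qed.

Lemma inLpQP f : inLp leb2 2%:E (domQ T a b) f <-> sqint leb2 (cutQ T a b f).
Proof. by rewrite /inLp restrict_domQ; exact: Lfun2P. Qed.

Lemma Rintegral_domQ f : \int[leb2]_(z in domQ T a b) f z = \int[leb2]_z cutQ T a b f z.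
Proof. by rewrite Rintegral_mkcond restrict_domQ. Qed.

Variables (beta q bt qt : R -> R) (beta0 M : R).
Hypotheses (mbeta : measurable_fun `]a, b[ beta) (mq : measurable_fun `]a, b[ q).
Hypotheses (mbt : measurable_fun setT bt) (mqt : measurable_fun setT qt).
Hypotheses (beta0_gt0 : 0 < beta0) (bt_ge : forall x, beta0 <= bt x).
Hypotheses (qt_ge0 : forall x, 0 <= qt x).
Hypotheses (btM : forall x, bt x <= M) (qtM : forall x, qt x <= M).
Hypotheses (btE : {ae leb, forall x, x \in `]a, b[ -> beta x = bt x})
  (qtE : {ae leb, forall x, x \in `]a, b[ -> q x = qt x}).

Let btn x : `|bt x| <= M.
Proof. by rewrite ger0_norm// (le_trans (ltW beta0_gt0)). Qed.

Let qtn x : `|qt x| <= M. Proof. by rewrite ger0_norm. Qed.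

Let bt_gt0 x : 0 < bt x. Proof. exact: lt_le_trans (bt_ge x). Qed.

Let kT : R -> R -> R := fun x s => k s x.
Let skT : schur leb kT Ck. Proof. exact: schur_transpose. Qed.
Let kTout x s : ~~ ((x \in `]a, b[) && (s \in `]a, b[)) -> kT x s = 0.
Proof. by rewrite andbC; exact: jker_out. Qed.

Let EJ f : EQ T a b f -> EQ T a b (op2 leb k f). Proof. exact: (EQ_op2 sk jker_out). Qed.
Let EW f : EQ T a b f -> EQ T a b (op1 leb l f). Proof. exact: (EQ_op1 sl jkerT_out). Qed.

Let EB f : EQ T a b f -> EQ T a b (fun z => bt z.2 * f z).
Proof.
move=> Ef; split; first exact: (sqint_space_mul mbt btn (EQ_sqint Ef)).
by move=> z zQ; rewrite (EQ_out Ef zQ) mulr0.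
Qed.

Let Eq f : EQ T a b f -> EQ T a b (fun z => qt z.2 * f z).
Proof.
move=> Ef; split; first exact: (sqint_space_mul mqt qtn (EQ_sqint Ef)).
by move=> z zQ; rewrite (EQ_out Ef zQ) mulr0.
Qed.

Let ellipticT := elliptic (EQ T a b) (@ipQ R) (formQ k bt qt) (op2 leb k).

Let EB_sub f g : EQ T a b f -> EQ T a b g -> EQ T a b (fun z => f z - g z).
Proof.
move=> Ef Eg; split; first exact: (sqintB (EQ_sqint Ef) (EQ_sqint Eg)).
by move=> z zQ; rewrite (EQ_out Ef zQ) (EQ_out Eg zQ) subrr.
Qed.

Let formQE g z : EQ T a b g -> EQ T a b z -> forall w, EQ T a b w ->
  formQ k bt qt g z - ip leb2 w (op2 leb k z) =
  ip leb2 (fun y => bt y.2 * g y - op2 leb kT (fun y => w y - qt y.2 * op2 leb k g y) y) z.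
Proof.
move=> Eg Ez w Ew; have EqJ := Eq (EJ Eg); have Ep := EB_sub Ew EqJ.
have Ekp : EQ T a b (op2 leb kT (fun y => w y - qt y.2 * op2 leb k g y)).
  exact: (EQ_op2 skT kTout).
have sz := EQ_sqint Ez; have sJz := EQ_sqint (EJ Ez).
have e1 := ipBl (EQ_sqint (EB Eg)) (EQ_sqint Ekp) sz.
have e2 := ipBl (EQ_sqint Ew) (EQ_sqint EqJ) sJz.
have e3 := op2_adjoint sk sz (EQ_sqint Ep).
have e4 : ip leb2 (op2 leb kT (fun y => w y - qt y.2 * op2 leb k g y)) z =
    ip leb2 (fun y => w y - qt y.2 * op2 leb k g y) (op2 leb k z).
  by rewrite [LHS]ipC -e3 ipC.
apply: esym; apply: (etrans e1); rewrite e4; apply: (etrans (congr1 (fun c => _ - c) e2)).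
rewrite /formQ; ring.
Qed.

(** By [formQE] the weak equation says that the defect of this identity is orthogonal to [EQ]; the
    defect belongs to [EQ], so it can be tested against itself. *)
Lemma elliptic_ae w g : EQ T a b w -> EQ T a b g -> ellipticT w g ->
  {ae (@lebesgue_measure R \x @lebesgue_measure R)%E, forall z,
    bt z.2 * g z = op2 leb kT (fun z => w z - qt z.2 * op2 leb k g z) z}.
Proof.
move=> Ew Eg wg; have Ep := EB_sub Ew (Eq (EJ Eg)).
have Ekp := EQ_op2 skT kTout Ep; have Er := EB_sub (EB Eg) Ekp.
have := formQE Eg Er Ew; have := wg _ Er; rewrite /ipQ => ->; rewrite subrr => /esym r0.
apply: ae_mono (ip_eq0 (EQ_sqint Er) r0) => z /eqP.
by rewrite subr_eq0 => /eqP.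
Qed.

(** [g'] stands for the test function [phi]: in the application [g] is defined from [phi] by the
    equation, and [phi = J g] is known almost everywhere only. *)
Lemma elliptic_intro w g g' : EQ T a b w -> EQ T a b g -> EQ T a b g' ->
  {ae (@lebesgue_measure R \x @lebesgue_measure R)%E, forall z, g' z = op2 leb k g z} ->
  (forall z, bt z.2 * g z = op2 leb kT (fun z => w z - qt z.2 * g' z) z) ->
  ellipticT w g.
Proof.
move=> Ew Eg Eg' g'E gE z Ez; have EqJ := Eq Eg'; have Ep := EB_sub Ew EqJ.
have sz := EQ_sqint Ez; have sJz := EQ_sqint (EJ Ez).
have e2 := ipBl (EQ_sqint Ew) (EQ_sqint EqJ) sJz.
have e3 := op2_adjoint sk sz (EQ_sqint Ep).
have e1 : ip leb2 (fun y => bt y.2 * g y) z = ip leb2 (fun y => w y - qt y.2 * g' y) (op2 leb k z).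
  have -> : (fun y => bt y.2 * g y) = op2 leb kT (fun z => w z - qt z.2 * g' z).
    by apply/funext.
  by rewrite [LHS]ipC -e3 ipC.
have e4 : ip leb2 (fun y => qt y.2 * op2 leb k g y) (op2 leb k z) =
    ip leb2 (fun y => qt y.2 * g' y) (op2 leb k z).
  have [m1 _] := EQ_sqint (Eq (EJ Eg)); have [m2 _] := EQ_sqint EqJ.
  have [m3 _] := sJz.
  apply: (ip_ae m1 m2 m3 m3 _ (ae_all _ (fun y => erefl))).
  by apply: ae_mono g'E => y ->.
rewrite /formQ e1 e4; move: e2; rewrite /ipQ => ->; ring.
Qed.

Let ae_sections (f g : R * R -> R) :
  {ae (@lebesgue_measure R \x @lebesgue_measure R)%E, forall z, f z = g z} ->
  {ae leb, forall t, {ae leb, forall x, f (t, x) = g (t, x)}}.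
Proof. exact: ae_prod. Qed.

(** The explicit solutions are admissible tests: [phi = W (J g) = J (W g)], where the first form
    gives the time regularity and the second, with [W g] elliptic for [W eta], puts almost every
    section in the graph of A. *)
Lemma elliptic_in_Psi eta g : EQ T a b eta -> EQ T a b g -> ellipticT eta g ->
  exists phi J, in_Psi T a b gamma alpha beta q phi (op1 leb l eta) (op2 leb k g) J.
Proof.
move=> Eeta Eg eg; pose psi := op2 leb k g; have Epsi : EQ T a b psi by exact: EJ.
pose G := op1 leb l g; have EG : EQ T a b G by exact: EW.
pose phi := op1 leb l psi; have Ephi : EQ T a b phi by exact: EW.
pose w := op1 leb l eta; have Ew : EQ T a b w by exact: EW.
have wG : ellipticT w G.
  exact: (ellipticQ_W sl sk jkerT_out jker_out mbt mqt beta0_gt0 bt_ge qt_ge0 btM qtM Eeta Eg eg).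
exists phi, (tail_int T psi).
have cutE f : EQ T a b f -> cutQ T a b f = f.
  by move=> Ef; apply/funext => z; rewrite /cutQ; case: ifPn => // zQ; rewrite (EQ_out Ef).
have inE f : EQ T a b f -> inLp leb2 2%:E (domQ T a b) f.
  by move=> Ef; apply/inLpQP; rewrite (cutE _ Ef); exact: (EQ_sqint Ef).
have GJ : {ae (@lebesgue_measure R \x @lebesgue_measure R)%E, forall z,
    phi z = op2 leb k G z} by exact: (op_comm sl sk (EQ_sqint Eg)).
have FI := fracQ_tailQ Epsi.
have restr f t : EQ T a b f -> (fun x => f (t, x)) \_ `]a, b[ = (fun x => f (t, x)).
  move=> Ef; apply/funext => x; rewrite patchE mem_setE; case: ifPn => // xab.
  by rewrite (EQ_out Ef)// /inQ /= (negbTE xab) andbF.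
split; first exact: inE.
- split; first exact: inE.
  have h1 := ae_sections GJ; have h2 := ae_sections (elliptic_ae Ew EG wG).
  have h3 := sqint_sections (EQ_sqint Ephi); have h4 := sqint_sections (EQ_sqint Ew).
  have h5 := sqint_sections (EQ_sqint EG).
  apply: ae_mono2 (ae_and h1 h2) (ae_and h3 (ae_and h4 h5)) => t [a1 a2] [s1 [s2 s3]] t0T.
  apply: (@graphA_intro _ a b alpha ab alpha_gt0 alpha_le1 beta q bt qt M mbeta mq mbt mqt
    btn qtn btE qtE _ _ (fun x => G (t, x))).
  + by rewrite (restr phi t Ephi); exact: s1.
  + by rewrite (restr w t Ew); exact: s2.
  + exact: s3.
  + by move=> x xab; rewrite (EQ_out EG)// /inQ /= (negbTE xab) andbF.
  + by apply: ae_mono a1 => x h _; exact: h.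
  + rewrite (restr phi t Ephi) (restr w t Ew); have [mphi _] := EQ_sqint Ephi; have [mw _] := EQ_sqint Ew.
    have [mJG _] := EQ_sqint (EJ EG).
    apply: ae_mono a2 => x h; apply: (etrans h); rewrite /op2 /=.
    apply: (kop_side_eq (fractional_side_right ab) (cker alpha) x alpha_gt0).
    * apply: measurable_funB; first exact: (measurable_pair1 t mw).
      apply: (measurable_funM mqt); exact: (measurable_pair1 t mJG).
    * apply: measurable_funB; first exact: (measurable_pair1 t mw).
      apply: (measurable_funM mqt); exact: (measurable_pair1 t mphi).
    * by apply: ae_mono a1 => s hs _; rewrite hs.
- split; first exact: inE.
  have h1 := ae_prod (ae_swap FI).
  have h2 := sqint_sections (sqint_swap (EQ_sqint Epsi)).
  apply: ae_mono2 h1 h2 => x hx sx xab.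
  have ip : leb.-integrable `]0, T[ (EFin \o (fun t => - psi (t, x))).
    have := sqintN sx => sN; exact: sqint_integrable_itv sN.
  (* The integral from [t] to [T] is the one from 0 to [T] minus the primitive of [psi]; hence this
     constant and the minus sign in [is_right_RL]. *)
  apply: (@wderiv_primitive _ _ _ _ _ (tail_int T psi 0 x)) => //.
    apply: (measurable_frac_int_right T_gt0) => //.
    have [mphi _] := EQ_sqint Ephi; apply: measurable_funTS.
    exact: (measurable_pair2 x mphi).
  apply: ae_mono hx => t ht t0T; move: (t0T); rewrite in_itv /= => /andP[t0 tT].
  rewrite -(fracQE Ephi) ?/inQ /= ?t0T ?xab//.
  move: ht => /= ->; rewrite tailQE//.
  have d := tail_int_diff (ltW t0) (ltW tT) sx.
  have -> : \int[leb]_(s in `]0, t[) - psi (s, x) = - \int[leb]_(s in `]0, t[) psi (s, x).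
    have i0t := sqint_integrable_itv 0 t sx.
    rewrite -[RHS]mulN1r -RintegralZl//.
    by apply: eq_Rintegral => s _; rewrite mulN1r.
  rewrite -d; ring.
- split; last first.
    have h1 := ae_sections FI.
    apply: ae_mono h1 => t ht t0T; apply: ae_mono ht => x hx xab.
    rewrite -(fracQE Ephi) ?/inQ /= ?t0T ?xab//.
    by rewrite hx tailQE.
  have spsi := EQ_sqint Epsi.
  have restrI t : tail_int T psi t \_ `]a, b[ = tail_int T psi t.
    apply/funext => x; rewrite patchE mem_setE; case: ifPn => // xab.
    by rewrite (tail_int_out _ Epsi).
  split.
    move=> t; rewrite in_itv /= => /andP[_ tT]; apply/inLp2P; rewrite restrI.
    exact: sqint_tail_int.
  move=> t0 t0T; have [t00 t0T'] : 0 <= t0 /\ t0 <= T by move: t0T; rewrite in_itv /= => /andP.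
  set P := ip leb2 psi psi; have P0 : 0 <= P by exact: ip_ge0.
  have bound t : t \in `[0, T] -> (normL2 leb `]a, b[
      (fun x => tail_int T psi t x - tail_int T psi t0 x)%R <= (Num.sqrt (`|t - t0| * P))%:E)%E.
    rewrite in_itv /= => /andP[t_0 tT]; rewrite /normL2.
    have [st tle] : sqint leb (fun x => tail_int T psi t x - tail_int T psi t0 x) /\
        ip leb (fun x => tail_int T psi t x - tail_int T psi t0 x)
               (fun x => tail_int T psi t x - tail_int T psi t0 x) <= `|t - t0| * P.
      have [tt|tt] := leP t t0.
        have [s1 s2] := tail_int_cont spsi tt t0T'.
        have -> : `|t - t0| = t0 - t by rewrite distrC ger0_norm// subr_ge0.
        by [].
      have [s1 s2] := tail_int_cont spsi (ltW tt) tT.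
      have -> : (fun x => tail_int T psi t x - tail_int T psi t0 x) =
          \- (fun x => tail_int T psi t0 x - tail_int T psi t x).
        by apply/funext => x /=; rewrite opprB.
      have -> : `|t - t0| = t - t0 by rewrite ger0_norm// subr_ge0 ltW.
      by rewrite ipNN; split => //; exact: sqintN.
    have -> : (fun x => tail_int T psi t x - tail_int T psi t0 x) \_ `]a, b[ =
        (fun x => tail_int T psi t x - tail_int T psi t0 x).
      apply/funext => x; rewrite patchE mem_setE; case: ifPn => // xab.
      by rewrite !(tail_int_out _ Epsi)// subrr.
    by rewrite (Lnorm2E st) lee_fin ler_wsqrtr.
  have lim : (Num.sqrt (`|t - t0| * P))%:E @[t --> within `[0, T] (nbhs t0)] --> 0%E.
    apply: cvg_EFin; first by near=> t.
    apply: (@cvg_within_filter _ _ _ (nbhs t0)).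
    have c0 : {for t0, continuous (fun t : R => Num.sqrt (`|t - t0| * P))}.
      apply: (@continuous_comp _ _ _ (fun t : R => `|t - t0| * P) Num.sqrt); last exact: sqrt_continuous.
      apply: cvgM; last exact: cvg_cst.
      by apply: (@cvg_norm _ R^o); apply: cvgB; [exact: cvg_id|exact: cvg_cst].
    by move: c0; rewrite /prop_for /continuous_at subrr normr0 mul0r sqrtr0.
  apply: (@squeeze_cvge _ _ _ _ (fun=> 0%E) _ (fun t => (Num.sqrt (`|t - t0| * P))%:E)) => //.
    near=> t; rewrite Lnorm_ge0 /=; apply: bound; near: t; exact: withinT.
  exact: cvg_cst.
- by apply: ae_all => x _; rewrite tail_int_T.
Unshelve. all: by end_near. Qed.

Lemma measurable_invr_ge (c : R -> R) : measurable_fun setT c -> (forall x, 0 < c x) ->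
  measurable_fun setT (fun x => (c x)^-1).
Proof.
move=> mc c0; have -> : (fun x => (c x)^-1) = (fun x => (c x) `^ (-1)).
  by apply/funext => x; rewrite powR_inv1// ltW.
exact: (measurableT_comp (measurable_powR (-1)) mc).
Qed.

(** In time, [tail_representation] and [fracQ_inj] give [phi = W psi]. In space, [graphA_elim] holds
    at almost every time separately, and the task is to assemble the sections into a single function
    on Q. *)
Lemma in_Psi_backward phi w psi (J : R -> R -> R) :
  in_Psi T a b gamma alpha beta q phi w psi J ->
  exists g, [/\ backwardQ T a b l k bt qt (cutQ T a b psi) (cutQ T a b w) g,
    {ae (@lebesgue_measure R \x @lebesgue_measure R)%E, forall z,
       cutQ T a b phi z = op1 leb l (cutQ T a b psi) z},
    {ae leb, forall x, x \in `]a, b[ -> J 0 x = tail_int T (cutQ T a b psi) 0 x} &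
    {ae leb, forall t, t \in `]0, T[ ->
       frac_trace a b alpha (fun x => phi (t, x)) b = \int[leb]_x g (t, x)}].
Proof.
move=> [/inLpQP sphi [/inLpQP sw gA] [/inLpQP spsi RL] [Jc JF] JT].
set phi0 := cutQ T a b phi in sphi *; set w0 := cutQ T a b w in sw *.
set psi0 := cutQ T a b psi in spsi *.
have out h z : ~~ inQ T a b z -> cutQ T a b h z = 0 by rewrite /cutQ => /negbTE ->.
have Ephi : EQ T a b phi0 by split => // z; exact: out.
have Ew : EQ T a b w0 by split => // z; exact: out.
have Epsi : EQ T a b psi0 by split => // z; exact: out.
have cutI h t x : t \in `]0, T[ -> x \in `]a, b[ -> cutQ T a b h (t, x) = h (t, x).
  by move=> t0T xab; rewrite /cutQ /inQ /= t0T xab.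
have EF := EQ_fracQ Ephi.
have Faff : {ae leb, forall x, x \in `]a, b[ -> exists c, {ae leb, forall t, t \in `]0, T[ ->
    fracQ phi0 (t, x) = c + tail_int T psi0 t x}}.
  apply: ae_mono2 RL (sqint_sections (sqint_swap spsi)) => x hx sx xab.
  have [c cP] := is_wderivP T_gt0 (hx xab).
  exists (c - tail_int T psi0 0 x); apply: ae_mono cP => t ht t0T.
  have tQ : inQ T a b (t, x) by rewrite /inQ /= t0T xab.
  rewrite (fracQE Ephi tQ) -(frac_int_right_cutQ (1 - gamma) phi tQ) ht//.
  move: (t0T); rewrite in_itv /= => /andP[t0 tT].
  have d := tail_int_diff (ltW t0) (ltW tT) sx.
  have -> : primitive 0 (fun t => - psi (t, x)) t = - \int[leb]_(s in `]0, t[) psi0 (s, x).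
    have i0t := sqint_integrable_itv 0 t sx.
    rewrite -[RHS]mulN1r -RintegralZl//; apply: eq_Rintegral => s.
    rewrite inE /= in_itv /= => /andP[s0 st].
    by rewrite mulN1r /psi0 cutI// in_itv /= s0 (lt_trans st tT).
  rewrite -d; ring.
have JF' : {ae leb, forall t, t \in `]0, T[ ->
    {ae leb, forall x, x \in `]a, b[ -> J t x = fracQ phi0 (t, x)}}.
  apply: ae_mono JF => t ht t0T; apply: ae_mono (ht t0T) => x hx xab.
  have tQ : inQ T a b (t, x) by rewrite /inQ /= t0T xab.
  by rewrite hx// (fracQE Ephi tQ) -(frac_int_right_cutQ (1 - gamma) phi tQ).
have [FI J0] := tail_representation T_gt0 EF Epsi Faff Jc JF' JT.
have phiW := fracQ_inj Ephi Epsi FI.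
have EqP := Eq Ephi; have Ep := EB_sub Ew EqP.
pose p z := w0 z - qt z.2 * phi0 z.
have Ekp : EQ T a b (op2 leb kT p) by exact: (EQ_op2 skT kTout Ep).
(* The derivatives [gs t] are chosen for each [t] and need not be measurable in [t]. The elliptic
   equation, solved for [g], provides a jointly measurable function with the same sections almost
   everywhere. *)
pose g z := (bt z.2)^-1 * op2 leb kT p z.
have btV x : `|(bt x)^-1| <= beta0^-1.
  by rewrite ger0_norm ?invr_ge0 ?(ltW (bt_gt0 x))// lef_pV2 ?posrE.
have Eg : EQ T a b g.
  split; first exact: (sqint_space_mul (measurable_invr_ge mbt bt_gt0) btV (EQ_sqint Ekp)).
  by move=> z zQ; rewrite /g (EQ_out Ekp zQ) mulr0.
have bg z : bt z.2 * g z = op2 leb kT p z by rewrite /g mulVKf// gt_eqF.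
pose gs t := (left_RL a b alpha (fun x => phi (t, x)) \_ `]a, b[).
have gsP : {ae leb, forall t, t \in `]0, T[ -> [/\ sqint leb (gs t),
    {ae leb, forall x, x \in `]a, b[ -> phi (t, x) = kop leb (jker a b alpha) (gs t) x},
    frac_trace a b alpha (fun x => phi (t, x)) b = \int[leb]_x gs t x &
    {ae leb, forall x, gs t x = g (t, x)}]}.
  apply: ae_mono gA => t ht t0T.
  have [s1 s2 s3 s4 s5] := graphA_elim ab alpha_gt0 alpha_le1 mbeta mq mbt mqt btn qtn btE qtE (ht t0T).
  have rE h : (fun x => h (t, x)) \_ `]a, b[ = (fun x => cutQ T a b h (t, x)).
    by apply/funext => x; rewrite patchE mem_setE /cutQ /inQ /= t0T.
  split => //; apply: ae_mono s5 => x; rewrite (rE w) (rE phi) => hx.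
  apply: (mulfI (lt0r_neq0 (bt_gt0 x))).
  exact: (etrans hx (esym (bg (t, x)))).
have phiJ : {ae (@lebesgue_measure R \x @lebesgue_measure R)%E, forall z, phi0 z = op2 leb k g z}.
  have Ed := EB_sub Ephi (EJ Eg); have [md _] := EQ_sqint Ed.
  suff : {ae (@lebesgue_measure R \x @lebesgue_measure R)%E, forall z,
      (fun z => phi0 z - op2 leb k g z) z = 0}.
    by apply: ae_mono => z /eqP; rewrite subr_eq0 => /eqP.
  apply: prod_ae0 => //; have [mg _] := EQ_sqint Eg.
  apply: ae_mono gsP => t ht.
  have [t0T|t0T] := boolP ((t : R) \in `]0, T[); last first.
    by apply: ae_all => x; rewrite (EQ_out Ed)// /inQ /= (negbTE t0T).
  have [[ms _] s2 _ s4] := ht t0T; apply: ae_mono s2 => x hx.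
  have [xab|xab] := boolP ((x : R) \in `]a, b[); last first.
    by rewrite (EQ_out Ed)// /inQ /= (negbTE xab) andbF.
  apply/eqP; rewrite subr_eq0 /phi0 cutI// hx//; apply/eqP.
  apply: (kop_side_eq (fractional_side_left ab) (cker alpha) x alpha_gt0 ms).
    exact: (measurable_pair1 t mg).
  by apply: ae_mono s4 => s hs _.
exists g; split; [|exact: phiW|exact: J0|].
- split; [exact: Epsi|exact: Ew|exact: Eg| |].
  + exact: (elliptic_intro Ew Eg Ephi phiJ bg).
  + move=> z Ez; have EWp := EW Epsi.
    have [m1 _] := EQ_sqint EWp; have [m2 _] := EQ_sqint (EJ Eg).
    have [m3 _] := EQ_sqint Ez.
    apply: (ip_ae m1 m2 m3 m3 _ (ae_all _ (fun y => erefl))).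
    by apply: ae_mono2 phiW phiJ => y e1 e2; rewrite -e1 e2.
- have [mg _] := EQ_sqint Eg; apply: ae_mono gsP => t ht t0T.
  have [[ms _] _ -> s4] := ht t0T.
  by apply: (Rintegral_ae ms _ s4); exact: (measurable_pair1 t mg).
Qed.

Lemma sqint_tensor u v : sqint leb u -> sqint leb v ->
  sqint leb2 (fun z => u z.1 * v z.2) /\
  ip leb2 (fun z => u z.1 * v z.2) (fun z => u z.1 * v z.2) = ip leb u u * ip leb v v.
Proof.
move=> su sv; have [mu _] := su; have [mv _] := sv.
have m : measurable_fun setT (fun z : R * R => u z.1 * v z.2).
  apply: measurable_funM; first exact: (measurableT_comp mu measurable_fst).
  exact: (measurableT_comp mv measurable_snd).
have e : (\int[leb2]_z ((u z.1 * v z.2) ^+ 2)%:E = (ip leb u u * ip leb v v)%:E)%E.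
  rewrite fubini_tonelli1//=; last 2 first.
  - exact: measurable_sqE.
  - by move=> z; rewrite lee_fin sqr_ge0.
  transitivity (\int[leb]_t ((ip leb v v)%:E * (u t ^+ 2)%:E))%E.
    apply: eq_integral => t _; rewrite /fubini_F /=.
    rewrite (ip_sqE sv) muleC -ge0_integralZl_EFin ?sqr_ge0//.
    + by apply: eq_integral => x _; rewrite exprMn EFinM.
    + by move=> x _; rewrite lee_fin sqr_ge0.
    + exact: measurable_sqE.
  rewrite ge0_integralZl_EFin ?ip_ge0//.
  - by rewrite -(ip_sqE su) -EFinM mulrC.
  - by move=> x _; rewrite lee_fin sqr_ge0.
  - exact: measurable_sqE.
have s : sqint leb2 (fun z => u z.1 * v z.2) by split => //; rewrite e ltry.
by split => //; apply: EFin_inj; rewrite (ip_sqE s).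
Qed.

Let lT : R -> R -> R := fun t s => l s t.
Let slT : schur leb lT Cl. Proof. exact: schur_transpose. Qed.
Let lTout t s : ~~ ((t \in `]0, T[) && (s \in `]0, T[)) -> lT t s = 0.
Proof. by rewrite andbC; exact: jkerT_out. Qed.

(** Data on a face of [Q] become densities on [Q], constant in the transverse variable, because the
    traces of [phi] are full integrals: of [psi] in time, of [g] in space. *)
Definition initial_source u : R * R -> R := fun z => itv_ind 0 T z.1 * (u \_ `]a, b[) z.2.

Definition boundary_source v : R * R -> R := fun z => (v \_ `]0, T[) z.1 * itv_ind a b z.2.

Definition dual_source f u : R * R -> R := fun z =>
  op1 leb lT (cutQ T a b f) z + initial_source u z.

Lemma initial_sourceP u : sqint leb (u \_ `]a, b[) ->
  EQ T a b (initial_source u) /\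
  ip leb2 (initial_source u) (initial_source u) = T * ip leb (u \_ `]a, b[) (u \_ `]a, b[).
Proof.
move=> su; have [si iE] := sqint_itv_ind (ltW T_gt0).
have [s e] := sqint_tensor si su; split; last by rewrite e iE subr0.
split => // -[t x]; rewrite /inQ /initial_source /itv_ind /= patchE mem_setE.
by case: ifP => _; case: ifP => _; rewrite ?mul0r ?mulr0.
Qed.

Lemma boundary_sourceP v : sqint leb (v \_ `]0, T[) ->
  EQ T a b (boundary_source v) /\
  ip leb2 (boundary_source v) (boundary_source v) =
    (b - a) * ip leb (v \_ `]0, T[) (v \_ `]0, T[).
Proof.
move=> sv; have [si iE] := sqint_itv_ind (ltW ab).
have [s e] := sqint_tensor sv si; split; last by rewrite e iE mulrC.
split => // -[t x]; rewrite /inQ /boundary_source /itv_ind /= patchE mem_setE.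
by case: ifP => _; case: ifP => _; rewrite ?mul0r ?mulr0.
Qed.

Lemma EQ_dual_source f u : sqint leb2 (cutQ T a b f) -> sqint leb (u \_ `]a, b[) ->
  EQ T a b (dual_source f u) /\
  ip leb2 (dual_source f u) (dual_source f u) <=
    2 * (Cl ^+ 2 * ip leb2 (cutQ T a b f) (cutQ T a b f)) +
    2 * (T * ip leb (u \_ `]a, b[) (u \_ `]a, b[)).
Proof.
have arith (x1 x2 x3 y : R) : x1 <= y -> 0 <= x1 - 2 * x2 + x3 ->
    x1 + 2 * x2 + x3 <= 2 * y + 2 * x3 by move=> h1 h2; lra.
move=> sf su; have [EY <-] := initial_sourceP su.
have Ef : EQ T a b (cutQ T a b f).
  by split => // z zQ; rewrite /cutQ (negbTE zQ).
have EWf : EQ T a b (op1 leb lT (cutQ T a b f)) by exact: (EQ_op1 slT lTout Ef).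
split; first exact: (shD (EQ_semihilbert (R := R) T a b) EWf EY).
have H := @sqint_semihilbert R _ _ leb2.
have sW := EQ_sqint EWf; have sY := EQ_sqint EY.
have h1 := sh_sqD H sW sY; have h2 := sh_sqB H sW sY.
have h3 : ip leb2 (op1 leb lT (cutQ T a b f)) (op1 leb lT (cutQ T a b f)) <=
    Cl ^+ 2 * ip leb2 (cutQ T a b f) (cutQ T a b f) by exact: op1_bounded slT sf.
have h4 : 0 <= ip leb2 (fun z => op1 leb lT (cutQ T a b f) z - initial_source u z)
   (fun z => op1 leb lT (cutQ T a b f) z - initial_source u z) by exact: ip_ge0.
move: h1 h2 h3 h4.
set X1 := ip leb2 (op1 leb lT _) (op1 leb lT _); set X2 := ip leb2 (op1 leb lT _) (initial_source u).
set X3 := ip leb2 (initial_source u) (initial_source u).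
move=> h1 h2 h3 h4.
have e1 : ip leb2 (dual_source f u) (dual_source f u) = X1 + 2 * X2 + X3 := h1.
have e2 : ip leb2 (fun z => op1 leb lT (cutQ T a b f) z - initial_source u z)
   (fun z => op1 leb lT (cutQ T a b f) z - initial_source u z) = X1 - 2 * X2 + X3 := h2.
rewrite e1; rewrite e2 in h4.
exact: (arith _ _ _ _ h3 h4).
Qed.

Lemma initial_source_ip u psi (J0 : R -> R) : sqint leb (u \_ `]a, b[) ->
  measurable_fun `]a, b[ J0 -> EQ T a b psi ->
  {ae leb, forall x, x \in `]a, b[ -> J0 x = tail_int T psi 0 x} ->
  \int[leb]_(x in `]a, b[) (u x * J0 x) = ip leb2 (initial_source u) psi.
Proof.
move=> su mJ Epsi JE; have [EY _] := initial_sourceP su.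
have [mY _] := EQ_sqint EY; have [mpsi _] := EQ_sqint Epsi; have [mu _] := su.
have [mi _] := (sqint_itv_ind (ltW T_gt0)).1.
rewrite (ip_swap leb leb mY mpsi) ip_sections; [|exact: (sqint_swap (EQ_sqint EY))|exact: (sqint_swap (EQ_sqint Epsi))].
have mI := measurable_tail_int T 0 mpsi.
have e1 : \int[leb]_(x in `]a, b[) (u x * J0 x) =
    \int[leb]_x ((u \_ `]a, b[) x * tail_int T psi 0 x).
  apply: Rintegral_itv_ae.
  - by apply: measurable_funM => //; exact: measurable_restrict_itv mu.
  - exact: measurable_funM mu mI.
  - by apply: ae_mono JE => x h xab; rewrite h// patchE mem_setE xab.
  - by move=> x xab; rewrite patchE mem_setE (negbTE xab) mul0r.
rewrite e1; apply: eq_Rintegral => x _; rewrite /ip /initial_source /=.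
have mp := measurable_pair2 x mpsi.
have -> : tail_int T psi 0 x = \int[leb]_t (itv_ind 0 T t * psi (t, x)).
  rewrite /tail_int [LHS]Rintegral_mkcond; apply: eq_Rintegral => t _.
  by rewrite /itv_ind patchE mem_setE; case: ifP => _; rewrite ?mul1r ?mul0r.
rewrite -Rintegral_scale; last exact: (measurable_funM mi mp).
by apply: eq_Rintegral => t _; rewrite mulrA [itv_ind _ _ _ * _]mulrC.
Qed.

Lemma boundary_source_ip v g (tr : R -> R) : sqint leb (v \_ `]0, T[) ->
  EQ T a b g -> {ae leb, forall t, t \in `]0, T[ -> tr t = \int[leb]_x g (t, x)} ->
  \int[leb]_(t in `]0, T[) (v t * tr t) = ip leb2 (boundary_source v) g.
Proof.
move=> sv Eg trE; have [EV _] := boundary_sourceP sv.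
have [mg _] := EQ_sqint Eg; have [mv _] := sv.
rewrite ip_sections; [|exact: (EQ_sqint EV)|exact: (EQ_sqint Eg)].
have mG := @measurable_param_Rintegral _ _ _ _ _ leb g mg.
(* [tr] is known through an almost everywhere identity only, so its integral is exchanged for that
   of a measurable function. *)
rewrite Rintegral_mkcond (@Rintegral_ae_nonmeasurable _ _ _ leb _
  (fun t => (v \_ `]0, T[) t * \int[leb]_x g (t, x))).
- apply: eq_Rintegral => t _; rewrite /ip /boundary_source /=.
  rewrite -Rintegral_scale; last exact: (measurable_pair1 t mg).
  apply: eq_Rintegral => x _; rewrite /itv_ind; case: ifPn => xab; first by rewrite mulr1.
  by rewrite (EQ_out Eg) ?mulr0// /inQ /= (negbTE xab) andbF.
- exact: measurable_funM mv mG.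
- apply: ae_mono trE => t h; rewrite !patchE mem_setE; case: ifP => t0T; first by rewrite h.
  by rewrite mul0r.
Qed.

Lemma in_Psi_rhs f u v phi w psi (J : R -> R -> R) : sqint leb2 (cutQ T a b f) ->
  sqint leb (u \_ `]a, b[) -> sqint leb (v \_ `]0, T[) ->
  in_Psi T a b gamma alpha beta q phi w psi J ->
  exists g, backwardQ T a b l k bt qt (cutQ T a b psi) (cutQ T a b w) g /\
    \int[leb2]_(z in domQ T a b) (f z * phi z) + \int[leb]_(x in `]a, b[) (u x * J 0 x) +
    \int[leb]_(t in `]0, T[) (v t * frac_trace a b alpha (fun x => phi (t, x)) b) =
    ip leb2 (dual_source f u) (cutQ T a b psi) + ip leb2 (boundary_source v) g.
Proof.
move=> sf su sv Psi; have [g [bw phiW J0 trE]] := in_Psi_backward Psi.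
have [Epsi Ew Eg _ _] := bw; exists g; split; first exact: bw.
have [_ _ _ [[Jc _] _] _] := Psi.
have mJ0 : measurable_fun `]a, b[ (J 0).
  have T0 : 0 \in `[0, T] by rewrite in_itv /= lexx ltW.
  by have /inLp2P[mJ _] := Jc 0 T0; exact: measurable_restrict_itv.
rewrite (initial_source_ip su mJ0 Epsi J0) (boundary_source_ip sv Eg trE); congr (_ + _).
have [EY _] := initial_sourceP su.
have Ef : EQ T a b (cutQ T a b f).
  by split => // z zQ; rewrite /cutQ (negbTE zQ).
have EWf : EQ T a b (op1 leb lT (cutQ T a b f)) by exact: (EQ_op1 slT lTout Ef).
have e1 := ipDl (EQ_sqint EWf) (EQ_sqint EY) (EQ_sqint Epsi).
apply: (etrans _ (esym e1)); congr (_ + _).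
rewrite Rintegral_domQ; have e2 := op1_adjoint sl (EQ_sqint Epsi) sf.
rewrite [RHS]ipC -e2 ipC.
have [mf _] := sf; have [mW _] := op1_sqint sl (EQ_sqint Epsi).
have [/inLpQP[mphi _] _ _ _ _] := Psi.
have e3 := ip_ae mf mf mphi mW (ae_all _ (fun y => erefl)) phiW.
apply: (etrans _ e3); apply: eq_Rintegral => z _; rewrite /cutQ.
by case: ifP => _; rewrite ?mul0r.
Qed.

Lemma lhs_ip (y phi psi : R * R -> R) :
  \int[leb2]_(z in domQ T a b) (y z * (phi z + psi z)) =
  ip leb2 (cutQ T a b y) (fun z => cutQ T a b phi z + cutQ T a b psi z).
Proof.
rewrite Rintegral_domQ; apply: eq_Rintegral => z _; rewrite /cutQ.
by case: ifP => _; rewrite ?mul0r.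
Qed.

Lemma cutQ_EQ h : EQ T a b h -> cutQ T a b h = h.
Proof. by move=> Eh; apply/funext => z; rewrite /cutQ; case: ifPn => // zQ; rewrite (EQ_out Eh). Qed.

Lemma weak_solution_exists : exists C, 0 <= C /\ forall f u v,
  sqint leb2 (cutQ T a b f) -> sqint leb (u \_ `]a, b[) -> sqint leb (v \_ `]0, T[) ->
  exists y, [/\ EQ T a b y, very_weak_solution T a b gamma alpha beta q f u v y &
    ip leb2 y y <= C * (ip leb2 (dual_source f u) (dual_source f u) +
                        ip leb2 (boundary_source v) (boundary_source v))].
Proof.
have [C [C0 H]] := backwardQ_dual sl sk jkerT_out jker_out
  jkerT_positive jkerT_injective mbt mqt beta0_gt0 bt_ge qt_ge0 btM qtM.
exists C; split => // f u v sf su sv.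
have [Ep _] := EQ_dual_source sf su; have [EV _] := boundary_sourceP sv.
have [y [Ey yC yH]] := H _ _ Ep EV; exists y; split => //.
split; first by apply/inLpQP; rewrite (cutQ_EQ Ey); exact: (EQ_sqint Ey).
move=> phi w psi J Psi; have [g [bw ->]] := in_Psi_rhs sf su sv Psi.
rewrite lhs_ip (cutQ_EQ Ey); exact: yH bw.
Qed.

Lemma weak_solution_unique f u v y y' :
  very_weak_solution T a b gamma alpha beta q f u v y ->
  very_weak_solution T a b gamma alpha beta q f u v y' ->
  {ae (@lebesgue_measure R \x @lebesgue_measure R)%E, forall z,
     cutQ T a b y' z = cutQ T a b y z}.
Proof.
move=> [/inLpQP sy Hy] [/inLpQP sy' Hy'].
have Ey : EQ T a b (cutQ T a b y) by split => // z zQ; rewrite /cutQ (negbTE zQ).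
have Ey' : EQ T a b (cutQ T a b y') by split => // z zQ; rewrite /cutQ (negbTE zQ).
have Ed := EB_sub Ey' Ey.
suff d0 : ip leb2 (fun z => cutQ T a b y' z - cutQ T a b y z)
    (fun z => cutQ T a b y' z - cutQ T a b y z) = 0.
  by apply: ae_mono (ip_eq0 (EQ_sqint Ed) d0) => z /eqP; rewrite subr_eq0 => /eqP.
apply: (ellipticQ_dense sl sk jkerT_out jker_out
  jkerT_positive jkerT_injective mbt mqt beta0_gt0 bt_ge qt_ge0 btM qtM Ed) => g Eg eg.
have [phi [J Psi]] := elliptic_in_Psi Ed Eg eg.
have := Hy' _ _ _ _ Psi; rewrite -(Hy _ _ _ _ Psi) !lhs_ip (cutQ_EQ (EJ Eg)) (cutQ_EQ (EW Ed)).
set s := (fun z => _) => e.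
have ss : sqint leb2 s by exact: (sqintD (EQ_sqint (EJ Eg)) (EQ_sqint (EW Ed))).
have e1 := ipBl sy' sy ss; apply: (etrans e1); apply/eqP; rewrite subr_eq0; exact/eqP.
Qed.

End Correspondence.

(** * Well-posedness *)

(** Extending by the lower bound [beta0] keeps the bounds valid on the whole line; the maximum on
    [[a, b]] is the upper one. *)
Lemma diffusion_coefficient (R : realType) (a b beta0 : R) (beta : R -> R) : a < b ->
  {within `[a, b], continuous beta} -> (forall x, x \in `[a, b] -> beta0 <= beta x) ->
  exists (bt : R -> R) (M : R), [/\ measurable_fun `]a, b[ beta, measurable_fun setT bt,
    forall x, beta0 <= bt x, forall x, bt x <= M &
    forall x, x \in `]a, b[ -> beta x = bt x].
Proof.
move=> ab bc bge; have [m mab mP] := EVT_max (ltW ab) bc.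
have mb : measurable_fun `]a, b[ beta.
  apply: (@measurable_funS _ _ _ _ `[a, b]) => //.
    by move=> x /=; exact: subset_itv_oo_cc.
  exact: subspace_continuous_measurable_fun.
exists (fun x => if x \in `]a, b[ then beta x else beta0), (beta m); split => //.
- have -> : (fun x => if x \in `]a, b[ then beta x else beta0) =
      (fun x => beta0 + ((fun x => beta x - beta0) \_ `]a, b[) x).
    by apply/funext => x; rewrite patchE mem_setE; case: ifP => _; rewrite ?addr0// addrC subrK.
  apply: measurable_funD => //; apply/(measurable_restrictT _ _).1 => //.
  by apply: measurable_funB.
- by move=> x; case: ifP => // /subset_itv_oo_cc; exact: bge.
- by move=> x; case: ifP => [/subset_itv_oo_cc|_]; [exact: mP|exact: bge].
- by move=> x ->.
Qed.

(** Clipping at 0 and at an essential bound makes both bounds hold everywhere and changes [q] on a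
    null set of []a, b[] only. *)
Lemma potential_coefficient (R : realType) (a b q0 : R) (q : R -> R) :
  inLp leb +oo%E `]a, b[ q -> 0 < q0 -> {ae leb, forall x, x \in `]a, b[ -> q0 <= q x} ->
  exists (qt : R -> R) (M : R), [/\ measurable_fun `]a, b[ q, measurable_fun setT qt,
    forall x, 0 <= qt x, forall x, qt x <= M &
    {ae leb, forall x, x \in `]a, b[ -> q x = qt x}].
Proof.
move=> qL q00 qge; pose qr := q \_ `]a, b[.
have [mq fq] : measurable_fun setT qr /\ finite_norm leb +oo%E qr.
  by move: qL; rewrite /inLp inE => /andP[]; rewrite !inE.
have [M0 qM] : exists M, {ae leb, forall x, `|qr x| <= M}.
  move: fq; rewrite /finite_norm unlock.
  (* The norm of exponent infinity is the essential supremum once the whole space has positive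
     measure. *)
  have -> : (0 < @lebesgue_measure R [set: R])%E.
    by rewrite -set_itvNyy [ltRHS]lebesgue_measure_itv /= addye// lt0y.
  set s := ess_sup _ _ => sfin.
  have h := ess_sup_ge leb (abse \o (EFin \o qr)).
  exists (fine s); have : s \is a fin_num \/ s = -oo%E.
    by move: sfin; case: (s) => [r| |] // _; [left|right].
  case=> sE; apply: ae_mono h => x /=; rewrite -/s.
    by rewrite -{1}(fineK sE) lee_fin.
  by rewrite sE leeNy_eq.
pose M := Num.max 0 M0.
exists (fun x => Num.max 0 (Num.min M (qr x))), M; split.
- by apply: measurable_restrict_itv.
- by apply: measurable_maxr => //; apply: measurable_minr.
- by move=> x; rewrite le_max lexx.
- by move=> x; rewrite ge_max le_max lexx ge_min lexx.
- apply: ae_mono2 qge qM => x h1 h2 xab.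
  have e : qr x = q x by rewrite /qr patchE mem_setE xab.
  have q0x := le_trans (ltW q00) (h1 xab).
  have qxM : q x <= M by rewrite -e /M le_max (le_trans (ler_norm _) h2) orbT.
  by rewrite e min_r// max_r.
Qed.

Lemma normL2_domQ (R : realType) (T a b : R) (f : R * R -> R) :
  sqint leb2 (cutQ T a b f) ->
  normL2 leb2 (domQ T a b) f = (Num.sqrt (ip leb2 (cutQ T a b f) (cutQ T a b f)))%:E.
Proof. by move=> sf; rewrite /normL2 restrict_domQ; exact: Lnorm2E. Qed.

Lemma weighted_sum_le (R : realType) (c1 c2 c3 x1 x2 x3 : R) :
  0 <= c1 -> 0 <= c2 -> 0 <= c3 -> 0 <= x1 -> 0 <= x2 -> 0 <= x3 ->
  2 * (c1 * x1) + 2 * (c2 * x2) + c3 * x3 <= (2 * c1 + 2 * c2 + c3) * (x1 + x2 + x3).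
Proof.
move=> p1 p2 p3 p4 p5 p6.
have -> : (2 * c1 + 2 * c2 + c3) * (x1 + x2 + x3) =
    2 * (c1 * x1) + 2 * (c2 * x2) + c3 * x3 +
    (2 * (c1 * x2) + 2 * (c1 * x3) + 2 * (c2 * x1) + 2 * (c2 * x3) + c3 * x1 + c3 * x2).
  by ring.
by rewrite lerDl !addr_ge0 ?mulr_ge0.
Qed.

Lemma sum_sqr_le (R : realType) (x1 x2 x3 : R) : 0 <= x1 -> 0 <= x2 -> 0 <= x3 ->
  x1 ^+ 2 + x2 ^+ 2 + x3 ^+ 2 <= (x1 + x2 + x3) ^+ 2.
Proof. by move=> p1 p2 p3; nra. Qed.

Theorem theorem3p6 (R : realType) (a b T : R)
    (a_ge0 : 0 <= a) (lt_ab : a < b) (T_gt0 : 0 < T)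
    (beta q : R -> R) (beta0 q0 : R)
    (beta_cont : {within `[a, b], continuous beta})
    (q_Linfty : inLp leb +oo%E `]a, b[ q)
    (beta0_gt0 : 0 < beta0) (q0_gt0 : 0 < q0)
    (beta_ge : forall x, x \in `[a, b] -> beta0 <= beta x)
    (q_ge : {ae leb, forall x, x \in `]a, b[ -> q0 <= q x})
    (gamma alpha : R)
    (gamma_gt0 : 0 < gamma) (gamma_le1 : gamma <= 1)
    (alpha_gt0 : 0 < alpha) (alpha_le1 : alpha <= 1) :
  (forall (f : R * R -> R) (y0 v : R -> R),
     inLp leb2 2%:E (domQ T a b) f ->
     inLp leb 2%:E `]a, b[ y0 ->
     inLp leb 2%:E `]0, T[ v ->
     exists y : R * R -> R,
       very_weak_solution T a b gamma alpha beta q f y0 v y /\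
       forall y' : R * R -> R,
         very_weak_solution T a b gamma alpha beta q f y0 v y' ->
         {ae leb2, forall z, domQ T a b z -> y' z = y z}) /\
  (exists C : R, 0 < C /\
     forall (f : R * R -> R) (y0 v : R -> R) (y : R * R -> R),
       inLp leb2 2%:E (domQ T a b) f ->
       inLp leb 2%:E `]a, b[ y0 ->
       inLp leb 2%:E `]0, T[ v ->
       very_weak_solution T a b gamma alpha beta q f y0 v y ->
       (normL2 leb2 (domQ T a b) y <=
        C%:E * (normL2 leb2 (domQ T a b) f + normL2 leb `]a, b[ y0 +
                normL2 leb `]0%R, T[ v))%E).
Proof.
have [bt [M1 [mbeta mbt bt_ge btM1 btE]]] := diffusion_coefficient lt_ab beta_cont beta_ge.
have [qt [M2 [mq mqt qt_ge0 qtM2 qtE]]] := potential_coefficient q_Linfty q0_gt0 q_ge.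
pose M := Num.max M1 M2.
have btM x : bt x <= M by rewrite le_max btM1.
have qtM x : qt x <= M by rewrite le_max qtM2 orbT.
have btE' : {ae leb, forall x, x \in `]a, b[ -> beta x = bt x} by exact: ae_all.
have [Cl slT] := schur_jker T_gt0 gamma_gt0 gamma_le1.
have sl := schur_transpose slT.
have [Ck sk] := schur_jker lt_ab alpha_gt0 alpha_le1.
have [C [C0 exC]] := weak_solution_exists T_gt0 lt_ab gamma_gt0 gamma_le1 alpha_gt0 alpha_le1
  sl sk mbeta mq mbt mqt beta0_gt0 bt_ge qt_ge0 btM qtM btE' qtE.
have uniq := weak_solution_unique T_gt0 lt_ab gamma_gt0 gamma_le1 alpha_gt0 alpha_le1
  sl sk mbeta mq mbt mqt beta0_gt0 bt_ge qt_ge0 btM qtM btE' qtE.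
split.
  move=> f y0 v /inLpQP sf /inLp2P sy0 /inLp2P sv.
  have [y [Ey wy _]] := exC f y0 v sf sy0 sv; exists y; split => // y' wy'.
  have := uniq f y0 v y y' wy wy'; apply: ae_mono => z; rewrite /cutQ domQE.
  by move=> h /= zQ; move: h; rewrite zQ.
(* [C] comes from the duality, [2 Cl^2] from the fractional integral of [f], [2 T] and [b - a] from
   spreading the initial and boundary data over [Q]; the 1 makes [K] positive. *)
pose K := C * (2 * Cl ^+ 2 + 2 * T + (b - a)) + 1.
have K1 : 0 <= C * (2 * Cl ^+ 2 + 2 * T + (b - a)).
  rewrite mulr_ge0// addr_ge0 ?subr_ge0 ?(ltW lt_ab)// addr_ge0//.
    by rewrite mulr_ge0// sqr_ge0.
  by rewrite mulr_ge0// ltW.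
have K0 : 0 < K by rewrite ltr_wpDl.
exists (Num.sqrt K); split; first by rewrite sqrtr_gt0.
move=> f y0 v y /inLpQP sf /inLp2P sy0 /inLp2P sv wy.
have [y1 [Ey1 wy1 y1C]] := exC f y0 v sf sy0 sv.
have [/inLpQP sy _] := wy.
(* The estimate is known for the solution [y1] built by Riesz representation; uniqueness passes it
   to [y]. *)
have yE : ip leb2 (cutQ T a b y) (cutQ T a b y) = ip leb2 y1 y1.
  have [my _] := sy; have [my1 _] := EQ_sqint Ey1.
  have h := uniq f y0 v y1 y wy1 wy; rewrite (cutQ_EQ Ey1) in h.
  exact: (ip_ae my my1 my my1 h h).
rewrite (normL2_domQ sy) (normL2_domQ sf) /normL2 (Lnorm2E sy0) (Lnorm2E sv).
rewrite -!EFinD -EFinM lee_fin yE.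
have [_ pb] := EQ_dual_source T_gt0 sl sf sy0.
have [_ vb] := boundary_sourceP lt_ab sv.
rewrite vb in y1C.
set F := ip leb2 (cutQ T a b f) (cutQ T a b f) in pb *; set Y := ip leb (y0 \_ _) _ in pb *.
set V := ip leb (v \_ _) _ in y1C *.
have F0 : 0 <= F by exact: ip_ge0.
have Y0 : 0 <= Y by exact: ip_ge0.
have V0 : 0 <= V by exact: ip_ge0.
have bound : ip leb2 y1 y1 <= K * (F + Y + V).
  apply: (le_trans y1C).
  have -> : K * (F + Y + V) =
      C * (2 * Cl ^+ 2 + 2 * T + (b - a)) * (F + Y + V) + (F + Y + V).
    by rewrite /K [LHS]mulrDl mul1r.
  apply: (@le_trans _ _ (C * (2 * Cl ^+ 2 + 2 * T + (b - a)) * (F + Y + V))); last first.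
    by rewrite lerDl !addr_ge0.
  rewrite -mulrA ler_wpM2l//; apply: (le_trans (lerD pb (lexx _))).
  by apply: weighted_sum_le; rewrite ?sqr_ge0 ?subr_ge0// ltW.
rewrite -[leRHS]ger0_norm; last by rewrite mulr_ge0 ?sqrtr_ge0// !addr_ge0 ?sqrtr_ge0.
rewrite -sqrtr_sqr ler_wsqrtr// exprMn sqr_sqrtr ?(ltW K0)//.
apply: (le_trans bound); rewrite ler_wpM2l ?(ltW K0)//.
(* From squared norms to norms: a sum of squares of nonnegative numbers is at most the square of
   their sum. *)
rewrite -{1}(sqr_sqrtr F0) -{1}(sqr_sqrtr Y0) -{1}(sqr_sqrtr V0).
by rewrite sum_sqr_le ?sqrtr_ge0.
Qed.
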